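(* Let $\mathbb{F}_q$ be a finite field with $q$ elements. (1) If $q>7$, there is no smooth plane cubic over $\mathbb{F}_q$ admitting exactly two equivalence classes of linear determinantal representations over $\mathbb{F}_q$. (2) If $q\in\{2,3,5,7\}$, there are exactly 2 projective equivalence classes of smooth plane cubics over $\mathbb{F}_q$ admitting exactly two equivalence classes of linear determinantal representations over $\mathbb{F}_q$. (3) If $q=4$, there are exactly 4 such projective equivalence classes. Representatives are: for $q=2$: $X^2Z+XY^2+YZ^2$ and $X^2Z+XZ^2+Y^3$; for $q=3$: $X^2Z+XY^2+YZ^2+2XYZ$ and $X^2Z-XZ^2-XYZ-Y^3$; for $q=4$: $X^2Z+XY^2+\omega YZ^2$, $X^2Z+XY^2+(\omega+1)YZ^2$, $X^2Z+XZ^2+\omega Y^3$ and $X^2Z+XZ^2+(\omega+1)Y^3$; for $q=5$: $X^2Z+XY^2+YZ^2-2XYZ$ and $X^2Z-XZ^2-2XYZ-Y^3$; for $q=7$: $X^2Z+XY^2+3YZ^2$ and $X^2Z-XZ^2+3Y^3$ (each curve given as the zero locus of the displayed form).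
   Context: A smooth plane cubic $C\subset\mathbb{P}^2$ over $\mathbb{F}_q$ is defined by a ternary cubic form $F$ over $\mathbb{F}_q$. A linear determinantal representation of $C$ over $\mathbb{F}_q$ is a $3\times3$ matrix $M$ of $\mathbb{F}_q$-linear forms in $X,Y,Z$ with $F=\lambda\det(M)$ for some $\lambda\in\mathbb{F}_q^\times$; two such $M,M'$ are equivalent if $M'=AMB$ for some $A,B\in\mathrm{GL}_3(\mathbb{F}_q)$. Two smooth plane cubics $C,C'$ over $\mathbb{F}_q$ are projectively equivalent if there is an automorphism of $\mathbb{P}^2$ over $\mathbb{F}_q$ inducing an isomorphism $C\cong C'$. $\omega\in\mathbb{F}_4$ denotes an element with $\omega^2+\omega+1=0$. *)

(* Defs.v *)
From HB Require Import structures.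
From mathcomp Require Import all_boot all_order all_algebra all_field.
From mathcomp Require Import mpoly.
Set Implicit Arguments. Unset Strict Implicit. Unset Printing Implicit Defensive.
Import GRing.Theory.
Local Open Scope ring_scope.

Definition i0 : 'I_3 := @Ordinal 3 0 isT.
Definition i1 : 'I_3 := @Ordinal 3 1 isT.
Definition i2 : 'I_3 := @Ordinal 3 2 isT.
Definition vX {K : ringType} : {mpoly K[3]} := 'X_i0.
Definition vY {K : ringType} : {mpoly K[3]} := 'X_i1.
Definition vZ {K : ringType} : {mpoly K[3]} := 'X_i2.

Definition singular_point {K L : fieldType} (f : {rmorphism K -> L})
    (F : {mpoly K[3]}) (v : 'I_3 -> L) : Prop :=
  (exists i, v i != 0) /\
  (map_mpoly f F).@[v] = 0 /\
  (forall i : 'I_3, (map_mpoly f (mderiv i F)).@[v] = 0).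

(* F is a ternary cubic form defining a smooth plane cubic: F is nonzero,
   homogeneous of degree 3, and the curve has no singular point over any
   field extension of K (equivalently, over an algebraic closure). *)
Definition smooth_plane_cubic {K : fieldType} (F : {mpoly K[3]}) : Prop :=
  F != 0 /\ F \is 3.-homog /\
  forall (L : fieldType) (f : {rmorphism K -> L}) (v : 'I_3 -> L),
    ~ singular_point f F v.

Definition lin_det_rep {K : fieldType} (F : {mpoly K[3]})
    (M : 'M[{mpoly K[3]}]_3) : Prop :=
  (forall i j, M i j \is 1.-homog) /\
  exists lambda : K, lambda != 0 /\ F = lambda *: \det M.

Definition ldr_equiv {K : fieldType} (M M' : 'M[{mpoly K[3]}]_3) : Prop :=
  exists A B : 'M[K]_3, A \in unitmx /\ B \in unitmx /\
    M' = map_mx (fun c => c%:MP) A *m M *m map_mx (fun c => c%:MP) B.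

Definition exactly_two_ldr_classes {K : fieldType} (F : {mpoly K[3]}) : Prop :=
  exists M1 M2, lin_det_rep F M1 /\ lin_det_rep F M2 /\ ~ ldr_equiv M1 M2 /\
    forall M, lin_det_rep F M -> ldr_equiv M1 M \/ ldr_equiv M2 M.

Definition lin_subst {K : fieldType} (A : 'M[K]_3) : 3.-tuple {mpoly K[3]} :=
  [tuple \sum_(j < 3) (A i j)%:MP * 'X_j | i < 3].

(* Projective equivalence of the plane curves defined by F and G: an
   element of PGL_3(K) carrying one curve onto the other, i.e.
   G = mu * F(A x) with A in GL_3(K), mu <> 0. *)
Definition proj_equiv {K : fieldType} (F G : {mpoly K[3]}) : Prop :=
  exists (A : 'M[K]_3) (mu : K), A \in unitmx /\ mu != 0 /\
    G = mu *: (F \mPo lin_subst A).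

Definition two_ldr_cubic {K : fieldType} (F : {mpoly K[3]}) : Prop :=
  smooth_plane_cubic F /\ exactly_two_ldr_classes F.

Definition classes_represented_by {K : fieldType} (reps : seq {mpoly K[3]}) :
    Prop :=
  (forall F, F \in reps -> two_ldr_cubic F) /\
  (forall i j, (i < j < size reps)%N ->
     ~ proj_equiv (nth 0 reps i) (nth 0 reps j)) /\
  (forall G, two_ldr_cubic G -> exists2 F, F \in reps & proj_equiv F G).

(* Main.v *)
Require Import Defs.
From HB Require Import structures.
From mathcomp Require Import all_boot all_order all_algebra all_field.
From mathcomp Require Import mpoly.
From mathcomp Require Import ring.
Import GRing.Theory.
Local Open Scope ring_scope.
Set Implicit Arguments. Unset Strict Implicit. Unset Printing Implicit Defensive.

(** Conceptually, the classes of representations correspond to the nonzero rational points of the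
    Jacobian, one fewer than the rational points of C; the residual point S makes this explicit with
    linear algebra only.

    If C has three points, they form a torsor under a group of order 3. Sending a point to the third
    intersection of its tangent with C acts on them as a translation P -> P + k, because -2 = 1
    modulo 3. The case k = 0 gives three flexes and k != 0 gives the cyclic case.

    Lang's theorem usually rests on the surjectivity of Frob - 1 on the Jacobian. Here it is
    replaced by one explicit function, a coordinate of Frob P - P, which without rational points has
    no poles.

    The bound q > 7 is what Hasse's inequality q + 1 - 2 sqrt q <= 3 predicts. The power sums give
    the same bound for another reason: the third power of the function that is summed has degree 6,
    and sums of x^n over nonzero x vanish only for 0 < n < q - 1. *)

(** Fix a rational point P of a smooth cubic C. The kernel of a determinantal
   representation at P singles out another rational point S, any S other than P
   occurs, and S determines the representation up to equivalence. So C has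
   exactly two classes if and only if it has exactly three rational points.
   That C has a point at all is Lang's theorem for the genus one curve C.

   If C has exactly three points, either the tangent lines permute them
   cyclically or all three are flexes. This leads to the normal forms
   X^2 Z + X Y^2 + b Y Z^2 + c X Y Z and X^2 Z - X Z^2 - c X Y Z - b Y^3. In
   either form, a further point is a solution of x1 + x2 + x3 = - c
   (respectively c), x1 x2 x3 = b. Power sums show that such a system is
   solvable for all b != 0 as soon as q > 7. In the small fields the unsolvable
   pairs (b, c) are found by inspection, up to (b, c) -> (t^3 b, t c). *)

(** * Ternary cubics *)

(** Cubics are stored as coefficient tuples over an arbitrary type: base change is then [cmap],
    polynomial identities are left to [ring], and the same formulas serve for field elements and for
    generic points in polynomial rings. *)
Record cubic (T : Type) := Cubic
  {c300 : T; c030 : T; c003 : T; c210 : T; c201 : T;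
   c120 : T; c021 : T; c102 : T; c012 : T; c111 : T}.

Definition cmap (T U : Type) (g : T -> U) (f : cubic T) : cubic U :=
  Cubic (g (c300 f)) (g (c030 f)) (g (c003 f)) (g (c210 f)) (g (c201 f))
        (g (c120 f)) (g (c021 f)) (g (c102 f)) (g (c012 f)) (g (c111 f)).

Section Cubic.
Variable R : comNzRingType.
Implicit Types (f : cubic R) (u v w : 'I_3 -> R).

Definition ceval f (x y z : R) : R :=
  c300 f * x ^+ 3 + c030 f * y ^+ 3 + c003 f * z ^+ 3
  + c210 f * x ^+ 2 * y + c201 f * x ^+ 2 * z + c120 f * x * y ^+ 2
  + c021 f * y ^+ 2 * z + c102 f * x * z ^+ 2 + c012 f * y * z ^+ 2
  + c111 f * x * y * z.

Definition cderx f (x y z : R) : R :=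
  c300 f * x ^+ 2 *+ 3 + c210 f * x * y *+ 2 + c201 f * x * z *+ 2
  + c120 f * y ^+ 2 + c102 f * z ^+ 2 + c111 f * y * z.
Definition cdery f (x y z : R) : R :=
  c030 f * y ^+ 2 *+ 3 + c120 f * x * y *+ 2 + c021 f * y * z *+ 2
  + c210 f * x ^+ 2 + c012 f * z ^+ 2 + c111 f * x * z.
Definition cderz f (x y z : R) : R :=
  c003 f * z ^+ 2 *+ 3 + c102 f * x * z *+ 2 + c012 f * y * z *+ 2
  + c201 f * x ^+ 2 + c021 f * y ^+ 2 + c111 f * x * y.

Definition cev f v := ceval f (v i0) (v i1) (v i2).

(* Coefficient of s^2 t in f (s u + t v). *)
Definition cpolar f u v :=
  cderx f (u i0) (u i1) (u i2) * v i0 + cdery f (u i0) (u i1) (u i2) * v i1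
  + cderz f (u i0) (u i1) (u i2) * v i2.

(* Coefficient of r s t in f (r u + s v + t w). *)
Definition ctri f u v w :=
  c300 f * u i0 * v i0 * w i0 *+ 6 + c030 f * u i1 * v i1 * w i1 *+ 6
  + c003 f * u i2 * v i2 * w i2 *+ 6
  + c210 f * (u i0 * v i0 * w i1 + u i0 * v i1 * w i0 + u i1 * v i0 * w i0) *+ 2
  + c201 f * (u i0 * v i0 * w i2 + u i0 * v i2 * w i0 + u i2 * v i0 * w i0) *+ 2
  + c120 f * (u i1 * v i1 * w i0 + u i1 * v i0 * w i1 + u i0 * v i1 * w i1) *+ 2
  + c021 f * (u i1 * v i1 * w i2 + u i1 * v i2 * w i1 + u i2 * v i1 * w i1) *+ 2
  + c102 f * (u i2 * v i2 * w i0 + u i2 * v i0 * w i2 + u i0 * v i2 * w i2) *+ 2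
  + c012 f * (u i2 * v i2 * w i1 + u i2 * v i1 * w i2 + u i1 * v i2 * w i2) *+ 2
  + c111 f * (u i0 * (v i1 * w i2 + v i2 * w i1)
              + u i1 * (v i0 * w i2 + v i2 * w i0)
              + u i2 * (v i0 * w i1 + v i1 * w i0)).

Definition cscale (a : R) f := cmap ( *%R a) f.

Definition cact f (A : 'M[R]_3) : cubic R :=
  let a := A^~ i0 in let b := A^~ i1 in let c := A^~ i2 in
  Cubic (cev f a) (cev f b) (cev f c) (cpolar f a b) (cpolar f a c)
        (cpolar f b a) (cpolar f b c) (cpolar f c a) (cpolar f c b)
        (ctri f a b c).

Lemma ceval_act f (A : 'M[R]_3) x y z :
  ceval (cact f A) x y z =
  ceval f (A i0 i0 * x + A i0 i1 * y + A i0 i2 * z)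
          (A i1 i0 * x + A i1 i1 * y + A i1 i2 * z)
          (A i2 i0 * x + A i2 i1 * y + A i2 i2 * z).
Proof.
rewrite /ceval /cact /cev /cpolar /ctri /cderx /cdery /cderz /ceval /=; ring.
Qed.

End Cubic.

Lemma ceval_map (R S : comNzRingType) (g : {rmorphism R -> S}) f x y z :
  ceval (cmap g f) (g x) (g y) (g z) = g (ceval f x y z).
Proof. by rewrite /ceval /= !(rmorphD, rmorphM, rmorphXn). Qed.

Lemma cderx_map (R S : comNzRingType) (g : {rmorphism R -> S}) f x y z :
  cderx (cmap g f) (g x) (g y) (g z) = g (cderx f x y z).
Proof. by rewrite /cderx /= !(rmorphD, rmorphM, rmorphXn, rmorphMn). Qed.
Lemma cdery_map (R S : comNzRingType) (g : {rmorphism R -> S}) f x y z :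
  cdery (cmap g f) (g x) (g y) (g z) = g (cdery f x y z).
Proof. by rewrite /cdery /= !(rmorphD, rmorphM, rmorphXn, rmorphMn). Qed.
Lemma cderz_map (R S : comNzRingType) (g : {rmorphism R -> S}) f x y z :
  cderz (cmap g f) (g x) (g y) (g z) = g (cderz f x y z).
Proof. by rewrite /cderz /= !(rmorphD, rmorphM, rmorphXn, rmorphMn). Qed.

Lemma ctri_map (R S : comNzRingType) (g : {rmorphism R -> S}) f u v w :
  ctri (cmap g f) (g \o u) (g \o v) (g \o w) = g (ctri f u v w).
Proof.
rewrite /ctri /=.
do 9!rewrite rmorphD; rewrite !rmorphMn.
by do 9?[congr (_ + _)]; rewrite ?rmorphM ?rmorphD ?rmorphM ?rmorphD ?rmorphM.
Qed.

Lemma cpolar_map (R S : comNzRingType) (g : {rmorphism R -> S}) f u v :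
  cpolar (cmap g f) (g \o u) (g \o v) = g (cpolar f u v).
Proof.
rewrite /cpolar /= cderx_map cdery_map cderz_map [RHS]rmorphD [in RHS]rmorphD.
by rewrite [in RHS]rmorphM [X in _ = _ + X + _]rmorphM [X in _ = _ + X]rmorphM.
Qed.

Lemma cact_map (R S : comNzRingType) (g : {rmorphism R -> S}) f (A : 'M_3) :
  cact (cmap g f) (map_mx g A) = cmap g (cact f A).
Proof.
have E f' (M : 'M[S]_3) : M = \matrix_(i, j) g (A i j) -> cact f' M =
  let a := g \o A^~ i0 in let b := g \o A^~ i1 in let c := g \o A^~ i2 in
  Cubic (cev f' a) (cev f' b) (cev f' c) (cpolar f' a b) (cpolar f' a c)
        (cpolar f' b a) (cpolar f' b c) (cpolar f' c a) (cpolar f' c b)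
        (ctri f' a b c).
  by move=> ->; rewrite /cact /cev /cpolar /ctri !mxE.
rewrite E; last by apply/matrixP => i j; rewrite !mxE.
rewrite /= !(cpolar_map g f (A^~ _) (A^~ _)).
by rewrite (ctri_map g f (A^~ _) (A^~ _) (A^~ _)) /cev !(ceval_map g f).
Qed.

Section CubicPoly.
Variable K : fieldType.
Implicit Types (f : cubic K) (F : {mpoly K[3]}).

Definition cpoly f : {mpoly K[3]} := ceval (cmap (@mpolyC 3 K) f) vX vY vZ.

Definition mn (a b c : nat) : 'X_{1..3} := [multinom [tuple a; b; c]].

Definition ccoef F : cubic K :=
  Cubic F@_(mn 3 0 0) F@_(mn 0 3 0) F@_(mn 0 0 3) F@_(mn 2 1 0) F@_(mn 2 0 1)
        F@_(mn 1 2 0) F@_(mn 0 2 1) F@_(mn 1 0 2) F@_(mn 0 1 2) F@_(mn 1 1 1).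

Lemma mnE (m : 'X_{1..3}) : m = mn (m i0) (m i1) (m i2).
Proof.
apply/mnmP => i; rewrite multinomE (tnth_nth 0%N).
by case: i => [[|[|[|//]]] hi] /=; apply: f_equal; apply: val_inj.
Qed.

Lemma mn_eq a b c a' b' c' :
  (mn a b c == mn a' b' c') = [&& a == a', b == b' & c == c'].
Proof.
apply/eqP/and3P => [/mnmP E|[/eqP-> /eqP-> /eqP->] //].
by move: (E i0) (E i1) (E i2); rewrite !multinomE !(tnth_nth 0%N) /= => -> -> ->.
Qed.

Lemma monomialE (a b c : nat) :
  vX ^+ a * vY ^+ b * vZ ^+ c = 'X_[mn a b c] :> {mpoly K[3]}.
Proof.
rewrite /vX /vY /vZ !mpolyXn -!mpolyXD; congr 'X_[_].
rewrite [LHS]mnE !mnmDE !mulmnE !mnm1E /=.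
by rewrite !mul1n !mul0n !addn0 !add0n.
Qed.

Lemma cpolyE f : cpoly f =
  c300 f *: 'X_[mn 3 0 0] + c030 f *: 'X_[mn 0 3 0] + c003 f *: 'X_[mn 0 0 3]
  + c210 f *: 'X_[mn 2 1 0] + c201 f *: 'X_[mn 2 0 1] + c120 f *: 'X_[mn 1 2 0]
  + c021 f *: 'X_[mn 0 2 1] + c102 f *: 'X_[mn 1 0 2] + c012 f *: 'X_[mn 0 1 2]
  + c111 f *: 'X_[mn 1 1 1].
Proof.
rewrite -!monomialE -!mul_mpolyC /cpoly /ceval /=.
by rewrite !expr0 !expr1 !mulr1 !mul1r !mulrA.
Qed.

Lemma ccoefK f : ccoef (cpoly f) = f.
Proof.
rewrite /ccoef cpolyE; case: f => * /=; rewrite !mcoeffD !mcoeffZ !mcoeffX !mn_eq /=.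
by rewrite !(mulr1, mulr0, addr0, add0r).
Qed.

Lemma cpoly_inj : injective cpoly.
Proof. exact: can_inj ccoefK. Qed.

Lemma homog3E F : F \is 3.-homog -> F = cpoly (ccoef F).
Proof.
move=> hF; apply/mpolyP => m; rewrite cpolyE !mcoeffD !mcoeffZ !mcoeffX.
rewrite (mnE m); move: (m i0) (m i1) (m i2) => a b c.
rewrite !mn_eq.
have [E|NE] := eqVneq (a + b + c)%N 3%N.
  rewrite /ccoef /=; set G := fun a b c => F@_(mn a b c).
  rewrite -![F@_(mn _ _ _)]/(G _ _ _); move: G => G.
  have Ea : (a < 4)%N by rewrite ltnS -E -addnA leq_addr.
  have Eb : (b < 4)%N by rewrite ltnS -E -addnA addnCA leq_addr.
  have -> : c = (3 - (a + b))%N by rewrite -E addKn.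
  have : (a + b <= 3)%N by rewrite -E leq_addr.
  move: a b Ea Eb {E} => [|[|[|[|a]]]] [|[|[|[|b]]]] // _ _ _ /=;
  by rewrite !(mulr1, mulr0, addr0, add0r).
rewrite (dhomog_nemf_coeff hF); last first.
  change (mdeg (mn a b c) != 3%N); rewrite mdegE !big_ord_recl big_ord0 /= addn0.
  rewrite !multinomE !(tnth_nth 0%N) /= addnA; exact: NE.
have ne : forall a' b' c', (a' + b' + c')%N = 3%N ->
    [&& a' == a, b' == b & c' == c] = false.
  move=> a' b' c' E; apply/and3P => -[/eqP ? /eqP ? /eqP ?].
  by subst a' b' c'; rewrite E eqxx in NE.
by rewrite !ne // !mulr0 !addr0.
Qed.

Lemma cpoly_homog f : cpoly f \is 3.-homog.
Proof.
rewrite cpolyE.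
have h : forall a b c (k : K), (a + b + c)%N = 3%N -> k *: 'X_[mn a b c] \is 3.-homog.
  move=> a b c k E; apply: rpredZ; rewrite dhomogX.
  change (mdeg (mn a b c) == 3%N); rewrite mdegE !big_ord_recl big_ord0 /=.
  by rewrite addn0 !multinomE !(tnth_nth 0%N) /= addnA E.
by rewrite !rpredD // h.
Qed.

Lemma cpolyZ a f : a *: cpoly f = cpoly (cscale a f).
Proof. by rewrite !cpolyE /= !scalerDr !scalerA. Qed.

Lemma map_cpoly (L : fieldType) (g : {rmorphism K -> L}) f (v : 'I_3 -> L) :
  (map_mpoly g (cpoly f)).@[v] = cev (cmap g f) v.
Proof.
pose h : {rmorphism {mpoly K[3]} -> L} := meval v \o map_mpoly g.
have hX i : h 'X_i = v i by rewrite /h /= map_mpolyX mevalXU.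
have hC c : h c%:MP = g c by rewrite /h /= map_mpolyC mevalC.
have Ef : cmap h (cmap (@mpolyC 3 K) f) = cmap g f.
  by case: f => *; rewrite /cmap !hC.
have E := ceval_map h (cmap (@mpolyC 3 K) f) vX vY vZ.
by rewrite Ef /vX /vY /vZ !hX in E; rewrite /cev E.
Qed.

End CubicPoly.

Lemma sum3E (V : nmodType) (E : 'I_3 -> V) : \sum_(i < 3) E i = E i0 + E i1 + E i2.
Proof.
rewrite !big_ord_recl big_ord0 addr0 addrA.
by congr (_ + _ + _); apply: f_equal; apply: val_inj.
Qed.

Lemma ord3P (P : 'I_3 -> Prop) : P i0 -> P i1 -> P i2 -> forall i, P i.
Proof.
move=> p0 p1 p2 [[|[|[|//]]] hi].
- by rewrite (_ : Ordinal hi = i0) //; apply: val_inj.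
- by rewrite (_ : Ordinal hi = i1) //; apply: val_inj.
- by rewrite (_ : Ordinal hi = i2) //; apply: val_inj.
Qed.

Lemma mulmx3K (R : comNzRingType) (A B : 'M[R]_3) : B *m A = 1%:M -> forall x y z i,
  B i i0 * (A i0 i0 * x + A i0 i1 * y + A i0 i2 * z)
  + B i i1 * (A i1 i0 * x + A i1 i1 * y + A i1 i2 * z)
  + B i i2 * (A i2 i0 * x + A i2 i1 * y + A i2 i2 * z) =
  (i == i0)%:R * x + (i == i1)%:R * y + (i == i2)%:R * z.
Proof.
move=> E x y z i; move/matrixP: E => E.
move: (E i i0) (E i i1) (E i i2); rewrite !mxE !sum3E => <- <- <-; ring.
Qed.

Lemma cder_act (R : comNzRingType) (f : cubic R) (A : 'M[R]_3) x y z :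
  let X := A i0 i0 * x + A i0 i1 * y + A i0 i2 * z in
  let Y := A i1 i0 * x + A i1 i1 * y + A i1 i2 * z in
  let Z := A i2 i0 * x + A i2 i1 * y + A i2 i2 * z in
  [/\ cderx (cact f A) x y z =
        A i0 i0 * cderx f X Y Z + A i1 i0 * cdery f X Y Z + A i2 i0 * cderz f X Y Z,
      cdery (cact f A) x y z =
        A i0 i1 * cderx f X Y Z + A i1 i1 * cdery f X Y Z + A i2 i1 * cderz f X Y Z
    & cderz (cact f A) x y z =
        A i0 i2 * cderx f X Y Z + A i1 i2 * cdery f X Y Z + A i2 i2 * cderz f X Y Z].
Proof.
rewrite /cact /cev /cpolar /ctri /cderx /cdery /cderz /ceval /=; split; ring.
Qed.

Definition csmooth (K : fieldType) (f : cubic K) :=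
  forall (L : fieldType) (g : {rmorphism K -> L}) x y z,
    ceval (cmap g f) x y z = 0 -> cderx (cmap g f) x y z = 0 ->
    cdery (cmap g f) x y z = 0 -> cderz (cmap g f) x y z = 0 ->
    [/\ x = 0, y = 0 & z = 0].

Section Forms.
Variable K : fieldType.
Implicit Types (f h : cubic K) (A B : 'M[K]_3).

Lemma mderiv_vXYZ (i : 'I_3) :
  (mderiv i vX = (i == i0)%:R :> {mpoly K[3]}) *
  (mderiv i vY = (i == i1)%:R :> {mpoly K[3]}) *
  (mderiv i vZ = (i == i2)%:R :> {mpoly K[3]}).
Proof.
by split; [split|]; rewrite mderivX mnm1E;
  move: i; apply: ord3P; rewrite /= ?scale0r // scale1r;
  rewrite (_ : (_ - _)%MM = 0%MM) ?mpolyX0 //; apply/mnmP => j; rewrite mnmBE subnn mnm0E.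
Qed.

Lemma mderiv_cpoly f :
  [/\ mderiv i0 (cpoly f) = cderx (cmap (@mpolyC 3 K) f) vX vY vZ,
      mderiv i1 (cpoly f) = cdery (cmap (@mpolyC 3 K) f) vX vY vZ
    & mderiv i2 (cpoly f) = cderz (cmap (@mpolyC 3 K) f) vX vY vZ].
Proof.
split; rewrite /cpoly /ceval /cderx /cdery /cderz !exprS expr0 !mulr1;
  rewrite !mderivD !mderivM !mderiv_vXYZ !mderivC /=; ring.
Qed.

Lemma map_cder (L : fieldType) (g : {rmorphism K -> L}) f (v : 'I_3 -> L) :
  [/\ (map_mpoly g (mderiv i0 (cpoly f))).@[v] = cderx (cmap g f) (v i0) (v i1) (v i2),
      (map_mpoly g (mderiv i1 (cpoly f))).@[v] = cdery (cmap g f) (v i0) (v i1) (v i2)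
    & (map_mpoly g (mderiv i2 (cpoly f))).@[v] = cderz (cmap g f) (v i0) (v i1) (v i2)].
Proof.
pose h : {rmorphism {mpoly K[3]} -> L} := meval v \o map_mpoly g.
have E : cmap h (cmap (@mpolyC 3 K) f) = cmap g f.
  by case: f => *; rewrite /cmap /= /h /= !map_mpolyC !mevalC.
have hX i : h 'X_i = v i by rewrite /h /= map_mpolyX mevalXU.
have Ex := cderx_map h (cmap (@mpolyC 3 K) f) vX vY vZ.
have Ey := cdery_map h (cmap (@mpolyC 3 K) f) vX vY vZ.
have Ez := cderz_map h (cmap (@mpolyC 3 K) f) vX vY vZ.
rewrite E /vX /vY /vZ !hX in Ex Ey Ez.
by have [-> -> ->] := mderiv_cpoly f; rewrite Ex Ey Ez.
Qed.

Lemma smooth_cpoly f : smooth_plane_cubic (cpoly f) <-> csmooth f.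
Proof.
split=> [[_ [_ sm]] L g x y z f0 fx fy fz|sm].
  pose v (i : 'I_3) := if i == i0 then x else if i == i1 then y else z.
  have nv : ~ exists i, v i != 0.
    move=> vn0; apply: (sm L g v); split=> //; split; first by rewrite map_cpoly.
    by have [dx dy dz] := map_cder g f v; apply: ord3P; rewrite ?dx ?dy ?dz.
  have v0 i : v i = 0 by apply/eqP; apply: contra_notT nv => ?; exists i.
  by split; [apply: (v0 i0)|apply: (v0 i1)|apply: (v0 i2)].
split; last split; last first.
- move=> L g v [[i vi] []]; rewrite map_cpoly => f0 fd.
  have [dx dy dz] := map_cder g f v.
  have fx := fd i0; have fy := fd i1; have fz := fd i2.
  rewrite dx in fx; rewrite dy in fy; rewrite dz in fz.
  have [v0 v1 v2] := sm L g _ _ _ f0 fx fy fz.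
  by move: i vi; apply: ord3P; rewrite ?v0 ?v1 ?v2 eqxx.
- exact: cpoly_homog.
apply/eqP => f0.
have Ef : f = cmap (fun=> 0) f.
  by rewrite -[LHS]ccoefK f0 /ccoef !mcoeff0.
(* The zero form would be singular at (1 : 0 : 0). *)
have [||||/eqP] := sm K idfun 1 0 0; last by rewrite oner_eq0.
all: rewrite Ef /ceval /cderx /cdery /cderz /=; ring.
Qed.

Lemma comp_cpoly f A : cpoly f \mPo lin_subst A = cpoly (cact f A).
Proof.
pose h : {rmorphism {mpoly K[3]} -> {mpoly K[3]}} := comp_mpoly (lin_subst A).
have hX i : h 'X_i = (A i i0)%:MP * 'X_i0 + (A i i1)%:MP * 'X_i1 + (A i i2)%:MP * 'X_i2.
  by rewrite /h /= comp_mpolyXU -tnth_nth tnth_mktuple sum3E.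
have Ef : cmap h (cmap (@mpolyC 3 K) f) = cmap (@mpolyC 3 K) f.
  by case: f => *; rewrite /cmap /= !comp_mpolyC.
have E := ceval_map h (cmap (@mpolyC 3 K) f) vX vY vZ.
rewrite Ef /vX /vY /vZ !hX in E.
by rewrite [RHS]/cpoly -(cact_map (@mpolyC 3 K)) ceval_act !mxE E.
Qed.

Lemma ceval_eq (R : comNzRingType) (f : cubic R) x y z x' y' z' :
  x = x' -> y = y' -> z = z' -> ceval f x y z = ceval f x' y' z'.
Proof. by move=> -> -> ->. Qed.

Lemma ceval_actM (R : comNzRingType) (f : cubic R) (A B : 'M[R]_3) x y z :
  ceval (cact (cact f A) B) x y z = ceval (cact f (A *m B)) x y z.
Proof. by rewrite !ceval_act !mxE !sum3E; apply: ceval_eq; ring. Qed.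

Lemma ceval_act1 (R : comNzRingType) (f : cubic R) x y z :
  ceval (cact f 1%:M) x y z = ceval f x y z.
Proof. by rewrite !ceval_act !mxE; apply: ceval_eq; rewrite /=; ring. Qed.

(** The pointwise identity [ceval_actM] is used at the generic point (vX, vY, vZ) over the
    polynomial ring, where the value is [cpoly] and determines the cubic. *)
Lemma cactM f A B : cact (cact f A) B = cact f (A *m B).
Proof.
apply: cpoly_inj; have := ceval_actM (cmap (@mpolyC 3 K) f)
  (map_mx (@mpolyC 3 K) A) (map_mx (@mpolyC 3 K) B) vX vY vZ.
by rewrite -map_mxM !cact_map => E; exact: E.
Qed.

Lemma cact1 f : cact f 1%:M = f.
Proof.
apply: cpoly_inj; have := ceval_act1 (cmap (@mpolyC 3 K) f) vX vY vZ.
by rewrite -(map_mx1 (@mpolyC 3 K)) cact_map => E; exact: E.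
Qed.

Lemma cactZ a f A : cact (cscale a f) A = cscale a (cact f A).
Proof.
rewrite /cact /cscale /cmap /cev /cpolar /ctri /cderx /cdery /cderz /ceval /=.
congr Cubic; ring.
Qed.

Lemma cscaleM a b f : cscale a (cscale b f) = cscale (a * b) f.
Proof. by rewrite /cscale /cmap /= !mulrA. Qed.

Lemma cscale1 f : cscale 1 f = f.
Proof. by rewrite /cscale /cmap /= !mul1r; case: f. Qed.

(** A maps singular points of [cact f A] to singular points of f: the gradient of f at the image
    point is obtained from that of [cact f A] by the chain rule for the inverse matrix. *)
Lemma csmooth_act f A : A \in unitmx -> csmooth f -> csmooth (cact f A).
Proof.
move=> uA sf L g x y z; set h := cact f A.
pose a := map_mx g A; pose b := map_mx g (invmx A).
have Eh : cmap g h = cact (cmap g f) a by rewrite cact_map.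
have Ef : cmap g f = cact (cmap g h) b.
  by rewrite cact_map /h cactM mulmxV // cact1.
have ba : b *m a = 1%:M by rewrite -map_mxM mulVmx // map_mx1.
have K3 := mulmx3K ba x y z.
have := (K3 i0, K3 i1, K3 i2).
rewrite /= !mul1r !mul0r !addr0 !add0r.
set X := _ + _ + a i0 i2 * z; set Y := _ + _ + a i1 i2 * z; set Z := _ + _ + a i2 i2 * z.
move=> [[kx ky] kz] h0 hx hy hz.
have [dx dy dz] := cder_act (cmap g h) b X Y Z.
have [X0 Y0 Z0] : [/\ X = 0, Y = 0 & Z = 0].
  apply: (sf L g X Y Z).
  - by move: h0; rewrite Eh ceval_act.
  - by rewrite Ef dx kx ky kz hx hy hz; ring.
  - by rewrite Ef dy kx ky kz hx hy hz; ring.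
  - by rewrite Ef dz kx ky kz hx hy hz; ring.
by split; rewrite -?kx -?ky -?kz X0 Y0 Z0; ring.
Qed.

Lemma proj_equiv_cpoly f h : proj_equiv (cpoly f) (cpoly h) <->
  exists A mu, [/\ A \in unitmx, mu != 0 & h = cscale mu (cact f A)].
Proof.
split=> -[A [mu []]].
  move=> uA [mu0]; rewrite comp_cpoly cpolyZ => /cpoly_inj Eh.
  by exists A, mu.
by move=> uA mu0 Eh; exists A, mu; rewrite comp_cpoly cpolyZ -Eh.
Qed.
End Forms.

(** * Linear determinantal representations *)

Lemma det3E (R : comNzRingType) (A : 'M[R]_3) : \det A =
  A i0 i0 * (A i1 i1 * A i2 i2 - A i1 i2 * A i2 i1)
  - A i0 i1 * (A i1 i0 * A i2 i2 - A i1 i2 * A i2 i0)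
  + A i0 i2 * (A i1 i0 * A i2 i1 - A i1 i1 * A i2 i0).
Proof.
have det2 (B : 'M[R]_2) : \det B = B 0 0 * B 1 1 - B 0 1 * B 1 0.
  rewrite (expand_det_row _ 0) !big_ord_recl big_ord0 addr0 /cofactor !det_mx11 !mxE /=.
  rewrite (_ : lift 0 0 = 1 :> 'I_2); last by apply: val_inj.
  rewrite (_ : lift 1 0 = 0 :> 'I_2); last by apply: val_inj.
  rewrite /= !addn0 expr0 expr1; ring.
rewrite (expand_det_row _ i0) sum3E /cofactor !det2 !mxE /=.
rewrite (_ : lift i0 0 = i1); last by apply: val_inj.
rewrite (_ : lift i0 1 = i2); last by apply: val_inj.
rewrite (_ : lift i1 0 = i0); last by apply: val_inj.
rewrite (_ : lift i1 1 = i2); last by apply: val_inj.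
rewrite (_ : lift i2 0 = i0); last by apply: val_inj.
rewrite (_ : lift i2 1 = i1); last by apply: val_inj.
rewrite (_ : (-1) ^+ (i0 + i0) = 1) ?expr0 // (_ : (-1) ^+ (i0 + i1) = -1) ?expr1 //.
rewrite (_ : (-1) ^+ (i0 + i2) = 1) ?sqrrN ?expr1n //; ring.
Qed.

Section MixedDet.
Variable R : comNzRingType.
Implicit Types A : 'I_3 -> 'M[R]_3.

(** The determinant with row 0 taken from [A i], row 1 from [A j] and row 2 from [A k]. Expanding
    det(x A_0 + y A_1 + z A_2) by rows expresses its coefficients in these. *)
Definition mixdet A (i j k : 'I_3) :=
  A i i0 i0 * (A j i1 i1 * A k i2 i2 - A j i1 i2 * A k i2 i1)
  - A i i0 i1 * (A j i1 i0 * A k i2 i2 - A j i1 i2 * A k i2 i0)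
  + A i i0 i2 * (A j i1 i0 * A k i2 i1 - A j i1 i1 * A k i2 i0).

Definition cdet A : cubic R :=
  let d i j := mixdet A i i j + mixdet A i j i + mixdet A j i i in
  Cubic (mixdet A i0 i0 i0) (mixdet A i1 i1 i1) (mixdet A i2 i2 i2)
        (d i0 i1) (d i0 i2) (d i1 i0) (d i1 i2) (d i2 i0) (d i2 i1)
        (mixdet A i0 i1 i2 + mixdet A i0 i2 i1 + mixdet A i1 i0 i2
         + mixdet A i1 i2 i0 + mixdet A i2 i0 i1 + mixdet A i2 i1 i0).

Lemma cdet_eval A (M : 'M[R]_3) x y z :
  (forall i j, M i j = A i0 i j * x + A i1 i j * y + A i2 i j * z) ->
  \det M = ceval (cdet A) x y z.
Proof. move=> EM; rewrite det3E !EM /ceval /cdet /mixdet /=; ring. Qed.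
End MixedDet.

Lemma cdet_map (R S : comNzRingType) (g : {rmorphism R -> S}) A :
  cdet (fun k => map_mx g (A k)) = cmap g (cdet A).
Proof.
have E i j k : mixdet (fun k => map_mx g (A k)) i j k = g (mixdet A i j k).
  by rewrite /mixdet !mxE !(rmorphD, rmorphN, rmorphM).
by rewrite /cdet /cmap /= !E; congr Cubic; rewrite 2?rmorphD // ?rmorphD.
Qed.

Section Tensor.
Variable K : fieldType.
Implicit Types (A : 'I_3 -> 'M[K]_3) (f : cubic K).

(** A matrix of linear forms is handled as its three coefficient matrices: equivalence multiplies
    each of them by scalar matrices, and a coordinate change on the plane mixes the three. *)
Definition rep_mx A : 'M[{mpoly K[3]}]_3 :=
  \matrix_(i, j) ((A i0 i j)%:MP * vX + (A i1 i j)%:MP * vY + (A i2 i j)%:MP * vZ).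

Lemma det_rep_mx A : \det (rep_mx A) = cpoly (cdet A).
Proof.
rewrite /cpoly -(cdet_map (@mpolyC 3 K)).
by apply: cdet_eval => i j; rewrite !mxE.
Qed.

Definition rep_at A (v : 'cV[K]_3) : 'M[K]_3 := v i0 0 *: A i0 + v i1 0 *: A i1 + v i2 0 *: A i2.

Lemma det_rep_at A v : \det (rep_at A v) = ceval (cdet A) (v i0 0) (v i1 0) (v i2 0).
Proof.
apply: cdet_eval => i j; rewrite !mxE; ring.
Qed.

Lemma homog1E (p : {mpoly K[3]}) : p \is 1.-homog ->
  p = p@_U_(i0) *: vX + p@_U_(i1) *: vY + p@_U_(i2) *: vZ.
Proof.
move=> hp; apply/mpolyP => m; rewrite !mcoeffD !mcoeffZ /vX /vY /vZ !mcoeffX.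
have [/eqP/mdeg1P [i /eqP Ei]|m1] := eqVneq (mdeg m) 1%N.
  rewrite Ei; have e j : (U_(j)%MM == U_(i)%MM :> 'X_{1..3}) = (j == i).
    by apply/eqP/eqP => [E|-> //]; have := congr1 (fun m : 'X_{1..3} => m j) E; rewrite !mnm1E eqxx; case: eqP => // ->.
  by rewrite !e; move: i {Ei e}; apply: ord3P; rewrite /= !(mulr1, mulr0, addr0, add0r).
rewrite (dhomog_nemf_coeff hp) //.
have e j : (U_(j)%MM == m) = false by apply/eqP => E; rewrite -E mdeg1 eqxx in m1.
by rewrite !e !mulr0 !addr0.
Qed.

Definition ldr f A := exists2 l : K, l != 0 & f = cscale l (cdet A).
Definition rep_eqv A A' := exists U W : 'M[K]_3,
  [/\ U \in unitmx, W \in unitmx & forall k, A' k = U *m A k *m W].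

Lemma rep_mx_mul A U W :
  rep_mx (fun k => U *m A k *m W) = map_mx (fun c => c%:MP) U *m rep_mx A *m map_mx (fun c => c%:MP) W.
Proof.
apply/matrixP => i j; rewrite !(mxE, sum3E).
rewrite !mpolyCD !mpolyCM !mpolyCD !mpolyCM; ring.
Qed.

Lemma rep_mx_inj A A' : rep_mx A = rep_mx A' -> forall k, A k = A' k.
Proof.
move=> E k; apply/matrixP => i j; have := congr1 (fun M : 'M[{mpoly K[3]}]_3 => (M i j)@_U_(k)) E.
rewrite !mxE /vX /vY /vZ !mul_mpolyC !mcoeffD !mcoeffZ !mcoeffX.
have e (a b : 'I_3) : (U_(a)%MM == U_(b)%MM :> 'X_{1..3}) = (a == b).
  by apply/eqP/eqP => [Em|-> //]; have := congr1 (fun m : 'X_{1..3} => m a) Em; rewrite !mnm1E eqxx; case: eqP => // ->.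
by rewrite !e; move: k; apply: ord3P; rewrite /= !(mulr1, mulr0, addr0, add0r).
Qed.

Lemma lin_det_repP f M : lin_det_rep (cpoly f) M <-> exists2 A, M = rep_mx A & ldr f A.
Proof.
split=> [[hM [l [l0 E]]]|[A -> [l l0 E]]].
  pose A (k : 'I_3) : 'M[K]_3 := \matrix_(i, j) (M i j)@_U_(k).
  have EM : M = rep_mx A.
    by apply/matrixP => i j; rewrite [LHS](homog1E (hM i j)) !mxE -!mul_mpolyC.
  exists A => //; exists l => //; apply: cpoly_inj.
  by rewrite -cpolyZ -det_rep_mx -EM.
split=> [i j|]; last by exists l; split=> //; rewrite det_rep_mx cpolyZ -E.
rewrite mxE !mul_mpolyC !rpredD // rpredZ // dhomogX; exact/eqP/mdeg1.
Qed.

Lemma ldr_equivP A A' : ldr_equiv (rep_mx A) (rep_mx A') <-> rep_eqv A A'.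
Proof.
split=> [[U [W [uU [uW]]]]|[U [W [uU uW E]]]].
  by rewrite -rep_mx_mul => /rep_mx_inj E; exists U, W.
exists U, W; split=> //; split=> //; rewrite -rep_mx_mul.
by apply/matrixP => i j; rewrite [LHS]mxE [RHS]mxE !E.
Qed.

Lemma rep_eqv_sym A A' : rep_eqv A A' -> rep_eqv A' A.
Proof.
move=> [U [W [uU uW E]]]; exists (invmx U), (invmx W); rewrite !unitmx_inv; split=> // k.
by rewrite E !mulmxA mulVmx // mul1mx mulmxK.
Qed.

Lemma rep_eqv_trans A B C : rep_eqv A B -> rep_eqv B C -> rep_eqv A C.
Proof.
move=> [U [W [uU uW E]]] [U' [W' [uU' uW' E']]].
exists (U' *m U), (W *m W'); rewrite !unitmx_mul uU uW uU' uW'; split=> // k.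
by rewrite E' E !mulmxA.
Qed.

Lemma cdet_mul A U W : cdet (fun k => U *m A k *m W) = cscale (\det U * \det W) (cdet A).
Proof.
apply: cpoly_inj; rewrite -det_rep_mx rep_mx_mul !det_mulmx -cpolyZ -det_rep_mx.
rewrite !(det_map_mx (@mpolyC 3 K)) -mul_mpolyC mpolyCM; ring.
Qed.

Definition rep_subst (g : 'M[K]_3) A : 'I_3 -> 'M[K]_3 := fun j => rep_at A (col j g).

Lemma rep_at_subst g A v : rep_at (rep_subst g A) v = rep_at A (g *m v).
Proof.
by apply/matrixP => i j; rewrite /rep_at /rep_subst /rep_at !mxE !sum3E; ring.
Qed.

Lemma rep_subst1 A k : rep_subst 1%:M A k = A k.
Proof.
move: k; apply: ord3P; rewrite /rep_subst /rep_at !mxE /=;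
by rewrite !(scale1r, scale0r, addr0, add0r).
Qed.

Lemma rep_substM g h A k : rep_subst h (rep_subst g A) k = rep_subst (g *m h) A k.
Proof. by rewrite {1}/rep_subst rep_at_subst colE mulmxA -colE. Qed.

Lemma cdet_sub g A : cdet (rep_subst g A) = cact (cdet A) g.
Proof.
apply: cpoly_inj; rewrite -det_rep_mx -comp_cpoly -det_rep_mx.
pose h : {rmorphism {mpoly K[3]} -> {mpoly K[3]}} := comp_mpoly (lin_subst g).
have hX i : h 'X_i = (g i i0)%:MP * 'X_i0 + (g i i1)%:MP * 'X_i1 + (g i i2)%:MP * 'X_i2.
  by rewrite /h /= comp_mpolyXU -tnth_nth tnth_mktuple sum3E.
have hC c : h c%:MP = c%:MP by rewrite /h /= comp_mpolyC.
rewrite -[RHS]/(h _) -(det_map_mx h); congr (\det _).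
apply/matrixP => i j; rewrite !mxE !(rmorphD h) !(rmorphM h) !hC /vX /vY /vZ !hX.
rewrite !mpolyCD !mpolyCM; ring.
Qed.

Lemma ldr_sub f g A : ldr f A -> ldr (cact f g) (rep_subst g A).
Proof. by case=> l l0 ->; exists l => //; rewrite cactZ cdet_sub. Qed.

Lemma ldr_eqv f A A' : rep_eqv A A' -> ldr f A -> ldr f A'.
Proof.
move=> [U [W [uU uW E]]] [l l0 Ef]; exists (l / (\det U * \det W)).
  by rewrite mulf_neq0 // invr_neq0 // mulf_neq0 // -unitfE -unitmxE.
have -> : cdet A' = cscale (\det U * \det W) (cdet A).
  by rewrite -cdet_mul /cdet /mixdet !E.
rewrite cscaleM divfK // mulf_neq0 // -unitfE -unitmxE //.
Qed.

Lemma rep_eqv_subst g A A' : rep_eqv A A' -> rep_eqv (rep_subst g A) (rep_subst g A').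
Proof.
move=> [U [W [uU uW E]]]; exists U, W; split=> // k; rewrite /rep_subst /rep_at !E.
by rewrite !mulmxDr !mulmxDl -!scalemxAr -!scalemxAl.
Qed.
End Tensor.

(** * Smooth cubics over finite fields have rational points *)

Definition swapxy (T : Type) (f : cubic T) : cubic T :=
  Cubic (c030 f) (c300 f) (c003 f) (c120 f) (c021 f)
        (c210 f) (c201 f) (c012 f) (c102 f) (c111 f).
Definition swapyz (T : Type) (f : cubic T) : cubic T :=
  Cubic (c300 f) (c003 f) (c030 f) (c201 f) (c210 f)
        (c102 f) (c012 f) (c120 f) (c021 f) (c111 f).

Section Difference.
Variable R : comNzRingType.
Implicit Types f : cubic R.

(* On pairs of points P = (x : y : z), Q = (s : t : r) of the cubic f = 0, the
   quotients gx / (y r - z t)^2 and gy / (z s - x r)^2 are the same function,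
   a Weierstrass x-coordinate of Q - P on the Jacobian. *)
Definition gx f (x y z s t r : R) : R :=
  c300 f ^+ 2 * x ^+ 2 * s ^+ 2 *+ 3
  - c300 f * c030 f * x * y * t ^+ 2 *+ 3
  - c300 f * c030 f * y ^+ 2 * s * t *+ 3
  - c300 f * c003 f * x * z * r ^+ 2 *+ 3
  - c300 f * c003 f * z ^+ 2 * s * r *+ 3
  + c300 f * c210 f * x ^+ 2 * s * t *+ 2
  + c300 f * c210 f * x * y * s ^+ 2 *+ 2
  + c300 f * c201 f * x ^+ 2 * s * r *+ 2
  + c300 f * c201 f * x * z * s ^+ 2 *+ 2
  + c300 f * c120 f * x ^+ 2 * t ^+ 2
  - c300 f * c120 f * x * y * s * t *+ 2
  + c300 f * c120 f * y ^+ 2 * s ^+ 2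
  - c300 f * c021 f * x * y * t * r *+ 2 - c300 f * c021 f * x * z * t ^+ 2
  - c300 f * c021 f * y ^+ 2 * s * r - c300 f * c021 f * y * z * s * t *+ 2
  + c300 f * c102 f * x ^+ 2 * r ^+ 2
  - c300 f * c102 f * x * z * s * r *+ 2
  + c300 f * c102 f * z ^+ 2 * s ^+ 2 - c300 f * c012 f * x * y * r ^+ 2
  - c300 f * c012 f * x * z * t * r *+ 2
  - c300 f * c012 f * y * z * s * r *+ 2 - c300 f * c012 f * z ^+ 2 * s * t
  + c300 f * c111 f * x ^+ 2 * t * r - c300 f * c111 f * x * y * s * r
  - c300 f * c111 f * x * z * s * t + c300 f * c111 f * y * z * s ^+ 2
  - c030 f * c210 f * y ^+ 2 * t ^+ 2 *+ 2
  - c030 f * c201 f * y ^+ 2 * t * r - c030 f * c201 f * y * z * t ^+ 2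
  - c003 f * c210 f * y * z * r ^+ 2 - c003 f * c210 f * z ^+ 2 * t * r
  - c003 f * c201 f * z ^+ 2 * r ^+ 2 *+ 2
  + c210 f ^+ 2 * x * y * s * t *+ 2 + c210 f * c201 f * x * y * s * r *+ 2
  + c210 f * c201 f * x * z * s * t *+ 2 + c210 f * c120 f * x * y * t ^+ 2
  + c210 f * c120 f * y ^+ 2 * s * t - c210 f * c021 f * y ^+ 2 * t * r
  - c210 f * c021 f * y * z * t ^+ 2 + c210 f * c102 f * x * y * r ^+ 2
  + c210 f * c102 f * z ^+ 2 * s * t - c210 f * c012 f * y * z * t * r *+ 2
  + c210 f * c111 f * x * y * t * r + c210 f * c111 f * y * z * s * t
  + c201 f ^+ 2 * x * z * s * r *+ 2 + c201 f * c120 f * x * z * t ^+ 2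
  + c201 f * c120 f * y ^+ 2 * s * r - c201 f * c021 f * y * z * t * r *+ 2
  + c201 f * c102 f * x * z * r ^+ 2 + c201 f * c102 f * z ^+ 2 * s * r
  - c201 f * c012 f * y * z * r ^+ 2 - c201 f * c012 f * z ^+ 2 * t * r
  + c201 f * c111 f * x * z * t * r + c201 f * c111 f * y * z * s * r
  + c120 f ^+ 2 * y ^+ 2 * t ^+ 2 + c120 f * c102 f * y ^+ 2 * r ^+ 2
  + c120 f * c102 f * z ^+ 2 * t ^+ 2 + c120 f * c111 f * y ^+ 2 * t * r
  + c120 f * c111 f * y * z * t ^+ 2 + c102 f ^+ 2 * z ^+ 2 * r ^+ 2
  + c102 f * c111 f * y * z * r ^+ 2 + c102 f * c111 f * z ^+ 2 * t * r
  + c111 f ^+ 2 * y * z * t * r.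

Definition gy f (x y z s t r : R) : R := gx (swapxy f) y x z t s r.

Lemma gx_swapyz f x y z s t r : gx (swapyz f) x z y s r t = gx f x y z s t r.
Proof. rewrite /gx /=; ring. Qed.

(** The equality of the two quotients, with explicit cofactors. It is later applied to the generic
    point and its Frobenius image, where f itself is not zero and the error terms have to be
    tracked. *)
Lemma gx_gy f x y z s t r : exists P P' : R,
  gx f x y z s t r * (z * s - x * r) ^+ 2 - gy f x y z s t r * (y * r - z * t) ^+ 2
  = ceval f x y z * P + ceval f s t r * P'.
Proof.
exists (
  c300 f * x * s ^+ 2 * r ^+ 2 *+ 3 - c300 f * z * s ^+ 3 * r *+ 6
  - c030 f * y * t ^+ 2 * r ^+ 2 *+ 3 - c003 f * z * r ^+ 4 *+ 3
  + c210 f * x * s * t * r ^+ 2 *+ 2 - c210 f * y * s ^+ 2 * r ^+ 2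
  - c210 f * z * s ^+ 2 * t * r *+ 4 + c201 f * x * s * r ^+ 3 *+ 2
  - c201 f * z * s ^+ 2 * r ^+ 2 *+ 5 + c120 f * x * t ^+ 2 * r ^+ 2
  - c120 f * y * s * t * r ^+ 2 *+ 2 - c120 f * z * s * t ^+ 2 * r *+ 2
  - c021 f * y * t * r ^+ 3 *+ 2 - c021 f * z * t ^+ 2 * r ^+ 2
  + c102 f * x * r ^+ 4 - c102 f * z * s * r ^+ 3 *+ 4
  - c012 f * y * r ^+ 4 - c012 f * z * t * r ^+ 3 *+ 2
  + c111 f * x * t * r ^+ 3 - c111 f * y * s * r ^+ 3
  - c111 f * z * s * t * r ^+ 2 *+ 3).
exists (
  c300 f * x ^+ 2 * z ^+ 2 * s *+ 3 + c030 f * y ^+ 3 * z * r *+ 6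
  - c030 f * y ^+ 2 * z ^+ 2 * t *+ 3 + c003 f * z ^+ 4 * r *+ 3
  + c210 f * x ^+ 2 * y * z * r *+ 2 - c210 f * x ^+ 2 * z ^+ 2 * t
  + c210 f * x * y * z ^+ 2 * s *+ 2 + c201 f * x ^+ 2 * z ^+ 2 * r
  + c201 f * x * z ^+ 3 * s *+ 2 + c120 f * x * y ^+ 2 * z * r *+ 4
  - c120 f * x * y * z ^+ 2 * t *+ 2 + c120 f * y ^+ 2 * z ^+ 2 * s
  + c021 f * y ^+ 2 * z ^+ 2 * r *+ 5 - c021 f * y * z ^+ 3 * t *+ 2
  + c102 f * x * z ^+ 3 * r *+ 2 + c102 f * z ^+ 4 * s
  + c012 f * y * z ^+ 3 * r *+ 4 - c012 f * z ^+ 4 * t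
  + c111 f * x * y * z ^+ 2 * r *+ 3 - c111 f * x * z ^+ 3 * t
  + c111 f * y * z ^+ 3 * s).
rewrite /gy /gx /ceval /=; ring.
Qed.
End Difference.

(** * Polynomials in two variables that vanish at all rational points *)

Section FiniteField.
Variable K : finFieldType.
Let q := #|K|.

Lemma card_pchar_nat : [pchar K].-nat q.
Proof.
have [p p_pr pK] := finPcharP K.
by rewrite (eq_pnat _ (pcharf_eq pK)) /q -cardsT; apply: pprimeChar_pgroup pK.
Qed.

Lemma exprD_card (R : comNzRingType) (g : {rmorphism K -> R}) (a b : R) :
  (a + b) ^+ q = a ^+ q + b ^+ q.
Proof.
apply: exprDn_pchar; apply: sub_in_pnat card_pchar_nat => p _.
exact: rmorph_pchar.
Qed.

Lemma ceval_card (R : comNzRingType) (g : {rmorphism K -> R}) (f : cubic K) x y z :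
  ceval (cmap g f) x y z ^+ q = ceval (cmap g f) (x ^+ q) (y ^+ q) (z ^+ q).
Proof.
have gq c : g c ^+ q = g c by rewrite -rmorphXn expf_card.
rewrite /ceval !(exprD_card g) !exprMn /= !gq. ring.
Qed.

Lemma poly_eq0_card (p : {poly K}) : (size p <= q)%N -> (forall u, p.[u] = 0) -> p = 0.
Proof.
move=> sp p0; apply: (@roots_geq_poly_eq0 _ p (enum K)); rewrite ?enum_uniq -?cardE //.
by apply/allP => u _; apply/rootP.
Qed.

Lemma rdiv_expXsubX (R : comNzRingType) (p : {poly R}) :
  exists a r : {poly R}, p = a * ('X^q - 'X) + r /\ (size r <= q)%N.
Proof.
have q1 : (1 < q)%N := finNzRing_gt1 K.
have sU : size ('X^q - 'X : {poly R}) = q.+1.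
  by rewrite size_polyDl size_polyXn // size_polyN size_polyX ltnS.
have mU : ('X^q - 'X : {poly R}) \is monic.
  by rewrite monicE lead_coefDl ?lead_coefXn // size_polyN size_polyX size_polyXn ltnS.
exists (Pdiv.CommonRing.rdivp p ('X^q - 'X)), (Pdiv.CommonRing.rmodp p ('X^q - 'X)).
split; first exact: Pdiv.RingMonic.rdivp_eq.
rewrite -ltnS -sU Pdiv.CommonRing.ltn_rmodp; exact: monic_neq0.
Qed.

(** Divide by X^q - X. The remainder has degree less than q in X, so for each v its coefficients
    vanish at v; each coefficient then vanishes on all of K and is divisible by Y^q - Y. *)
Lemma vanishing_ideal (p : {poly {poly K}}) : (forall u v : K, p.[u%:P].[v] = 0) ->
  exists a b, p = a * ('X^q - 'X) + b * ('X%:P ^+ q - 'X%:P).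
Proof.
move=> p0; have [a [r [Ep sr]]] := rdiv_expXsubX p.
have r0 u v : r.[u%:P].[v] = 0.
  move: (p0 u v); rewrite Ep !(hornerE, hornerXn).
  rewrite expf_card subrr.
  by rewrite mulr0 add0r.
have ri (v : K) (i : nat) : (r`_i).[v] = 0.
  have: map_poly (horner_eval v) r = 0.
    apply: poly_eq0_card => [|u]; first exact: leq_trans (size_poly _ _) sr.
    by have := horner_map (horner_eval v) r u%:P; rewrite /= /horner_eval hornerC r0.
  by move/polyP/(_ i); rewrite coef_map coef0.
have di (i : nat) : exists b : {poly K}, r`_i == b * ('X^q - 'X).
  have [b [s [Es ss]]] := rdiv_expXsubX r`_i; exists b.
  suff s0 : s = 0 by rewrite {1}Es s0 addr0.
  apply: poly_eq0_card => // v; have := ri v i.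
  by rewrite Es !(hornerE, hornerXn) expf_card subrr mulr0 add0r.
exists a.
have [b Eb] : exists b : nat -> {poly K}, forall i, r`_i = b i * ('X^q - 'X).
  exists (fun i => xchoose (di i)) => i; apply/eqP; exact: xchooseP (di i).
exists (\poly_(i < size r) b i); rewrite Ep; congr (_ + _).
rewrite -[LHS]coefK -polyC_exp -polyCB mulrC mul_polyC.
apply/polyP => i; rewrite coefZ !coef_poly; case: ifP => _; rewrite ?mulr0 //.
by rewrite Eb mulrC.
Qed.
End FiniteField.

Lemma rdiv_unit_lead (R : comNzRingType) (c d : R) (r h : {poly R}) (n : nat) :
  c * d = 1 -> (size r <= n)%N ->
  exists a s, h = a * (c%:P * 'X^n + r) + s /\ (size s <= n)%N.
Proof.
move=> cd sr; pose U : {poly R} := 'X^n + d%:P * r.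
have sdr : (size (d%:P * r)%R <= n)%N.
  by rewrite mul_polyC; apply: leq_trans (size_scale_leq _ _) sr.
have sU : size U = n.+1 by rewrite size_polyDl size_polyXn.
have mU : U \is monic.
  by rewrite monicE lead_coefDl ?lead_coefXn // size_polyXn.
exists (Pdiv.CommonRing.rdivp h U * d%:P), (Pdiv.CommonRing.rmodp h U); split.
  have EU : U = d%:P * (c%:P * 'X^n + r).
    by rewrite mulrDr mulrA -polyCM [d * c]mulrC cd polyC1 mul1r.
  by rewrite -mulrA -EU; exact: Pdiv.RingMonic.rdivp_eq.
rewrite -ltnS -sU Pdiv.CommonRing.ltn_rmodp; exact: monic_neq0.
Qed.

Section Chart.
Variable K : finFieldType.
Let q := #|K|.
Let P2 := {poly {poly K}}.
Let CC : {rmorphism K -> P2} := polyC \o polyC.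
Let X : P2 := 'X.
Let Y : P2 := 'X%:P.

Definition affine_cubic (f : cubic K) : P2 := ceval (cmap CC f) X Y 1.

Lemma affine_cubicE (f : cubic K) : exists2 r : P2, (size r <= 3)%N &
  affine_cubic f = (c300 f)%:P%:P * 'X^3 + r.
Proof.
pose c2 : {poly K} := (c210 f)%:P * 'X + (c201 f)%:P.
pose c1 : {poly K} := (c120 f)%:P * 'X^2 + (c111 f)%:P * 'X + (c102 f)%:P.
pose c0 : {poly K} := (c030 f)%:P * 'X^3 + (c021 f)%:P * 'X^2 + (c012 f)%:P * 'X + (c003 f)%:P.
exists (c2%:P * 'X^2 + c1%:P * 'X + c0%:P).
  apply/leq_sizeP => j j3; rewrite !(coefD, coefCM, coefXn, coefX, coefC).
  by case: j j3 => [|[|[|j]]] //= _; rewrite !mulr0 !addr0.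
rewrite /affine_cubic /ceval /c2 /c1 /c0 /= /X /Y !(rmorphD, rmorphM, rmorphXn) /=; ring.
Qed.

(** Without rational points in the chart z = 1, the polynomial 1 - F^(q-1) vanishes on K x K, hence
    lies in the ideal of U = X^q - X and V = Y^q - Y. The squares of U and V are wanted because they
    are the denominators of [gx] and [gy]. *)
Lemma chart_unit (f : cubic K) : (forall u v, ceval f u v 1 != 0) ->
  exists a b e : P2,
    1 = a * (X ^+ q - X) ^+ 2 + b * (Y ^+ q - Y) ^+ 2 + e * affine_cubic f.
Proof.
move=> nz; pose F := affine_cubic f.
have [a [b E]] : exists a b : P2, 1 - F ^+ q.-1 = a * ('X^q - 'X) + b * ('X%:P ^+ q - 'X%:P).
  apply: vanishing_ideal => u v.
  pose h : {rmorphism P2 -> K} := horner_eval v \o horner_eval u%:P.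
  have hF : h F = ceval f u v 1.
    have hC : cmap h (cmap CC f) = f.
      by case: f {nz F} => *; rewrite /cmap /= /horner_eval !hornerC.
    have := ceval_map h (cmap CC f) X Y 1.
    by rewrite hC /F /affine_cubic => <-; rewrite /= /horner_eval /X /Y !(hornerX, hornerC).
  suff: h (1 - F ^+ q.-1) = 0 by [].
  rewrite rmorphB rmorph1 rmorphXn hF.
  suff -> : ceval f u v 1 ^+ q.-1 = 1 by rewrite subrr.
  apply: (mulfI (nz u v)); rewrite -exprS mulr1 prednK ?(ltnW (finNzRing_gt1 K)) //.
  exact: expf_card.
pose e := F ^+ q.-2.
have Fe : F ^+ q.-1 = e * F.
  by rewrite /e -exprSr; congr (_ ^+ _); rewrite prednK // -ltnS prednK ?finNzRing_gt1 // ltnW ?finNzRing_gt1.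
pose U := X ^+ q - X; pose V := Y ^+ q - Y.
have E1 : 1 = a * U + b * V + e * F by rewrite -E Fe subrK.
(* Cube the relation 1 = a U + b V + e F: each monomial without F contains U^2 or V^2. *)
exists (a ^+ 3 * U + a ^+ 2 * b * V *+ 3), (b ^+ 3 * V + a * b ^+ 2 * U *+ 3).
exists (e * ((a * U + b * V) ^+ 2 *+ 3 + (a * U + b * V) * e * F *+ 3 + e ^+ 2 * F ^+ 2)).
rewrite -/U -/V -/F -[LHS](expr1n _ 3) {1}E1; ring.
Qed.

Definition gxq (f : cubic K) : P2 := gx (cmap CC f) X Y 1 (X ^+ q) (Y ^+ q) 1.
Definition gyq (f : cubic K) : P2 := gy (cmap CC f) X Y 1 (X ^+ q) (Y ^+ q) 1.

(** If gx = h V^2, gy = h U^2 and 1 = a U^2 + b V^2 modulo F, then h must be a gy + b gx. Dividing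
    by F, of degree 3 in X with unit leading coefficient [c300 f], brings the degree of h in X down
    to 2. *)
Lemma chart_function (f : cubic K) : (forall u v, ceval f u v 1 != 0) -> c300 f != 0 ->
  exists h e1 e2 : P2, [/\ (size h <= 3)%N,
    h * (Y - Y ^+ q) ^+ 2 = gxq f + e1 * affine_cubic f &
    h * (X ^+ q - X) ^+ 2 = gyq f + e2 * affine_cubic f].
Proof.
move=> nz c0; have [a [b [e E]]] := chart_unit nz.
have [r sr EF] := affine_cubicE f.
set F := affine_cubic f in E EF *.
pose h := a * gyq f + b * gxq f.
have [s [h3 [Eh sh]]] := @rdiv_unit_lead {poly K} (c300 f)%:P (c300 f)^-1%:P r h 3
  (etrans (esym (polyCM _ _)) (congr1 polyC (mulfV c0))) sr.
rewrite -EF in Eh.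
have [P [P' EP]] := gx_gy (cmap CC f) X Y 1 (X ^+ q) (Y ^+ q) 1.
rewrite -/(affine_cubic f) -/F in EP.
(* The Frobenius image of the generic point satisfies the equation modulo F, since its value is
   F^q. *)
have Fq : ceval (cmap CC f) (X ^+ q) (Y ^+ q) 1 = F * F ^+ q.-1.
  rewrite -exprS prednK ?(ltnW (finNzRing_gt1 K)) // /F /affine_cubic ceval_card.
  by rewrite expr1n.
rewrite Fq !mul1r !mulr1 -/(gxq f) -/(gyq f) in EP.
have EP' : gxq f * (X ^+ q - X) ^+ 2 = gyq f * (Y - Y ^+ q) ^+ 2 + F * (P + F ^+ q.-1 * P').
  by move/(canRL (subrK _)): EP => ->; ring.
have YY : (Y - Y ^+ q) ^+ 2 = (Y ^+ q - Y) ^+ 2 by ring.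
rewrite YY in EP' *.
have Eh3 : h3 = h - s * F by rewrite Eh addrC addKr.
move: (X ^+ q - X) (Y ^+ q - Y) E EP' => U V E EP'.
exists h3, (- e * gxq f - a * (P + F ^+ q.-1 * P') - s * V ^+ 2).
exists (- e * gyq f + b * (P + F ^+ q.-1 * P') - s * U ^+ 2); split => //.
  rewrite -[X in _ = X + _]mulr1 {1}E Eh3 /h.
  transitivity (a * (gyq f * V ^+ 2 + F * (P + F ^+ q.-1 * P')) + b * gxq f * V ^+ 2
    - a * (F * (P + F ^+ q.-1 * P')) - s * F * V ^+ 2); first by ring.
  by rewrite -EP'; ring.
rewrite -[X in _ = X + _]mulr1 {1}E Eh3 /h.
transitivity (a * gyq f * U ^+ 2 + b * (gxq f * U ^+ 2) - s * F * U ^+ 2); first by ring.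
by rewrite EP'; ring.
Qed.
End Chart.

Lemma gx_homog (R : comNzRingType) (f : cubic R) a b x y z s t r :
  gx f (a * x) (a * y) (a * z) (b * s) (b * t) (b * r) =
  (a * b) ^+ 2 * gx f x y z s t r.
Proof. rewrite /gx; ring. Qed.

Lemma ceval_homog (R : comNzRingType) (f : cubic R) a x y z :
  ceval f (a * x) (a * y) (a * z) = a ^+ 3 * ceval f x y z.
Proof. rewrite /ceval; ring. Qed.

Lemma ceval_swapyz (R : comNzRingType) (f : cubic R) x y z :
  ceval (swapyz f) x z y = ceval f x y z.
Proof. rewrite /ceval /=; ring. Qed.

Lemma gx_map (R S : comNzRingType) (g : {rmorphism R -> S}) f x y z s t r :
  gx (cmap g f) (g x) (g y) (g z) (g s) (g t) (g r) = g (gx f x y z s t r).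
Proof.
rewrite /gx /=.
rewrite !rmorphD. rewrite ?rmorphN. rewrite !rmorphMn. rewrite !rmorphM. reflexivity.
Qed.

(** * Comparison of the charts z = 1 and y = 1 inside K(y)[X] *)

Section Glue.
Variable K : finFieldType.
Let q := #|K|.
Let P2 := {poly {poly K}}.
Let CC : {rmorphism K -> P2} := polyC \o polyC.
Let Om := {fraction {poly K}}.
Let E := {poly Om}.
Let y : Om := tofrac ('X : {poly K}).
Let kap : {rmorphism K -> Om} := @tofrac {poly K} \o polyC.

Lemma y_neq0 : y != 0.
Proof. by rewrite tofrac_eq0 polyX_eq0. Qed.

Definition invy : {rmorphism {poly K} -> Om} :=
  horner_morph (fun x => mulrC y^-1 (kap x)).

Lemma invyX : invy 'X = y^-1. Proof. exact: horner_morphX. Qed.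
Lemma invyC c : invy c%:P = kap c. Proof. exact: horner_morphC. Qed.

(** r is the reversed polynomial y^N s(1/y). The bound on its size later turns an equality between a
    polynomial in y and one in 1/y into a bound on degrees. *)
Lemma invy_rev (s : {poly K}) : exists N (r : {poly K}), (size r <= N.+1)%N /\ y ^+ N * invy s = tofrac r.
Proof.
elim/poly_ind: s => [|s c [N [r [sr Er]]]].
  by exists 0%N, 0; rewrite size_poly0 rmorph0 mulr0 tofrac0.
exists N.+1, (r + c%:P * 'X^(N.+1)); split.
  apply: leq_trans (size_polyD _ _) _; rewrite geq_max (leqW sr) /=.
  by rewrite mul_polyC (leq_trans (size_scale_leq _ _)) ?size_polyXn.
rewrite rmorphD rmorphM invyX invyC mulrDr tofracD -Er tofracM tofracXn -/y.
rewrite exprSr mulrACA mulfV ?y_neq0 // mulr1.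
by congr (_ + _); rewrite mulrC.
Qed.

Definition flip0 : {rmorphism {poly K} -> E} := polyC \o invy.
(** The point with coordinates (x, z) of the chart y = 1 is written as (X / y : 1 : 1 / y) = (X : y
    : 1), while [frac_coef] embeds the chart z = 1. *)
Definition flip : {rmorphism P2 -> E} :=
  horner_morph (fun x => mulrC (y^-1%:P * 'X) (flip0 x)).

Lemma flipX : flip 'X = y^-1%:P * 'X. Proof. exact: horner_morphX. Qed.
Lemma flipC p : flip p%:P = (invy p)%:P. Proof. exact: horner_morphC. Qed.

Lemma flip_coef (h : P2) i : (flip h)`_i = y^-1 ^+ i * invy h`_i.
Proof.
rewrite -{1}[h]coefK poly_def rmorph_sum /= coef_sum.
under eq_bigr => j _ do
  rewrite -mul_polyC rmorphM rmorphXn /= flipX flipC exprMn -polyC_exp mulrA -polyCM coefCM coefXn.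
have [ih|ih] := ltnP i (size h).
  rewrite (bigD1 (Ordinal ih)) //= eqxx mulr1 big1 ?addr0; first by rewrite mulrC.
  move=> j; rewrite -val_eqE /= eq_sym => /negPf ->; by rewrite mulr0.
rewrite big1 ?(nth_default _ ih) ?rmorph0 ?mulr0 // => j _.
by rewrite gtn_eqF ?mulr0 // (leq_trans (ltn_ord j)).
Qed.

Definition frac_coef : {rmorphism P2 -> E} := map_poly (@tofrac {poly K}).

Lemma frac_coef_X : frac_coef 'X = 'X. Proof. exact: map_polyX. Qed.
Lemma frac_coef_C p : frac_coef p%:P = (tofrac p)%:P. Proof. exact: map_polyC. Qed.
Lemma coef_frac_coef (h : P2) i : (frac_coef h)`_i = tofrac h`_i. Proof. exact: coef_map. Qed.
Lemma size_frac_coef (h : P2) : (size (frac_coef h) <= size h)%N. Proof. exact: size_poly. Qed.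

(* If f has no rational point, then Frob P - P is never 0, so its x-coordinate
   is a regular function of P, hence a constant. Regularity is tested on the
   two charts z = 1 and y = 1, glued by x, y -> x / y, 1 / y. *)
Lemma difference_const (f : cubic K) :
  (forall x z y, ceval f x y z = 0 -> [/\ x = 0, y = 0 & z = 0]) ->
  exists (c : K) (e : P2), c%:P%:P * ('X ^+ q - 'X) ^+ 2 = gyq f + e * affine_cubic f.
Proof.
move=> nz.
have nz1 u v : ceval f u v 1 != 0.
  by apply/eqP => /nz [_ _ /eqP]; rewrite oner_eq0.
have nz2 u v : ceval (swapyz f) u v 1 != 0.
  by rewrite ceval_swapyz; apply/eqP => /nz [_ /eqP]; rewrite oner_eq0.
have c0 : c300 f != 0.
  apply/eqP => c0; have [|/eqP] := nz 1 0 0; last by rewrite oner_eq0.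
  by rewrite /ceval c0; ring.
have [h [e1 [e2 [sh Ex Ey]]]] := chart_function nz1 c0.
have [h' [e1' [e2' [sh' Ex' _]]]] := chart_function nz2 c0.
pose kp : {rmorphism K -> E} := polyC \o kap.
pose u : E := y%:P; pose w : E := y^-1%:P.
have uw : u * w = 1 by rewrite -polyCM mulfV ?y_neq0 // polyC1.
have iY : frac_coef 'X%:P = u := frac_coef_C _.
have pX : flip 'X = w * 'X := flipX.
have pY : flip 'X%:P = w := etrans (flipC _) (congr1 polyC invyX).
have uq : (u - u ^+ q) ^+ 2 = ((y - y ^+ q) ^+ 2)%:P.
  by rewrite polyC_exp polyCB polyC_exp.
clearbody u w.
pose F := ceval (cmap kp f) 'X u 1.
pose G := gx (cmap kp f) 'X u 1 ('X ^+ q) (u ^+ q) 1.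
have iX : frac_coef 'X = 'X := frac_coef_X.
have iC : cmap frac_coef (cmap CC f) = cmap kp f.
  by case: f {nz nz1 nz2 c0 Ex Ey Ex' F G} => *; rewrite /cmap !frac_coef_C.
have iF : frac_coef (affine_cubic f) = F.
  by rewrite /affine_cubic -(ceval_map frac_coef) iC iX iY rmorph1.
have iG : frac_coef (gxq f) = G.
  by rewrite /gxq -(gx_map frac_coef) iC !rmorphXn iX iY rmorph1.
have pC : cmap flip (cmap CC (swapyz f)) = swapyz (cmap kp f).
  by case: f {nz nz1 nz2 c0 Ex Ey Ex' F G iC iF iG} => *;
     rewrite /cmap /swapyz !flipC !invyC.
have pF : u ^+ 3 * flip (affine_cubic (swapyz f)) = F.
  rewrite /affine_cubic -(ceval_map flip) pC pX pY rmorph1 ceval_swapyz -ceval_homog.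
  by rewrite mulr1 uw mulrA uw mul1r.
have pG : (u * u ^+ q) ^+ 2 * flip (gxq (swapyz f)) = G.
  rewrite /gxq -(gx_map flip) pC !rmorphXn pX pY rmorph1 gx_swapyz -gx_homog.
  by rewrite -!exprMn !mulrA !mulr1 uw mul1r expr1n.
have I1 : frac_coef h * (u - u ^+ q) ^+ 2 = G + frac_coef e1 * F.
  by rewrite -iF -iG -rmorphM -rmorphD -Ex rmorphM rmorphXn rmorphB rmorphXn iY.
have I2 : flip h' * (u - u ^+ q) ^+ 2 = G + (u ^+ q) ^+ 2 * w * flip e1' * F.
  have Ew : (u - u ^+ q) ^+ 2 = (u * u ^+ q) ^+ 2 * (w - w ^+ q) ^+ 2.
    rewrite -exprMn mulrBr -mulrA [u ^+ q * w]mulrC mulrA uw mul1r -mulrA -exprMn uw expr1n mulr1.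
    ring.
  rewrite Ew mulrCA; have := congr1 flip Ex'.
  rewrite rmorphM rmorphXn rmorphB rmorphXn pY => ->.
  rewrite rmorphD rmorphM mulrDr pG -pF; congr (_ + _).
  move: (flip e1') (flip (affine_cubic (swapyz f))) (u ^+ q) => a b v.
  rewrite (_ : v ^+ 2 * w * a * (u ^+ 3 * b) = (u * w) * ((u * v) ^+ 2 * (a * b))); last by ring.
  by rewrite uw mul1r.
(* By [I1] and [I2], the difference times (y - y^q)^2 is a multiple of F, which has degree 3 in X;
   the difference has degree at most 2 and so is zero. *)
have Eh : frac_coef h = flip h'.
  pose D := frac_coef h - flip h'.
  have ED : (y - y ^+ q) ^+ 2 *: D = (frac_coef e1 - (u ^+ q) ^+ 2 * w * flip e1') * F.
    rewrite -mul_polyC -uq mulrC mulrBl I1 I2; ring.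
  have sD : (size D <= 3)%N.
    apply: leq_trans (size_polyD _ _) _; rewrite geq_max size_polyN.
    rewrite (leq_trans (size_frac_coef _) sh) /=; apply/leq_sizeP => j j3.
    by rewrite flip_coef nth_default ?rmorph0 ?mulr0 // (leq_trans sh').
  have yq : (y - y ^+ q) ^+ 2 != 0.
    rewrite expf_neq0 // subr_eq0 -tofracXn tofrac_eq; apply/eqP => /(congr1 (fun p : {poly K} => size p)).
    rewrite size_polyX size_polyXn => -[E1]; have := finNzRing_gt1 K.
    by rewrite -/q -E1.
  have [r sr EF] := affine_cubicE f.
  have F4 : size F = 4%N.
    rewrite -iF EF rmorphD rmorphM rmorphXn iX frac_coef_C.
    have cn : tofrac (c300 f)%:P != 0 by rewrite tofrac_eq0 polyC_eq0.
    rewrite mul_polyC size_polyDl size_scale ?size_polyXn //.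
    by rewrite ltnS (leq_trans (size_frac_coef _)).
  apply/eqP; rewrite -subr_eq0 -/D.
  suff: (y - y ^+ q) ^+ 2 *: D == 0 by rewrite scaler_eq0 (negPf yq).
  rewrite ED; set e := (X in X * F) in ED *.
  have [-> |en] := eqVneq e 0; first by rewrite mul0r.
  have := congr1 (fun p : E => size p) ED; rewrite /= size_scale // size_mul //; last first.
    by rewrite -size_poly_eq0 F4.
  rewrite F4 => sE; move: sD; rewrite sE addnS /= -size_poly_gt0 in en *.
  by rewrite addnC -[X in (_ <= X)%N]addn0 leq_add2l leqNgt en.
(* The coefficients satisfy h_i(y) = y^-i h'_i(1/y), so a nonzero h_i has degree at most -i in y:
   only a constant h_0 survives. *)
have hi i : (size (h`_i)%R + i <= 1)%N || (h`_i == 0).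
  have [-> |hn] := eqVneq h`_i 0; first by rewrite orbT.
  rewrite orbF; have := congr1 (fun p : E => p`_i) Eh.
  rewrite /= flip_coef coef_frac_coef => Ei.
  have [N [r [sr Er]]] := invy_rev h'`_i.
  have: tofrac (h`_i * 'X^(N + i)) = tofrac r.
    rewrite tofracM tofracXn -/y Ei -Er exprD mulrC -!mulrA; congr (_ * _).
    by rewrite mulrA -exprMn mulfV ?y_neq0 // expr1n mul1r.
  move/eqP; rewrite tofrac_eq => /eqP Er'.
  move: sr; rewrite -Er' size_mulXn // addnC addnA addnAC.
  by rewrite -addn1 addnC leq_add2l.
have [c Ec] : exists c, h = c%:P%:P.
  exists (h`_0)`_0; apply/polyP => -[|i].
    rewrite coefC /=; have := hi 0%N; rewrite addn0 => /orP [/size1_polyC //|/eqP ->].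
    by rewrite coef0.
  rewrite coefC /=; have := hi i.+1; rewrite addnS ltnS leqn0 addn_eq0 size_poly_eq0.
  by case/orP=> [/andP [/eqP]|/eqP].
by exists c, e2; rewrite -Ec Ey.
Qed.
End Glue.

(** Pigeonhole: a root t is nonzero because n is, and it determines s; there are q values of s and
    only q - 1 nonzero t. This yields a cubic irreducible over K with prescribed trace d and norm
    n. *)
Lemma cubic_no_root (K : finFieldType) (d n : K) : n != 0 ->
  exists s, forall t, t ^+ 3 - d * t ^+ 2 + s * t - n != 0.
Proof.
move=> n0; suff: [exists s, forall t, t ^+ 3 - d * t ^+ 2 + s * t - n != 0].
  by case/existsP => s /forallP; exists s.
apply: contraT; rewrite negb_exists => /forallP H.
have {}H s : exists t, t ^+ 3 - d * t ^+ 2 + s * t - n == 0.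
  by have := H s; rewrite negb_forall => /existsP [t]; rewrite negbK => ?; exists t.
pose g s := xchoose (H s).
have gP s : g s ^+ 3 - d * g s ^+ 2 + s * g s - n = 0 by apply/eqP; exact: xchooseP (H s).
have g0 s : g s != 0.
  by apply/eqP => E; have := gP s; rewrite E !expr0n /= !mulr0 !addr0 subrr sub0r => /eqP; rewrite oppr_eq0 (negPf n0).
have gi : injective g.
  move=> s s' E; have := gP s; rewrite -(gP s') E => /(addIr _)/addrI.
  by move/(mulIf (g0 s')).
have : (#|codom g| <= #|predC1 (0%R : K)|)%N.
  by apply/subset_leq_card/subsetP => x /codomP [s ->]; rewrite inE g0.
by rewrite card_codom // cardC1 leqNgt prednK ?leqnn // ltnW ?finNzRing_gt1.
Qed.

(** * Frobenius on an algebraically closed extension and conjugate triples *)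

Section Conjugates.
Variables (K : finFieldType) (k : closedFieldType) (i : {rmorphism K -> k}).
Let q := #|K|.

Lemma frobD (x y : k) : (x + y) ^+ q = x ^+ q + y ^+ q.
Proof. exact: exprD_card i x y. Qed.

Lemma frobN (x : k) : (- x) ^+ q = - x ^+ q.
Proof.
apply/eqP; rewrite -addr_eq0 -frobD addrC subrr expr0n /q.
by have := finNzRing_gt1 K; case: #|_|.
Qed.

Lemma frobB (x y : k) : (x - y) ^+ q = x ^+ q - y ^+ q.
Proof. by rewrite frobD frobN. Qed.

Lemma frobK (c : K) : i c ^+ q = i c.
Proof. by rewrite -rmorphXn expf_card. Qed.

Lemma frob_fixed (x : k) : x ^+ q = x -> exists c, x = i c.
Proof.
move=> E; have := congr1 (fun p : {poly k} => p.[x]) (congr1 (map_poly i) (finField_genPoly K)).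
rewrite rmorphB rmorph_prod /= map_polyXn map_polyX !hornerE E subrr => /esym/eqP.
rewrite horner_prod prodf_seq_eq0 => /hasP [c _] /=.
by rewrite rmorphB /= map_polyX map_polyC !hornerE subr_eq0 => /eqP ->; exists c.
Qed.

Lemma cubic_conjugates (c2 c1 c0 : K) :
  (forall t, t ^+ 3 + c2 * t ^+ 2 + c1 * t + c0 != 0) ->
  exists a b c : k, [/\ a ^+ q = b, b ^+ q = c & c ^+ q = a] /\
   [/\ a != b, b != c & c != a] /\
   [/\ a + b + c = - i c2, a * b + b * c + c * a = i c1 & a * b * c = - i c0].
Proof.
move=> nr; pose P (t : k) := t ^+ 3 + i c2 * t ^+ 2 + i c1 * t + i c0.
have PK c : P (i c) != 0.
  by rewrite /P -!(rmorphXn, rmorphM, rmorphD) fmorph_eq0.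
have [a Pa] : exists a, P a = 0.
  have [x Ex] := @solve_monicpoly k 3 (fun j => nth 0 [:: - i c0; - i c1; - i c2] j) isT.
  exists x; rewrite /P Ex !big_ord_recl big_ord0 /=; ring.
have Pq x : P x = 0 -> P (x ^+ q) = 0.
  move=> Px; have := congr1 (fun t => t ^+ q) Px; rewrite /= expr0n.
  have -> : (q == 0)%N = false by have := finNzRing_gt1 K; rewrite /q; case: #|_|.
  rewrite mulr0n /P !frobD !exprMn !frobK => <-; ring.
have neq x : P x = 0 -> x != x ^+ q.
  move=> Px; apply/eqP => /esym/frob_fixed [c Ec]; move: (PK c).
  by rewrite -Ec Px eqxx.
pose b := a ^+ q; have Pb : P b = 0 := Pq a Pa.
have ab : a != b := neq a Pa.
pose d := - i c2 - a - b.
have E2 : a ^+ 2 + a * b + b ^+ 2 + i c2 * (a + b) + i c1 = 0.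
  have ab' : a - b != 0 by rewrite subr_eq0.
  apply: (mulfI ab'); rewrite mulr0; have <- : P a - P b = 0 by rewrite Pa Pb subrr.
  rewrite /P; ring.
have Ec1 : i c1 = a * b + b * d + d * a.
  have -> : i c1 = (a ^+ 2 + a * b + b ^+ 2 + i c2 * (a + b) + i c1) -
    (a ^+ 2 + a * b + b ^+ 2 + i c2 * (a + b)) by ring.
  rewrite E2 /d; ring.
have Ec0 : i c0 = - (a * b * d).
  have -> : i c0 = P a - (a ^+ 3 + i c2 * a ^+ 2 + i c1 * a) by rewrite /P; ring.
  rewrite Pa Ec1 /d; ring.
have Ec2 : i c2 = - (a + b + d) by rewrite /d; ring.
have Pf x : P x = (x - a) * (x - b) * (x - d) by rewrite /P Ec0 Ec1 Ec2; ring.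
pose c := b ^+ q; have Pc : P c = 0 := Pq b Pb.
have bc : b != c := neq b Pb.
have ca : c != a.
  (* If b^q = a, Frobenius exchanges a and b and fixes the third root d, which would then be a root
     in K. *)
  apply/eqP => E; have : d ^+ q = d.
    by rewrite /d !frobB frobN frobK -/b -/c E addrAC.
  by case/frob_fixed => x Ex; move: (PK x); rewrite -Ex Pf subrr mulr0 eqxx.
have cd : c = d.
  apply/eqP; rewrite -subr_eq0; move/eqP: Pc; rewrite Pf !mulf_eq0.
  by rewrite !subr_eq0 (negPf ca) eq_sym (negPf bc).
exists a, b, c; split; [split=> // | split; [by split | rewrite cd; split]].
- rewrite cd {1}/d !frobB frobN frobK -/b -/c cd /d; ring.
- by rewrite Ec2 opprK.
- by rewrite Ec1.
- by rewrite Ec0 opprK.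
Qed.
End Conjugates.

(** The embedding of K is an argument because additivity of x -> x^q is derived from it; the
    morphism instances below can then be inferred. *)
Definition frob_of (K : finFieldType) (k : closedFieldType) of {rmorphism K -> k} :=
  fun x : k => x ^+ #|K|.

Section FrobMorphism.
Variables (K : finFieldType) (k : closedFieldType) (i : {rmorphism K -> k}).

Lemma frob_of_zmod : zmod_morphism (frob_of i).
Proof. by move=> x y; rewrite /frob_of (frobB i). Qed.

Lemma frob_of_monoid : monoid_morphism (frob_of i).
Proof. by split=> [|x y]; rewrite /frob_of ?expr1n ?exprMn. Qed.

HB.instance Definition _ := GRing.isZmodMorphism.Build k k (frob_of i) frob_of_zmod.
HB.instance Definition _ := GRing.isMonoidMorphism.Build k k (frob_of i) frob_of_monoid.

Lemma cmap_frob (f : cubic K) : cmap (frob_of i) (cmap i f) = cmap i f.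
Proof. by case: f => *; rewrite /cmap /frob_of /= !frobK. Qed.
End FrobMorphism.

Section Identities.
Variable k : fieldType.
Implicit Types (a b c u v t m n : k).

Lemma quad_eq0 u v t a b c : a != b -> b != c -> c != a ->
  u * a ^+ 2 + v * a + t = 0 -> u * b ^+ 2 + v * b + t = 0 -> u * c ^+ 2 + v * c + t = 0 ->
  [/\ u = 0, v = 0 & t = 0].
Proof.
rewrite -subr_eq0 -(subr_eq0 b) -(subr_eq0 c) => ab bc ca Ea Eb Ec.
have E1 : u * (a + b) + v = 0.
  apply: (mulfI ab); rewrite mulr0 -[RHS](subrr 0) -{1}Ea -Eb; ring.
have E2 : u * (b + c) + v = 0.
  apply: (mulfI bc); rewrite mulr0 -[RHS](subrr 0) -{1}Eb -Ec; ring.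
have u0 : u = 0.
  apply: (mulfI ca); rewrite mulr0 -[RHS](subrr 0) -{1}E2 -E1; ring.
have v0 : v = 0 by rewrite -E1 u0 mul0r add0r.
by split=> //; rewrite -Ea u0 v0 !mul0r !add0r.
Qed.

(** For e != 0, the points (a : 0 : 1), (b : 0 : 1), (c : 0 : 1) are flexes: on each of the three
    lines only e y^3 is left. *)
Definition lines_cubic (l e : k) (a b c r s t : k) : cubic k :=
  Cubic l (l * (r * s * t) + e) (- l * (a * b * c)) (l * (r + s + t)) (- l * (a + b + c))
        (l * (r * s + s * t + t * r)) (- l * (a * s * t + b * t * r + c * r * s))
        (l * (a * b + b * c + c * a)) (l * (r * b * c + s * c * a + t * a * b))
        (- l * (r * (b + c) + s * (c + a) + t * (a + b))).

Lemma lines_cubicE l e a b c r s t x y z :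
  ceval (lines_cubic l e a b c r s t) x y z =
  l * ((x - a * z + r * y) * (x - b * z + s * y) * (x - c * z + t * y)) + e * y ^+ 3.
Proof. rewrite /ceval /lines_cubic /=; ring. Qed.

(* If a, b, c are the roots of f(x, 0, 1), the function [gy] takes the same
   value at the pairs (a, b) and (b, c) only if b is a flex. *)
Lemma flex_of_gy (f : cubic k) (w a b c r s t : k) (l := c300 f) :
  l != 0 -> a != b -> b != c -> c != a ->
  c201 f = - l * (a + b + c) -> c102 f = l * (a * b + b * c + c * a) ->
  c003 f = - l * (a * b * c) ->
  c210 f = l * (r + s + t) ->
  c111 f = - l * (r * (b + c) + s * (c + a) + t * (a + b)) ->
  c012 f = l * (r * b * c + s * c * a + t * a * b) ->
  gy f a 0 1 b 0 1 = w * (b - a) ^+ 2 -> gy f b 0 1 c 0 1 = w * (c - b) ^+ 2 ->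
  c120 f * b + c021 f = l * s * (t * (b - a) + r * (b - c)).
Proof.
move=> l0 ab bc ca E201 E102 E003 E210 E111 E012 G1 G2.
have D1 : gy f a 0 1 b 0 1 * (c - b) ^+ 2 - gy f b 0 1 c 0 1 * (b - a) ^+ 2 = 0.
  rewrite G1 G2; ring.
(* After substitution of the coefficients, the difference of the two values, cleared of
   denominators, is the flex condition times a nonzero factor. *)
have D2 : l * ((b - a) * (c - b) * (a - c)) * ((b - a) * (c - b)) *
   (c120 f * b + c021 f - l * s * (t * (b - a) + r * (b - c))) = 0.
  rewrite -D1 /gy /gx /= E201 E102 E003 E210 E111 E012 -/l; ring.
apply/eqP; rewrite -subr_eq0; move/eqP: D2; rewrite !mulf_eq0 (negPf l0).
rewrite !(subr_eq0 b a) !(subr_eq0 c b) (subr_eq0 a c) (eq_sym a c) (negPf ca).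
by rewrite (eq_sym b) (negPf ab) (eq_sym c) (negPf bc).
Qed.
End Identities.

(* Without rational points, the three points on y = 0 are conjugate flexes, so
   f = l L1 L2 L3 + e y^3 with L1, L2, L3 conjugate linear forms, and a zero of
   f amounts to an element of prescribed trace and norm in the cubic extension. *)
Theorem smooth_cubic_has_point (K : finFieldType) (f : cubic K) : csmooth f ->
  exists x y z, ~ [/\ x = 0, y = 0 & z = 0] /\ ceval f x y z = 0.
Proof.
move=> sm; suff: ~~ [forall v : K * K * K,
    (ceval f v.1.1 v.1.2 v.2 == 0) ==> [&& v.1.1 == 0, v.1.2 == 0 & v.2 == 0]].
  rewrite negb_forall => /existsP [[[x y] z]] /=; rewrite negb_imply => /andP [/eqP f0 n0].
  by exists x, y, z; split=> // -[x0 y0 z0]; rewrite x0 y0 z0 !eqxx in n0.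
apply/negP => /forallP nz0.
have {nz0}nz (x z y : K) : ceval f x y z = 0 -> [/\ x = 0, y = 0 & z = 0].
  by move=> /eqP f0; have := nz0 (x, y, z); rewrite /= f0 => /and3P [/eqP-> /eqP-> /eqP->].
have [k [/= i _]] := countable_algebraic_closure K.
pose q := #|K|; pose F := cmap i f; pose l := c300 F.
have q0 : (q == 0)%N = false by have := finNzRing_gt1 K; rewrite /q; case: #|_|.
have l0 : c300 f != 0.
  apply/eqP => E; have [|/eqP] := nz 1 0 0; last by rewrite oner_eq0.
  by rewrite /ceval E; ring.
have il0 : l != 0 by rewrite fmorph_eq0.
have lq : l ^+ q = l := frobK i _.
have [t|a [b [c [[aq bq cq] [[ab bc ca] [S1 S2 S3]]]]]] := @cubic_conjugates K k i
    (c201 f / c300 f) (c102 f / c300 f) (c003 f / c300 f).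
  apply/eqP => E; have [|_ _ /eqP] := nz t 1 0; last by rewrite oner_eq0.
  rewrite -[RHS](mulr0 (c300 f)) -[X in _ = _ * X]E /ceval; field; exact: l0.
have E201 : c201 F = - l * (a + b + c).
  by rewrite S1 rmorphM fmorphV mulNr mulrN opprK mulrCA mulfV ?mulr1.
have E102 : c102 F = l * (a * b + b * c + c * a).
  by rewrite S2 rmorphM fmorphV mulrCA mulfV ?mulr1.
have E003 : c003 F = - l * (a * b * c).
  by rewrite S3 rmorphM fmorphV mulNr mulrN opprK mulrCA mulfV ?mulr1.
have [w [e Ew]] := difference_const nz.
(* The relation is evaluated at the zero (a : 0 : 1) of f, whose Frobenius image is (b : 0 : 1).
   Applying Frobenius to the outcome gives the pairs (b, c) and (c, a). *)
have [ev [evX evY evC]] : exists ev : {rmorphism {poly {poly K}} -> k},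
    [/\ ev 'X = a, ev 'X%:P = 0 & forall c, ev c%:P%:P = i c].
  pose ev0 : {rmorphism {poly K} -> k} := horner_morph (fun x => mulrC 0 (i x)).
  exists (horner_morph (fun x => mulrC a (ev0 x))); split.
  - exact: horner_morphX.
  - exact: etrans (horner_morphC _ _) (horner_morphX _).
  - move=> d; exact: etrans (horner_morphC _ _) (horner_morphC _ _).
have fa : ceval F a 0 1 = 0.
  by rewrite /ceval -/l E201 E102 E003; ring.
have G1 : gy F a 0 1 b 0 1 = i w * (b - a) ^+ 2.
  have := congr1 ev Ew; rewrite rmorphM evC rmorphXn rmorphB rmorphXn evX -/q aq => ->.
  rewrite rmorphD rmorphM /affine_cubic -(ceval_map ev) /gyq /gy -(gx_map ev).
  rewrite !rmorphXn evX evY rmorph1 -/q aq expr0n q0 mulr0n.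
  have EF : cmap ev (cmap (polyC \o polyC) f) = F.
    by rewrite /F /cmap /= !evC.
  have EF' : cmap ev (swapxy (cmap (polyC \o polyC) f)) = swapxy F.
    by rewrite /F /cmap /= !evC.
  by rewrite EF EF' fa mulr0 addr0.
pose fr : {rmorphism k -> k} := frob_of i.
have Ff : cmap fr F = F := cmap_frob i f.
have fra : fr a = b := aq. have frb : fr b = c := bq. have frc : fr c = a := cq.
have fri d : fr (i d) = i d := frobK i d.
have Gfr x y : fr (gy F x 0 1 y 0 1) = gy F (fr x) 0 1 (fr y) 0 1.
  rewrite /gy -(gx_map fr) rmorph0 rmorph1.
  by have -> : cmap fr (swapxy F) = swapxy F by rewrite -{2}Ff.
have G2 : gy F b 0 1 c 0 1 = i w * (c - b) ^+ 2.
  by rewrite -fra -frb -Gfr fra G1 rmorphM rmorphXn rmorphB fri fra frb.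
have G3 : gy F c 0 1 a 0 1 = i w * (a - c) ^+ 2.
  by rewrite -frb -frc -Gfr frb G2 rmorphM rmorphXn rmorphB fri frb frc.
pose U x := c210 F * x ^+ 2 + c111 F * x + c012 F.
have frU x : fr (U x) = U (fr x).
  have E1 : fr (c210 F) = c210 F := congr1 (@c210 k) Ff.
  have E2 : fr (c111 F) = c111 F := congr1 (@c111 k) Ff.
  have E3 : fr (c012 F) = c012 F := congr1 (@c012 k) Ff.
  by rewrite /U !rmorphD rmorphM [fr (c111 F * x)]rmorphM rmorphXn E1 E2 E3.
(* [U x] is the coefficient of y in f(x, y, 1), and l (a - b) (a - c) is the x-derivative at (a : 0
   : 1), so the tangent there is x - a z + r y = 0. These r, s, t are conjugate, and they are the
   Lagrange coefficients of [U] / l at a, b, c. *)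
pose rho x y z := U x / (l * ((x - y) * (x - z))).
have frl : fr l = l := lq.
have frr x y z : fr (rho x y z) = rho (fr x) (fr y) (fr z).
  by rewrite /rho rmorphM fmorphV !rmorphM !rmorphB frU frl.
have rhoC x y z : rho x y z = rho x z y by rewrite /rho [(x - y) * _]mulrC.
pose r := rho a b c; pose s := rho b c a; pose t := rho c a b.
have frR : fr r = s by rewrite frr fra frb frc.
have frS : fr s = t by rewrite frr fra frb frc.
have frT : fr t = r by rewrite frr fra frb frc.
have rhoE x y z : x != y -> x != z -> U x = l * rho x y z * ((x - y) * (x - z)).
  move=> xy xz; rewrite /rho; field.
  by rewrite il0 !subr_eq0 xy xz.
have [ba cb ac] : [/\ b != a, c != b & a != c] by split; rewrite eq_sym.
have [E210 E111 E012] : [/\ c210 F = l * (r + s + t),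
    c111 F = - l * (r * (b + c) + s * (c + a) + t * (a + b)) &
    c012 F = l * (r * b * c + s * c * a + t * a * b)].
  have H x : U x = l * (r * ((x - b) * (x - c)) + s * ((x - c) * (x - a)) + t * ((x - a) * (x - b))) ->
    (c210 F - l * (r + s + t)) * x ^+ 2 +
    (c111 F + l * (r * (b + c) + s * (c + a) + t * (a + b))) * x +
    (c012 F - l * (r * b * c + s * c * a + t * a * b)) = 0.
    move=> E; rewrite -[RHS](subrr (U x)) {2}E /U; ring.
  have [|||E1 E2 E3] := quad_eq0 ab bc ca (H a _) (H b _) (H c _).
  - by rewrite (rhoE a b c) // -/r; ring.
  - by rewrite (rhoE b c a) // -/s; ring.
  - by rewrite (rhoE c a b) // -/t; ring.
  split; apply/eqP; rewrite -subr_eq0; [rewrite E1|rewrite mulNr opprK E2|rewrite E3]; exact: eqxx.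
(* The flex conditions at b and c are two linear equations for [c120 F] and [c021 F]; as b != c, the
   solution is that of [lines_cubic]. *)
have M1 := flex_of_gy il0 ab bc ca E201 E102 E003 E210 E111 E012 G1 G2.
have M2 : c120 F * c + c021 F = l * t * (r * (c - b) + s * (c - a)).
  apply: (flex_of_gy il0 bc ca ab _ _ _ _ _ _ G2 G3);
  rewrite ?E201 ?E102 ?E003 ?E210 ?E111 ?E012; ring.
have [E120 E021] : c120 F = l * (r * s + s * t + t * r) /\
    c021 F = - l * (a * s * t + b * t * r + c * r * s).
  have E1 : c120 F = l * (r * s + s * t + t * r).
    have bc' : b - c != 0 by rewrite subr_eq0.
    apply: (mulIf bc'); transitivity ((c120 F * b + c021 F) - (c120 F * c + c021 F)); first by ring.
    by rewrite M1 M2; ring.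
  split=> //; transitivity ((c120 F * b + c021 F) - c120 F * b); first by ring.
  by rewrite M1 E1; ring.
pose ee := c030 F - l * (r * s * t).
have EF : F = lines_cubic l ee a b c r s t.
  have E030 : c030 F = l * (r * s * t) + ee by rewrite /ee addrC subrK.
  have eta (g : cubic k) : g = Cubic (c300 g) (c030 g) (c003 g) (c210 g) (c201 g)
    (c120 g) (c021 g) (c102 g) (c012 g) (c111 g) by case: g.
  by rewrite [LHS]eta /lines_cubic E030 E003 E210 E201 E120 E021 E102 E012 E111.
have [e0|en0] := eqVneq ee 0.
  (* Three lines are singular where the first two meet; there y = b - a is not zero. *)
  have [||||_ /eqP] := sm k i (a * s - b * r) (b - a) (s - r).
    rewrite -/F EF e0 lines_cubicE; ring.
  all: rewrite -/F ?EF ?e0 /cderx /cdery /cderz /lines_cubic /=; try ring.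
  by rewrite subr_eq0 (negPf ba).
clearbody r s t.
(* The three linear forms satisfy (b - c) L1 + (c - a) L2 + (a - b) L3 = D y. At y = 1 the three
   summands are to be conjugates z0, z1, z2 with sum D, and f = 0 says that their product is the [N]
   below. Both D and [N] are fixed by Frobenius. *)
pose D := (b - c) * r + (c - a) * s + (a - b) * t.
have frD : fr D = D.
  rewrite /D !rmorphD 3!rmorphM !rmorphB fra frb frc frR frS frT; ring.
have [d Ed] := frob_fixed i frD.
pose N := - (ee / l) * ((b - c) * (c - a) * (a - b)).
have frE : fr ee = ee.
  have E030 : fr (c030 F) = c030 F := congr1 (@c030 k) Ff.
  rewrite /ee rmorphB E030 rmorphM [fr (r * s * t)]rmorphM [fr (r * s)]rmorphM.
  rewrite frR frS frT frl; ring.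
have frN : fr N = N.
  rewrite /N rmorphM rmorphN [fr (ee / l)]rmorphM fmorphV frE frl.
  rewrite [fr (_ * (a - b))]rmorphM [fr ((b - c) * _)]rmorphM !rmorphB fra frb frc; ring.
have [n En] := frob_fixed i frN.
have [bc' ca' ab'] : [/\ b - c != 0, c - a != 0 & a - b != 0].
  by rewrite !subr_eq0.
have n0 : n != 0.
  rewrite -(fmorph_eq0 i) -En /N !mulf_eq0 oppr_eq0 mulf_eq0 invr_eq0.
  by rewrite (negPf en0) (negPf il0) (negPf bc') (negPf ca') (negPf ab').
have [s' Hs] := cubic_no_root d n0.
have [x|z0 [z1 [z2 [[z0q z1q z2q] [_ [T1 _ T3]]]]]] := @cubic_conjugates K k i (- d) s' (- n).
  by rewrite mulNr; apply: Hs.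
rewrite !rmorphN !opprK in T1 T3.
pose x0 := z0 / (b - c) - r; pose x1 := z1 / (c - a) - s; pose x2 := z2 / (a - b) - t.
have frz0 : fr z0 = z1 := z0q. have frz1 : fr z1 = z2 := z1q.
have frx0 : fr x0 = x1 by rewrite /x0 rmorphB rmorphM fmorphV rmorphB frz0 frb frc frR.
have frx1 : fr x1 = x2 by rewrite /x1 rmorphB rmorphM fmorphV rmorphB frz1 frc fra frS.
have rel : (b - c) * x0 + (c - a) * x1 + (a - b) * x2 = 0.
  transitivity (z0 + z1 + z2 - D); last by rewrite T1 -Ed subrr.
  by rewrite /D /x0 /x1 /x2; field; rewrite bc' ca' ab'.
have X0 : x0 + r = z0 / (b - c) by rewrite /x0 subrK.
have X1 : x1 + s = z1 / (c - a) by rewrite /x1 subrK.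
have X2 : x2 + t = z2 / (a - b) by rewrite /x2 subrK.
clearbody x0 x1 x2.
(* Solve x0 = X - a Z and x1 = X - b Z. The relation [rel] is what makes Z, and then X, fixed by
   Frobenius. *)
pose Z := (x1 - x0) / (a - b).
have frZ : fr Z = Z.
  rewrite /Z rmorphM fmorphV !rmorphB frx0 frx1 fra frb.
  apply/eqP; rewrite -subr_eq0; apply/eqP.
  have -> : x2 = - ((b - c) * x0 + (c - a) * x1) / (a - b).
    apply: (mulIf ab'); rewrite mulfVK //; apply/eqP; rewrite -subr_eq0; apply/eqP.
    by rewrite -rel; ring.
  by field; rewrite bc' ab'.
pose Xx := x0 + a * Z.
have frX : fr Xx = Xx.
  rewrite /Xx rmorphD rmorphM frZ frx0 fra /Z; field; exact: ab'.
have [zz Ez] := frob_fixed i frZ; have [xx Exx] := frob_fixed i frX.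
have [|_ /eqP] := nz xx zz 1; last by rewrite oner_eq0.
apply/eqP; rewrite -(fmorph_eq0 i) -ceval_map -/F rmorph1 -Ez -Exx EF lines_cubicE.
apply/eqP; have -> : Xx - a * Z + r * 1 = z0 / (b - c) by rewrite -X0 /Xx; ring.
have H1 : Xx - b * Z = x1 by rewrite /Xx /Z; field; exact: ab'.
have H2 : Xx - c * Z = x2 by rewrite -frx1 -H1 rmorphB rmorphM frX frZ frb.
have -> : Xx - b * Z + s * 1 = z1 / (c - a) by rewrite H1 mulr1.
have -> : Xx - c * Z + t * 1 = z2 / (a - b) by rewrite H2 mulr1.
have -> : l * (z0 / (b - c) * (z1 / (c - a)) * (z2 / (a - b))) =
   (z0 * z1 * z2) * (l / ((b - c) * (c - a) * (a - b))).
  by field; rewrite bc' ca' ab'.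
rewrite T3 -En /N; field.
by rewrite il0 bc' ca' ab'.
Qed.

(** * Representations and rational points *)

Section Vectors.
Variable K : fieldType.
Implicit Types (u v w x y : 'cV[K]_3) (n : 'rV[K]_3).

Definition cols3 u v w : 'M[K]_3 :=
  \matrix_(i, j) (if j == i0 then u i 0 else if j == i1 then v i 0 else w i 0).

Lemma cols3_mul u v w x : cols3 u v w *m x = x i0 0 *: u + x i1 0 *: v + x i2 0 *: w.
Proof. by apply/matrixP => i j; rewrite !ord1 !mxE sum3E !mxE /=; ring. Qed.

Lemma col_cols3 u v w :
  [/\ col i0 (cols3 u v w) = u, col i1 (cols3 u v w) = v & col i2 (cols3 u v w) = w].
Proof. by split; apply/matrixP => i j; rewrite !ord1 !mxE. Qed.

Lemma cv3P x y : x i0 0 = y i0 0 -> x i1 0 = y i1 0 -> x i2 0 = y i2 0 -> x = y.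
Proof. by move=> e0 e1 e2; apply/matrixP => i j; rewrite !ord1; move: i; apply: ord3P. Qed.

Lemma unitmx_ker (M : 'M[K]_3) : (forall x, M *m x = 0 -> x = 0) -> M \in unitmx.
Proof.
move=> H; rewrite unitmxE -det_tr unitfE; apply/negP => /(@det0P K 3 _) [n n0 E].
have: n^T = 0 by apply: H; rewrite -[M]trmxK -trmx_mul E trmx0.
by move/(congr1 trmx); rewrite trmxK trmx0 => /eqP; rewrite (negPf n0).
Qed.

Lemma det_ker (M : 'M[K]_3) : \det M = 0 -> exists2 x : 'cV[K]_3, x != 0 & M *m x = 0.
Proof.
rewrite -det_tr => /eqP/(@det0P K 3 _) [n n0 E]; exists n^T.
  by apply: contra n0 => /eqP /(congr1 trmx); rewrite trmxK trmx0 => ->.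
by rewrite -[M]trmxK -trmx_mul E trmx0.
Qed.

Definition indep u v := forall a b : K, a *: u + b *: v = 0 -> a = 0 /\ b = 0.

Lemma indep_sym u v : indep u v -> indep v u.
Proof. by move=> H a b; rewrite addrC => /H []. Qed.

Lemma annihilator u v : exists2 n : 'rV[K]_3, n != 0 & n *m u = 0 /\ n *m v = 0.
Proof.
have /eqP/(@det0P K 3 _) [n n0 E] : \det (cols3 u v 0) = 0.
  by rewrite det3E !mxE /=; ring.
exists n => //; have [E1 E2 _] := col_cols3 u v 0.
by split; [rewrite -E1|rewrite -E2]; rewrite colE mulmxA E mul0mx.
Qed.

Lemma row_dual n : n != 0 -> exists w : 'cV[K]_3, n *m w = 1%:M.
Proof.
move=> /rV0Pn [j nj]; exists ((n 0 j)^-1 *: delta_mx j 0).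
by apply/matrixP => a b; rewrite !ord1 -scalemxAr -colE !mxE mulVf.
Qed.

Lemma cols3_unit n u v w : indep u v -> n *m u = 0 -> n *m v = 0 -> n *m w = 1%:M ->
  cols3 u v w \in unitmx.
Proof.
move=> H nu nv nw; apply: unitmx_ker => x; rewrite cols3_mul => E.
have x2 : x i2 0 = 0.
  have := congr1 (mulmx n) E; rewrite !mulmxDr -!scalemxAr nu nv nw !scaler0 !add0r mulmx0.
  by move/matrixP/(_ 0 0); rewrite !mxE mulr1.
move: E; rewrite x2 scale0r addr0 => /H [x0 x1].
by apply: cv3P; rewrite ?x0 ?x1 ?x2 mxE.
Qed.

Lemma basis_ext u v : indep u v -> exists w : 'cV[K]_3, cols3 u v w \in unitmx.
Proof.
move=> H; have [n n0 [nu nv]] := annihilator u v; have [w nw] := row_dual n0.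
by exists w; apply: cols3_unit nw.
Qed.

Lemma indep_ext u : u != 0 -> exists v : 'cV[K]_3, indep u v.
Proof.
move=> /cV0Pn [i ui].
have [j ij] : exists j, j != i by exists (if i == i0 then i1 else i0); case: i {ui} => [[|[|[]]]].
exists (delta_mx j 0) => a b E.
have a0 : a = 0.
  have := congr1 (fun x : 'cV_3 => x i 0) E; rewrite !mxE eq_sym (negPf ij) /= mulr0 addr0.
  by move/eqP; rewrite mulf_eq0 (negPf ui) orbF => /eqP.
split=> //; have := congr1 (fun x : 'cV_3 => x j 0) E.
by rewrite a0 !mxE mul0r add0r !eqxx mulr1.
Qed.

Lemma indep_unit u v : indep u v -> u != 0 /\ v != 0.
Proof.
move=> H; split; apply/eqP => E.
  by have [|/eqP] := H 1 0; rewrite ?E ?oner_eq0 // scaler0 scale0r addr0.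
by have [|_ /eqP] := H 0 1; rewrite ?E ?oner_eq0 // scaler0 scale0r addr0.
Qed.

Lemma indep_or u v : u != 0 -> indep u v \/ exists c, v = c *: u.
Proof.
move=> u0; have [i ui] := cV0Pn _ u0.
have [E|vu] := eqVneq v ((v i 0 / u i 0) *: u); first by right; exists (v i 0 / u i 0).
left=> a b E.
have Ei := congr1 (fun x : 'cV_3 => x i 0) E; rewrite !mxE in Ei.
have b0 : b = 0.
  apply/eqP; apply: contraNT vu => b0; apply/eqP; apply: (scalerI b0).
  have -> : b *: v = - (a *: u) by apply/eqP; rewrite -addr_eq0 addrC E.
  have -> : b *: ((v i 0 / u i 0) *: u) = (b * v i 0 / u i 0) *: u by rewrite scalerA mulrA.
  have -> : b * v i 0 = - (a * u i 0) by apply/eqP; rewrite -addr_eq0 addrC Ei.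
  by rewrite mulNr mulfK // scaleNr.
split=> //; move: Ei; rewrite b0 mul0r addr0 => /eqP.
by rewrite mulf_eq0 (negPf ui) orbF => /eqP.
Qed.

Lemma indep_scale u c : ~ indep u (c *: u).
Proof.
move=> H; have [|_ /eqP] := H c (-1); last by rewrite oppr_eq0 oner_eq0.
by rewrite scaleN1r subrr.
Qed.
End Vectors.

Section Singular.
Variable K : finFieldType.
Implicit Types f : cubic K.

Lemma singular_vertex f : c300 f = 0 -> c210 f = 0 -> c201 f = 0 -> ~ csmooth f.
Proof.
move=> e1 e2 e3 /(_ K idfun 1 0 0) [||||/eqP]; last by rewrite oner_eq0.
all: rewrite /ceval /cderx /cdery /cderz /= ?e1 ?e2 ?e3; ring.
Qed.

(** f is z times a conic, and it is singular where that conic meets the line z = 0, which happens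
    over an algebraic closure. *)
Lemma singular_line f : c300 f = 0 -> c030 f = 0 -> c210 f = 0 -> c120 f = 0 -> ~ csmooth f.
Proof.
move=> e1 e2 e3 e4 sm; have [k [/= i _]] := countable_algebraic_closure K.
have [x [y [xy E]]] : exists x y : k, ~ (x = 0 /\ y = 0) /\
    i (c201 f) * x ^+ 2 + i (c111 f) * x * y + i (c021 f) * y ^+ 2 = 0.
  have [a0|an0] := eqVneq (i (c201 f)) 0.
    exists 1, 0; split; last by rewrite a0; ring.
    by case=> /eqP; rewrite oner_eq0.
  have [x Ex] := @solve_monicpoly k 2 (fun j => nth 0 [:: - i (c021 f) / i (c201 f);
    - i (c111 f) / i (c201 f)] j) isT.
  exists x, 1; split; first by case=> _ /eqP; rewrite oner_eq0.
  by rewrite Ex !big_ord_recl big_ord0 /=; field.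
have [||||x0 y0 _] := sm k i x y 0; last exact: xy.
all: rewrite /ceval /cderx /cdery /cderz /= ?e1 ?e2 ?e3 ?e4 ?rmorph0; try ring.
by rewrite -[RHS]E; ring.
Qed.
End Singular.

Definition mx3 (R : Type) (a b c d e f g h k : R) : 'M[R]_3 :=
  \matrix_(i, j) nth a (nth [::] [:: [:: a; b; c]; [:: d; e; f]; [:: g; h; k]] i) j.

Lemma mx3P (R : Type) (M N : 'M[R]_3) :
  M i0 i0 = N i0 i0 -> M i0 i1 = N i0 i1 -> M i0 i2 = N i0 i2 ->
  M i1 i0 = N i1 i0 -> M i1 i1 = N i1 i1 -> M i1 i2 = N i1 i2 ->
  M i2 i0 = N i2 i0 -> M i2 i1 = N i2 i1 -> M i2 i2 = N i2 i2 -> M = N.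
Proof.
move=> *; apply/matrixP; apply: ord3P; apply: ord3P => //.
Qed.

Lemma col_mulmx (R : comNzRingType) (M N : 'M[R]_3) j : col j (M *m N) = M *m col j N.
Proof. by rewrite !colE mulmxA. Qed.

Lemma row_mulmx (R : comNzRingType) n (M : 'M[R]_3) (N : 'M[R]_(3, n)) j : row j (M *m N) = row j M *m N.
Proof. by rewrite !rowE mulmxA. Qed.

Section Geometry.
Variable K : finFieldType.
Implicit Types (A : 'I_3 -> 'M[K]_3) (f : cubic K) (P S v : 'cV[K]_3).

Definition e_ (j : 'I_3) : 'cV[K]_3 := delta_mx j 0.

Lemma rep_at_e A k : rep_at A (e_ k) = A k.
Proof.
rewrite /rep_at /e_ !mxE; move: k; apply: ord3P; rewrite /= ?scale1r ?scale0r ?addr0 ?add0r //.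
Qed.

Lemma rep_at_lin A a b u v : rep_at A (a *: u + b *: v) = a *: rep_at A u + b *: rep_at A v.
Proof. by apply/matrixP => i j; rewrite /rep_at !mxE; ring. Qed.

Definition cvec f v := ceval f (v i0 0) (v i1 0) (v i2 0).

Lemma cvec_act f (g : 'M[K]_3) v : cvec (cact f g) v = cvec f (g *m v).
Proof. by rewrite /cvec ceval_act !mxE !sum3E. Qed.

Lemma ldr_det f A v : ldr f A -> (cvec f v == 0) = (\det (rep_at A v) == 0).
Proof.
case=> l l0 ->; rewrite det_rep_at /cvec.
have -> : ceval (cscale l (cdet A)) (v i0 0) (v i1 0) (v i2 0) =
  l * ceval (cdet A) (v i0 0) (v i1 0) (v i2 0) by rewrite /ceval /=; ring.
by rewrite mulf_eq0 (negPf l0).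
Qed.

(* y spans the kernel of A(P), the vectors A(v) y lie in the plane n = 0, and S
   is the point with n A(S) = 0. For fixed P, the point S determines A up to
   equivalence and canonical_rep be any rational point other than P. *)
Definition residual A P S := exists y : 'cV[K]_3, exists n : 'rV[K]_3,
  [/\ y != 0, n != 0, rep_at A P *m y = 0, forall v, n *m rep_at A v *m y = 0 & n *m rep_at A S = 0].

Lemma residual_sub A (g : 'M[K]_3) P S : g \in unitmx ->
  residual (rep_subst g A) P S <-> residual A (g *m P) (g *m S).
Proof.
move=> ug; split=> -[y [n [y0 n0 E1 E2 E3]]]; exists y, n; move: E1 E3; rewrite !rep_at_subst;
  move=> E1 E3; split=> // v; last by rewrite rep_at_subst.
by have := E2 (invmx g *m v); rewrite rep_at_subst mulKVmx.
Qed.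

Lemma rep_at_eqv A A' U W v : (forall k, A' k = U *m A k *m W) -> rep_at A' v = U *m rep_at A v *m W.
Proof.
by move=> E; rewrite /rep_at !E !mulmxDr !mulmxDl -!scalemxAr -!scalemxAl.
Qed.

Lemma residual_eqv A A' P S : rep_eqv A A' -> residual A P S -> residual A' P S.
Proof.
move=> [U [W [uU uW E]]] [y [n [y0 n0 E1 E2 E3]]].
have apE v := rep_at_eqv v E.
exists (invmx W *m y), (n *m invmx U); split.
- by apply: contra y0 => /eqP e; rewrite -[y](mulKVmx uW) e mulmx0.
- by apply: contra n0 => /eqP e; rewrite -[n](mulmxKV uU) e mul0mx.
- by rewrite apE !mulmxA mulmxK // -mulmxA E1 mulmx0.
- by move=> v; rewrite apE !mulmxA mulmxKV // mulmxK // E2.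
- by rewrite apE !mulmxA mulmxKV // E3 mul0mx.
Qed.

Lemma unit_col (y : 'cV[K]_3) : y != 0 -> exists2 W : 'M[K]_3, W \in unitmx & col i0 W = y.
Proof.
move=> /indep_ext [v /basis_ext [w uW]].
by exists (cols3 y v w) => //; have [] := col_cols3 y v w.
Qed.

Lemma cdet_tr A : cdet (fun k => (A k)^T) = cdet A.
Proof.
apply: cpoly_inj; rewrite -!det_rep_mx -[RHS]det_tr; congr (\det _).
by apply/matrixP => i j; rewrite !mxE.
Qed.

(** Otherwise the determinant would vanish on the whole line through u and v. *)
Lemma no_common_kernel f A (y u v : 'cV[K]_3) : csmooth f -> ldr f A -> y != 0 -> indep u v ->
  rep_at A u *m y = 0 -> rep_at A v *m y = 0 -> False.
Proof.
move=> sm hA y0 uv Eu Ev; have [w ug] := basis_ext uv.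
have [c0 c1 _] := col_cols3 u v w; set g := cols3 u v w in ug c0 c1.
have [W uW cW] := unit_col y0.
pose B k := 1%:M *m rep_subst g A k *m W.
have hB : ldr (cact f g) B.
  by apply: ldr_eqv (ldr_sub g hA); exists 1%:M, W; rewrite unitmx1.
have z k i : rep_at A (col k g) *m y = 0 -> B k i i0 = 0.
  move=> E; have -> : B k i i0 = col i0 (B k) i 0 by rewrite [RHS]mxE.
  by rewrite /B col_mulmx cW mul1mx /rep_subst E mxE.
have z0 i : B i0 i i0 = 0 by apply: z; rewrite c0.
have z1 i : B i1 i i0 = 0 by apply: z; rewrite c1.
have [l _ Ef] := hB.
clearbody B; apply: (@singular_line K (cact f g)); last exact: csmooth_act.
all: rewrite Ef /= /mixdet ?z0 ?z1; ring.
Qed.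

(** Take n, y and S as first basis vectors. If P is a multiple of S, the slice at S has zero first
    row and column, and all slices vanish in the corner entry. The determinant then has no term in
    x^3, x^2 y, x^2 z, so S would be singular. *)
Lemma residual_neq f A P S c : csmooth f -> ldr f A -> P != 0 -> S != 0 ->
  residual A P S -> P = c *: S -> False.
Proof.
move=> sm hA P0 S0 [y [n [y0 n0 E1 E2 E3]]] EP.
have c0 : c != 0 by apply: contra P0 => /eqP c0; rewrite EP c0 scale0r.
have [g ug cg] := unit_col S0.
have [W uW cW] := unit_col y0.
have [V uV cV] : exists2 V : 'M[K]_3, V \in unitmx & row i0 V = n.
  have n0' : n^T != 0 by apply: contra n0 => /eqP e; rewrite -[n]trmxK e trmx0.
  by have [V uV cV] := unit_col n0'; exists V^T; rewrite ?unitmx_tr // -tr_col cV trmxK.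
pose B k := V *m rep_subst g A k *m W.
have hB : ldr (cact f g) B.
  by apply: ldr_eqv (ldr_sub g hA); exists V, W.
have aS : rep_at A S *m y = 0.
  apply: (scalerI c0); rewrite scaler0 scalemxAl -E1 EP; congr (_ *m _).
  by apply/matrixP => a b; rewrite /rep_at !mxE; ring.
have z0 i : B i0 i i0 = 0.
  have -> : B i0 i i0 = col i0 (B i0) i 0 by rewrite [RHS]mxE.
  by rewrite /B col_mulmx cW /rep_subst cg -mulmxA aS mulmx0 mxE.
have z1 i : B i0 i0 i = 0.
  have -> : B i0 i0 i = row i0 (B i0) 0 i by rewrite [RHS]mxE.
  by rewrite /B !row_mulmx cV /rep_subst cg E3 mul0mx mxE.
have z2 k : B k i0 i0 = 0.
  have -> : B k i0 i0 = (row i0 (col i0 (B k))) 0 0 by rewrite [RHS]mxE [RHS]mxE.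
  by rewrite /B col_mulmx cW !row_mulmx cV /rep_subst E2 mxE.
have [l _ Ef] := hB.
clearbody B; apply: (@singular_vertex K (cact f g)); last exact: csmooth_act.
all: rewrite Ef /= /mixdet ?z2 ?z0 ?z1; ring.
Qed.

End Geometry.

Lemma cubicP (T : Type) (f h : cubic T) :
  c300 f = c300 h -> c030 f = c030 h -> c003 f = c003 h -> c210 f = c210 h ->
  c201 f = c201 h -> c120 f = c120 h -> c021 f = c021 h -> c102 f = c102 h ->
  c012 f = c012 h -> c111 f = c111 h -> f = h.
Proof.
move: f h => [? ? ? ? ? ? ? ? ? ?] [? ? ? ? ? ? ? ? ? ?] /=.
by do 10!move=> ->.
Qed.

Section Canonical.
Variable K : finFieldType.
Implicit Types (A : 'I_3 -> 'M[K]_3) (f : cubic K) (P S v : 'cV[K]_3).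

(** Take y in the kernel of A(P). The matrix N of v -> A(v) y kills P, so it has a left kernel
    vector n. The matrix R of v -> n A(v), acting on row vectors, then kills y on the right, so it
    has a left kernel vector, which is S. *)
Lemma residual_exists f A P : ldr f A -> P != 0 -> cvec f P = 0 ->
  exists S, [/\ S != 0, cvec f S = 0 & residual A P S].
Proof.
move=> hA P0 fP.
have [y y0 Ey] : exists2 y : 'cV[K]_3, y != 0 & rep_at A P *m y = 0.
  by apply: det_ker; apply/eqP; rewrite -(ldr_det _ hA) fP.
pose N : 'M[K]_3 := \matrix_(i, k) (A k *m y) i 0.
have apN v : rep_at A v *m y = N *m v.
  apply/matrixP => i j; rewrite !ord1 /rep_at !mulmxDl -!scalemxAl !mxE !sum3E.
  by rewrite !mxE !sum3E; ring.
have [n n0 En] : exists2 n : 'rV[K]_3, n != 0 & n *m N = 0.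
  by apply/det0P; rewrite -det_tr; apply/(@det0P K 3 _); exists P^T;
    [apply: contra P0 => /eqP e; rewrite -[P]trmxK e trmx0 | rewrite -trmx_mul -apN Ey trmx0].
pose R : 'M[K]_3 := \matrix_(k, j) (n *m A k) 0 j.
have apR v : n *m rep_at A v = v^T *m R.
  apply/matrixP => i j; rewrite !ord1 /rep_at !mulmxDr -!scalemxAr !mxE !sum3E.
  by rewrite !mxE !sum3E; ring.
have E2 v : n *m rep_at A v *m y = 0 by rewrite -mulmxA apN mulmxA En mul0mx.
have [x x0 Ex] : exists2 x : 'rV[K]_3, x != 0 & x *m R = 0.
  apply/det0P; rewrite -det_tr; apply/(@det0P K 3 _); exists y^T.
    by apply: contra y0 => /eqP e; rewrite -[y]trmxK e trmx0.
  rewrite -trmx_mul (_ : R *m y = 0) ?trmx0 //; apply/row_matrixP => k.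
  by rewrite row_mulmx row0 -(E2 (e_ _ k)) apR /e_ trmx_delta -rowE.
have Enx : n *m rep_at A x^T = 0 by rewrite apR trmxK.
exists x^T; split.
- by apply: contra x0 => /eqP e; rewrite -[x]trmxK e trmx0.
- by apply/eqP; rewrite (ldr_det _ hA); apply/det0P; exists n.
- by exists y, n.
Qed.

(** The last column is (X, Y, 0), zero at P = (0 : 0 : 1), and the last row is (X, Z, 0), zero at S
    = (0 : 1 : 0). Expanding the determinant along them shows how the coefficients of f fill the
    other four entries. *)
Definition canonical_rep f (k : 'I_3) : 'M[K]_3 :=
  if k == i0 then mx3 0 0 1 (c201 f) (- c300 f) 0 1 0 0
  else if k == i1 then mx3 (- c021 f) (c120 f) 0 0 (- c210 f) 1 0 0 0
  else mx3 (- c012 f) (c111 f) 0 (c102 f) 0 0 0 1 0.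

Lemma ldr_canonical_rep f : c030 f = 0 -> c003 f = 0 -> ldr f (canonical_rep f).
Proof.
move=> e1 e2; exists 1; rewrite ?oner_eq0 // cscale1.
by apply: cubicP; rewrite /= /mixdet /canonical_rep /= !mxE /= ?e1 ?e2; ring.
Qed.

Lemma residual_canonical_rep f : residual (canonical_rep f) (e_ K i2) (e_ K i1).
Proof.
exists (e_ K i2), (e_ K i2)^T; split.
- by apply/cV0Pn; exists i2; rewrite !mxE !eqxx oner_eq0.
- by apply/rV0Pn; exists i2; rewrite !mxE !eqxx oner_eq0.
- by rewrite rep_at_e /e_ -colE; apply/matrixP => i j; rewrite !ord1 !mxE; move: i; apply: ord3P.
- move=> v; rewrite /e_ trmx_delta -rowE -colE; apply/matrixP => i j.
  by rewrite !ord1 /rep_at !mxE /=; ring.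
- by rewrite rep_at_e /e_ trmx_delta -rowE; apply/matrixP => i j; rewrite !ord1 !mxE; move: j; apply: ord3P.
Qed.

(** Smoothness at P leaves only the last basis vector, up to scale, as kernel vector y; then n, and
    in turn S, are forced. *)
Lemma residual_canonical_rep_uniq f S : csmooth f -> c003 f = 0 -> residual (canonical_rep f) (e_ K i2) S ->
  S = S i1 0 *: e_ K i1.
Proof.
move=> sm e3 [y [n [y0 n0]]]; rewrite rep_at_e => E1 E2 E3.
have m (M : 'M[K]_3) (i : 'I_3) : (M *m y) i 0 = M i i0 * y i0 0 + M i i1 * y i1 0 + M i i2 * y i2 0.
  by rewrite !mxE sum3E.
have r (M : 'M[K]_3) (j : 'I_3) : (n *m M) 0 j = n 0 i0 * M i0 j + n 0 i1 * M i1 j + n 0 i2 * M i2 j.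
  by rewrite !mxE sum3E.
have ym i : (canonical_rep f i2 *m y) i 0 = 0 by rewrite E1 mxE.
have := ym i2; rewrite m /canonical_rep /= !mxE /= mul0r mul1r add0r mul0r addr0 => y1.
have := ym i1; rewrite m /canonical_rep /= !mxE /= y1 !mulr0 mul0r !addr0 => /eqP.
rewrite mulf_eq0 => cy0.
have := ym i0; rewrite m /canonical_rep /= !mxE /= y1 !mulr0 mul0r !addr0 => /eqP.
rewrite mulf_eq0 oppr_eq0 => ay0.
have y00 : y i0 0 = 0.
  apply/eqP; apply: contraT => h; rewrite (negPf h) !orbF in cy0 ay0.
  (* [s] exchanges X and Z, to bring P to the vertex (1 : 0 : 0). *)
  exfalso; pose s : 'M[K]_3 := mx3 0 0 1 0 1 0 1 0 0.
  have us : s \in unitmx.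
    rewrite unitmxE (_ : \det s = -1) ?unitrN1 // det3E !mxE /=; ring.
  apply: (@singular_vertex K (cact f s)); last exact: csmooth_act.
  1-3: rewrite /cact /= /cev /cpolar /ceval /cderx /cdery /cderz /s ?mxE /=;
    rewrite ?e3 ?(eqP cy0) ?(eqP ay0); ring.
have y2 : y i2 0 != 0.
  apply: contra y0 => /eqP y20; apply/eqP; apply: cv3P; rewrite ?y00 ?y1 ?y20 mxE //.
have ny k : n *m canonical_rep f k *m y = 0 by rewrite -(rep_at_e (canonical_rep f)) E2.
have nyE k i : canonical_rep f k i i0 * y i0 0 + canonical_rep f k i i1 * y i1 0 + canonical_rep f k i i2 * y i2 0 =
  canonical_rep f k i i2 * y i2 0 by rewrite y00 y1 !mulr0 !add0r.
have nk k : n 0 i0 * canonical_rep f k i0 i2 + n 0 i1 * canonical_rep f k i1 i2 + n 0 i2 * canonical_rep f k i2 i2 = 0.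
  apply: (mulIf y2); rewrite mul0r -r.
  have : (n *m canonical_rep f k *m y) 0 0 = 0 by rewrite ny mxE.
  by rewrite mxE sum3E y00 y1 !mulr0 !add0r.
have := nk i0; rewrite /canonical_rep /= !mxE /= !mulr0 !addr0 mulr1 => n00.
have := nk i1; rewrite /canonical_rep /= !mxE /= !mulr0 !addr0 mulr1 add0r => n01.
have n2 : n 0 i2 != 0.
  apply: contra n0 => /eqP n20; apply/eqP; apply/matrixP => i j; rewrite !ord1 mxE.
  by move: j; apply: ord3P.
have q j : (n *m rep_at (canonical_rep f) S) 0 j = n 0 i2 * rep_at (canonical_rep f) S i2 j.
  by rewrite r n00 n01 !mul0r !add0r.
have S0 : S i0 0 = 0.
  apply: (mulfI n2); rewrite mulr0; have := q i0; rewrite E3 mxE /rep_at /canonical_rep /= !mxE /= => ->; ring.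
have S2 : S i2 0 = 0.
  apply: (mulfI n2); rewrite mulr0; have := q i1; rewrite E3 mxE /rep_at /canonical_rep /= !mxE /= => ->; ring.
by apply: cv3P; rewrite !mxE /= ?S0 ?S2 ?mulr0 ?mulr1.
Qed.

Lemma slice_indep f A (y : 'cV[K]_3) i j k : csmooth f -> ldr f A -> y != 0 ->
  i != j -> i != k -> j != k -> A k *m y = 0 -> indep (A i *m y) (A j *m y).
Proof.
move=> sm hA y0 ij ik jk Ak a b E.
have [/andP [/eqP-> /eqP->] //|ab] := boolP ((a == 0) && (b == 0)).
exfalso; apply: (@no_common_kernel K f A y (a *: e_ K i + b *: e_ K j) (e_ K k)) => //.
- move=> c d /matrixP Ecd.
  have := Ecd i 0; have := Ecd j 0; have := Ecd k 0.
  rewrite !mxE !eqxx !(eq_sym k) !(eq_sym j i) (negPf ij) (negPf ik) (negPf jk) /=.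
  rewrite !(mulr0, mulr1, addr0, add0r) => -> /eqP.
  rewrite mulf_eq0 => cb /eqP; rewrite mulf_eq0 => ca.
  split=> //; apply/eqP; apply: contraT => c0.
  by rewrite (negPf c0) /= in ca cb; rewrite ca cb in ab.
- by rewrite rep_at_lin !rep_at_e mulmxDl -!scalemxAl.
- by rewrite rep_at_e.
Qed.

(** In the bases [U0] and [W0] the last column becomes (X, Y, 0) and the last row (X, Z, 0). The
    vectors w and z, dual to n and y, complete the bases so that n and y become the last basis
    vectors. *)
Lemma rep_eqv_canonical f A : csmooth f -> ldr f A -> residual A (e_ K i2) (e_ K i1) -> rep_eqv A (canonical_rep f).
Proof.
move=> sm hA [y [n [y0 n0]]]; rewrite !rep_at_e => E1 E2 E3.
have A2 k : n *m A k *m y = 0 by rewrite -(rep_at_e A) E2.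
have uv := slice_indep sm hA y0 (isT : i0 != i1) (isT : i0 != i2) (isT : i1 != i2) E1.
pose B k := (A k)^T.
have hB : ldr f B by case: hA => l l0 ->; exists l => //; rewrite cdet_tr.
have n0' : n^T != 0 by apply: contra n0 => /eqP e; rewrite -[n]trmxK e trmx0.
have rs : indep ((n *m A i0)^T) ((n *m A i2)^T).
  rewrite !trmx_mul; apply: (slice_indep sm hB n0' (isT : i0 != i2) (isT : i0 != i1) (isT : i2 != i1)).
  by rewrite /B -trmx_mul E3 trmx0.
have [w nw] := row_dual n0.
have uU := cols3_unit uv (etrans (mulmxA _ _ _) (A2 i0)) (etrans (mulmxA _ _ _) (A2 i1)) nw.
have y0' : y^T != 0 by apply: contra y0 => /eqP e; rewrite -[y]trmxK e trmx0.
have [z yz] := row_dual y0'.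
have yA k : y^T *m (n *m A k)^T = 0 by rewrite -trmx_mul A2 trmx0.
have uW := cols3_unit rs (yA i0) (yA i2) yz.
set U0 := cols3 _ _ _ in uU; set W0 := cols3 _ _ _ in uW.
have [cU0 cU1 cU2] := col_cols3 (A i0 *m y) (A i1 *m y) w.
have [cW0 cW1 cW2] := col_cols3 (n *m A i0)^T (n *m A i2)^T z.
rewrite -/U0 in cU0 cU1 cU2; rewrite -/W0 in cW0 cW1 cW2.
pose U := invmx U0; pose W := invmx W0^T.
have uU' : U \in unitmx by rewrite unitmx_inv.
have uW' : W \in unitmx by rewrite unitmx_inv unitmx_tr.
have Uc j : U *m col j U0 = e_ K j by rewrite colE mulmxA mulVmx // mul1mx.
have Wr j : (col j W0)^T *m W = (e_ K j)^T.
  by rewrite tr_col rowE -mulmxA mulmxV ?unitmx_tr // mulmx1 trmx_delta.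
have nU0 : n *m U0 = (e_ K i2)^T.
  have c j : col j (n *m U0) = n *m col j U0 by rewrite !colE mulmxA.
  apply/matrixP => a j; rewrite !ord1.
  have -> : (n *m U0) 0 j = (col j (n *m U0)) 0 0 by rewrite [RHS]mxE.
  rewrite c; move: j; apply: ord3P; rewrite ?cU0 ?cU1 ?cU2 ?mulmxA ?A2 ?nw !mxE //.
have U2 : (e_ K i2)^T *m U = n by rewrite -nU0 mulmxK.
have W0y : W0^T *m y = e_ K i2.
  have c j : row j (W0^T *m y) = (col j W0)^T *m y by rewrite row_mulmx tr_col.
  apply/matrixP => j a; rewrite !ord1.
  have -> : (W0^T *m y) j 0 = (row j (W0^T *m y)) 0 0 by rewrite [RHS]mxE.
  have zy : z^T *m y = 1%:M by rewrite -[LHS]trmxK trmx_mul trmxK yz trmx1.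
  by rewrite c; move: j; apply: ord3P; rewrite ?cW0 ?cW1 ?cW2 ?trmxK ?A2 ?zy !mxE.
have W2 : W *m e_ K i2 = y by rewrite -W0y mulKmx // unitmx_tr.
pose C k := U *m A k *m W.
have eqC : rep_eqv A C by exists U, W.
have Cc k i : C k i i2 = (U *m (A k *m y)) i 0.
  have -> : C k i i2 = (col i2 (C k)) i 0 by rewrite [RHS]mxE.
  by rewrite /C colE -!mulmxA W2.
have Cr k j : C k i2 j = (n *m A k *m W) 0 j.
  have -> : C k i2 j = (row i2 (C k)) 0 j by rewrite [RHS]mxE.
  by rewrite /C rowE -[X in X *m _]trmxK trmx_delta !mulmxA U2.
have Cc0 i : C i0 i i2 = (i == i0)%:R by rewrite Cc -cU0 Uc !mxE andbT.
have Cc1 i : C i1 i i2 = (i == i1)%:R by rewrite Cc -cU1 Uc !mxE andbT.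
have Cc2 i : C i2 i i2 = 0 by rewrite Cc E1 mulmx0 mxE.
have Cr0 j : C i0 i2 j = (j == i0)%:R by rewrite Cr -[n *m _]trmxK -cW0 Wr !mxE andbT.
have Cr1 j : C i1 i2 j = 0 by rewrite Cr E3 mul0mx mxE.
have Cr2 j : C i2 i2 j = (j == i1)%:R by rewrite Cr -[n *m _]trmxK -cW1 Wr !mxE andbT.
have [l l0 Ef] := ldr_eqv eqC hA.
apply: rep_eqv_trans eqC _; move: {+}C Cc0 Cc1 Cc2 Cr0 Cr1 Cr2 Ef => D Dc0 Dc1 Dc2 Dr0 Dr1 Dr2 Ef.
(* Four multipliers, for the last row and the last column, clear the four coefficients that are zero
   in [canonical_rep]. The remaining ones can be read off the determinant, and l absorbs its scalar
   factor. *)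
pose g := D i1 i1 i0; pose a := D i0 i0 i0 - g; pose b := D i2 i1 i1; pose d := D i0 i0 i1.
exists (mx3 l 0 (- l * a) 0 l (- l * b) 0 0 1), (mx3 1 0 0 0 1 0 (- g) (- d) l^-1); split.
- rewrite unitmxE (_ : \det _ = l ^+ 2) ?unitfE ?expf_neq0 // det3E !mxE /=; ring.
- rewrite unitmxE (_ : \det _ = l^-1) ?unitfE ?invr_neq0 // det3E !mxE /=; ring.
apply: ord3P; apply: mx3P; rewrite /canonical_rep /= [LHS]mxE /= ?Ef /= /mixdet !(mxE, sum3E) /=.
all: rewrite ?Dc0 ?Dc1 ?Dc2 ?Dr0 ?Dr1 ?Dr2 /= /a /g /b /d; by field.
Qed.
End Canonical.

Section Correspondence.
Variable K : finFieldType.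
Implicit Types (A : 'I_3 -> 'M[K]_3) (f : cubic K) (P R S v : 'cV[K]_3).

Lemma cols3_rot (u v w : 'cV[K]_3) : cols3 u v w \in unitmx -> cols3 w u v \in unitmx.
Proof.
rewrite !unitmxE (_ : \det (cols3 w u v) = \det (cols3 u v w)) //.
rewrite !det3E !mxE /=; ring.
Qed.

Lemma residual_scale A P S c : c != 0 -> residual A P (c *: S) -> residual A P S.
Proof.
move=> c0 [y [n [y0 n0 E1 E2 E3]]]; exists y, n; split=> //.
apply: (scalerI c0); rewrite scaler0 -[RHS]E3 scalemxAr; congr (_ *m _).
by apply/matrixP => i j; rewrite /rep_at !mxE; ring.
Qed.

Lemma ldr_at f P S : csmooth f -> indep P S -> cvec f P = 0 -> cvec f S = 0 ->
  exists A, [/\ ldr f A, residual A P S,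
    forall S', residual A P S' -> exists c, S' = c *: S &
    forall A', ldr f A' -> residual A' P S -> rep_eqv A' A].
Proof.
move=> sm ind fP fS; have [w ug] := basis_ext (indep_sym ind).
have {}ug := cols3_rot ug; have [cw cS cP] := col_cols3 w S P.
set g := cols3 w S P in ug cw cS cP.
have gS : g *m e_ K i1 = S by rewrite -colE.
have gP : g *m e_ K i2 = P by rewrite -colE.
pose f' := cact f g.
have E030 : c030 f' = 0.
  transitivity (cvec f (col i1 g)); last by rewrite cS.
  by rewrite /cvec [col i1 g i0 0]mxE [col i1 g i1 0]mxE [col i1 g i2 0]mxE.
have E003 : c003 f' = 0.
  transitivity (cvec f (col i2 g)); last by rewrite cP.
  by rewrite /cvec [col i2 g i0 0]mxE [col i2 g i1 0]mxE [col i2 g i2 0]mxE.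
have sm' : csmooth f' by apply: csmooth_act.
have ui : invmx g \in unitmx by rewrite unitmx_inv.
have iS : invmx g *m S = e_ K i1 by rewrite -gS mulKmx.
have iP : invmx g *m P = e_ K i2 by rewrite -gP mulKmx.
exists (rep_subst (invmx g) (canonical_rep f')); split.
- have := ldr_sub (invmx g) (ldr_canonical_rep E030 E003).
  by rewrite /f' cactM mulmxV // cact1.
- by apply/residual_sub => //; rewrite iP iS; apply: residual_canonical_rep.
- move=> S' /(residual_sub _ _ _ ui); rewrite iP => /(residual_canonical_rep_uniq sm' E003) E.
  exists ((invmx g *m S') i1 0); rewrite -[S'](mulKVmx ug) {1}E -scalemxAr gS.
  by rewrite mulKVmx.
- move=> A' hA' rA'.
  have e1 : rep_eqv (rep_subst g A') (canonical_rep f').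
    apply: rep_eqv_canonical => //; first exact: ldr_sub.
    by apply/residual_sub => //; rewrite gP gS.
  apply: rep_eqv_trans (rep_eqv_subst (invmx g) e1).
  exists 1%:M, 1%:M; rewrite unitmx1; split=> // k.
  by rewrite mul1mx mulmx1 rep_substM mulmxV // rep_subst1.
Qed.

Definition points f P R S :=
  [/\ indep P R, indep P S & indep R S] /\
  [/\ cvec f P = 0, cvec f R = 0 & cvec f S = 0] /\
  forall v, v != 0 -> cvec f v = 0 ->
    exists c, [\/ v = c *: P, v = c *: R | v = c *: S].

Definition three_points f := exists P R S, points f P R S.

Lemma indep_residual f A P S : csmooth f -> ldr f A -> P != 0 -> S != 0 ->
  residual A P S -> indep P S.
Proof.
move=> sm hA P0 S0 rA; apply/indep_sym; have [//|[c Ec]] := indep_or P S0.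
by case: (residual_neq sm hA P0 S0 rA Ec).
Qed.

Lemma exactly_two_three_points f : csmooth f ->
  exactly_two_ldr_classes (cpoly f) <-> three_points f.
Proof.
move=> sm; split.
  move=> [M1 [M2 [/lin_det_repP [A1 -> h1] [/lin_det_repP [A2 -> h2] [n12 all]]]]].
  have [x [y [z [n0 f0]]]] := smooth_cubic_has_point sm.
  pose P : 'cV[K]_3 := \col_i (if i == i0 then x else if i == i1 then y else z).
  have P0 : P != 0.
    apply/eqP => E; apply: n0; split; [have := congr1 (fun v : 'cV[K]_3 => v i0 0) E
      | have := congr1 (fun v : 'cV[K]_3 => v i1 0) E
      | have := congr1 (fun v : 'cV[K]_3 => v i2 0) E]; by rewrite !mxE.
  have fP : cvec f P = 0 by rewrite /cvec !mxE.
  have [S1 [S10 fS1 r1]] := residual_exists h1 P0 fP.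
  have [S2 [S20 fS2 r2]] := residual_exists h2 P0 fP.
  have i1' := indep_residual sm h1 P0 S10 r1.
  have i2' := indep_residual sm h2 P0 S20 r2.
  have [B [hB rB uB eB]] := ldr_at sm i1' fP fS1.
  exists P, S1, S2; split; [split=> // | split; first by split].
    have [//|[c Ec]] := indep_or S2 S10; exfalso; apply: n12; apply/ldr_equivP.
    have c0 : c != 0 by apply: contra S20 => /eqP c0; rewrite Ec c0 scale0r.
    apply: rep_eqv_trans (eB _ h1 r1) (rep_eqv_sym (eB _ h2 _)).
    by apply: (residual_scale c0); rewrite -Ec.
  move=> v v0 fv.
  have [ind|[c Ec]] := indep_or v P0; last by exists c; constructor 1.
  (* A rational point v other than P is the residual point of some representation C, which must be
     equivalent to [A1] or [A2]; so v is S1 or S2 up to scale. *)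
  have [C [hC rC uC _]] := ldr_at sm ind fP fv.
  have scal S : S != 0 -> residual C P S -> exists c, v = c *: S.
    move=> S0 /uC [c Ec]; have c0 : c != 0 by apply: contra S0 => /eqP c0; rewrite Ec c0 scale0r.
    by exists c^-1; rewrite Ec scalerA mulVf // scale1r.
  have /lin_det_repP/all [] : exists2 A, rep_mx C = rep_mx A & ldr f A by exists C.
    by move=> /ldr_equivP/residual_eqv/(_ r1)/(scal _ S10) [c Ec]; exists c; constructor 2.
  by move=> /ldr_equivP/residual_eqv/(_ r2)/(scal _ S20) [c Ec]; exists c; constructor 3.
move=> [P [S1 [S2 [[i1' i2' i12] [[fP fS1 fS2] all]]]]].
have [P0 S10] := indep_unit i1'; have [_ S20] := indep_unit i2'.
have [A1 [h1 r1 u1 e1]] := ldr_at sm i1' fP fS1.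
have [A2 [h2 r2 u2 e2]] := ldr_at sm i2' fP fS2.
exists (rep_mx A1), (rep_mx A2); split; first by apply/lin_det_repP; exists A1.
split; first by apply/lin_det_repP; exists A2.
split.
  move=> /ldr_equivP/residual_eqv/(_ r1)/u2 [c Ec].
  by apply: (@indep_scale K S2 c); rewrite -Ec; apply: indep_sym.
move=> M /lin_det_repP [A -> hA].
have [S [S0 fS rS]] := residual_exists hA P0 fP.
have iPS := indep_residual sm hA P0 S0 rS.
have sc c T : S = c *: T -> residual A P T.
  move=> Ec; have c0 : c != 0 by apply: contra S0 => /eqP c0; rewrite Ec c0 scale0r.
  by apply: (residual_scale c0); rewrite -Ec.
have [c [Ec|/sc rT|/sc rT]] := all S S0 fS.
- by case: (@indep_scale K P c); rewrite -Ec.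
- by left; apply/ldr_equivP/rep_eqv_sym/e1.
- by right; apply/ldr_equivP/rep_eqv_sym/e2.
Qed.
End Correspondence.

(** * Normal forms for cubics with three points *)

Section NormalForms.
Variable K : finFieldType.
Implicit Types (f h : cubic K) (P R S u v w : 'cV[K]_3) (b c : K).

(* triangle: the tangent line at each of the three points passes through the
   next one; flexes: the three points are collinear flexes. *)
Definition triangle b c : cubic K := Cubic 0 0 0 0 1 1 0 0 b c.
Definition flexes b c : cubic K := Cubic 0 (- b) 0 0 1 0 0 (- 1) 0 (- c).

(** Dividing [triangle b c] by XYZ gives X/Y + Y/Z + b Z/X = - c, three terms with product b. With Y
    = 1, [flexes b c] reads x (- z) (c - x + z) = b, three factors with sum c. *)
Definition sum_prod c b := exists x1 x2 x3 : K, x1 + x2 + x3 = c /\ x1 * x2 * x3 = b.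

Definition cequiv f h :=
  exists A mu, [/\ A \in unitmx, mu != 0 & h = cscale mu (cact f A)].

Lemma cequiv_sym f h : cequiv f h -> cequiv h f.
Proof.
move=> [A [mu [uA mu0 ->]]]; exists (invmx A), mu^-1; rewrite unitmx_inv invr_neq0 //.
by split=> //; rewrite cactZ cactM mulmxV // cact1 cscaleM mulVf // cscale1.
Qed.

Lemma cequiv_trans f g h : cequiv f g -> cequiv g h -> cequiv f h.
Proof.
move=> [A [mu [uA mu0 ->]]] [B [nu [uB nu0 ->]]]; exists (A *m B), (nu * mu).
by rewrite unitmx_mul uA uB mulf_neq0 // cactZ cactM cscaleM.
Qed.

(** When f(u) = 0, the vanishing of [pol f u v] says that the tangent line at u passes through v. *)
Definition pol f u v := cpolar f (u^~ 0) (v^~ 0).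
Definition tri f u v w := ctri f (u^~ 0) (v^~ 0) (w^~ 0).

Lemma cact_cols3 f u v w : cact f (cols3 u v w) =
  Cubic (cvec f u) (cvec f v) (cvec f w) (pol f u v) (pol f u w)
        (pol f v u) (pol f v w) (pol f w u) (pol f w v) (tri f u v w).
Proof. by rewrite /cact /cev /cvec /pol /tri /cpolar /ctri !mxE. Qed.

Lemma cvec_line f u v (s t : K) : cvec f (s *: u + t *: v) =
  s ^+ 3 * cvec f u + s ^+ 2 * t * pol f u v + s * t ^+ 2 * pol f v u + t ^+ 3 * cvec f v.
Proof. rewrite /cvec /pol /cpolar /ceval /cderx /cdery /cderz !mxE; ring. Qed.

Lemma pol_lin f u v w (s t : K) : pol f u (s *: v + t *: w) = s * pol f u v + t * pol f u w.
Proof. rewrite /pol /cpolar !mxE; ring. Qed.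

Lemma pol_diag f u : pol f u u = cvec f u *+ 3.
Proof. rewrite /pol /cpolar /cvec /ceval /cderx /cdery /cderz; ring. Qed.

Lemma polZ f u v s : pol f u (s *: v) = s * pol f u v.
Proof. rewrite /pol /cpolar !mxE; ring. Qed.

Lemma polZl f u v s : pol f (s *: u) v = s ^+ 2 * pol f u v.
Proof. rewrite /pol /cpolar /cderx /cdery /cderz !mxE; ring. Qed.

Lemma cvecZ f u s : cvec f (s *: u) = s ^+ 3 * cvec f u.
Proof. rewrite /cvec /ceval !mxE; ring. Qed.

Lemma triZ f u v w s : tri f u v (s *: w) = s * tri f u v w.
Proof. rewrite /tri /ctri !mxE; ring. Qed.

Lemma cvec_comb f u v w x y z : cvec f (x *: u + y *: v + z *: w) =
  ceval (cact f (cols3 u v w)) x y z.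
Proof.
have := cvec_act f (cols3 u v w) (\col_i (if i == i0 then x else if i == i1 then y else z)).
by rewrite cols3_mul /cvec !mxE /= => ->.
Qed.

Lemma indep_line f u v : csmooth f -> indep u v -> cvec f u = 0 -> cvec f v = 0 ->
  pol f u v = 0 -> pol f v u != 0.
Proof.
move=> sm ind fu fv uv; apply/eqP => vu; have [w ug] := basis_ext ind.
apply: (@singular_line K (cact f (cols3 u v w))); last exact: csmooth_act.
all: by rewrite cact_cols3.
Qed.

(** Otherwise the gradient of f at u kills a basis. *)
Lemma indep_vertex f u v w : csmooth f -> cols3 u v w \in unitmx -> cvec f u = 0 ->
  pol f u v = 0 -> pol f u w != 0.
Proof.
move=> sm ug fu uv; apply/eqP => uw.
apply: (@singular_vertex K (cact f (cols3 u v w))); last exact: csmooth_act.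
all: by rewrite cact_cols3.
Qed.

Lemma cols3_span u v w : indep u v -> (forall s t : K, w <> s *: u + t *: v) ->
  cols3 u v w \in unitmx.
Proof.
move=> ind H; apply: unitmx_ker => x; rewrite cols3_mul => E.
have [x2|x2] := eqVneq (x i2 0) 0.
  move: E; rewrite x2 scale0r addr0 => /ind [x0 x1].
  by apply: cv3P; rewrite ?x0 ?x1 ?x2 mxE.
case: (H (- (x i0 0 / x i2 0)) (- (x i1 0 / x i2 0))).
apply: (scalerI x2); rewrite scalerDr !scalerA !mulrN ![x i2 0 * (_ / _)]mulrCA.
rewrite mulfV // !mulr1 !scaleNr -opprD; apply/eqP; rewrite -addr_eq0 addrC E //.
Qed.

Lemma cols3_inj u v w (a b c a' b' c' : K) : cols3 u v w \in unitmx ->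
  a *: u + b *: v + c *: w = a' *: u + b' *: v + c' *: w -> [/\ a = a', b = b' & c = c'].
Proof.
move=> ug; pose x (a b c : K) : 'cV[K]_3 := \col_i (if i == i0 then a else if i == i1 then b else c).
have E a1 b1 c1 : a1 *: u + b1 *: v + c1 *: w = cols3 u v w *m x a1 b1 c1.
  by rewrite cols3_mul !mxE.
rewrite !E => /(congr1 (mulmx (invmx (cols3 u v w)))); rewrite !mulKmx // => Ex.
have := (congr1 (fun x : 'cV[K]_3 => x i0 0) Ex, congr1 (fun x : 'cV[K]_3 => x i1 0) Ex,
  congr1 (fun x : 'cV[K]_3 => x i2 0) Ex).
by rewrite !mxE /= => -[[-> ->] ->].
Qed.

Lemma points_rot f P R S : points f P R S -> points f R S P.
Proof.
move=> [[i1 i2 i3] [[f1 f2 f3] all]]; split; [split=> //; exact: indep_sym|split=> // v v0 fv].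
by have [c [E|E|E]] := all v v0 fv; exists c; [constructor 3|constructor 1|constructor 2].
Qed.

Lemma points_swap f P R S : points f P R S -> points f R P S.
Proof.
move=> [[i1 i2 i3] [[f1 f2 f3] all]]; split; [split=> //; exact: indep_sym|split=> // v v0 fv].
by have [c [E|E|E]] := all v v0 fv; exists c; [constructor 2|constructor 1|constructor 3].
Qed.

Lemma comb_neq0 u v (s t : K) : indep u v -> (s != 0) || (t != 0) -> s *: u + t *: v != 0.
Proof. by move=> ind; apply: contraTneq => /ind [-> ->]; rewrite eqxx. Qed.

Lemma points_triangle f P R S : csmooth f -> points f P R S -> pol f P R = 0 ->
  exists b c, [/\ b != 0, cequiv f (triangle b c) & ~ sum_prod (- c) b].
Proof.
move=> sm [[PR PS RS] [[fP fR fS] all]] pPR.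
have pRP := indep_line sm PR fP fR pPR.
have ug : cols3 P R S \in unitmx.
  apply: cols3_span PR _ => s t E; move: fS; rewrite E cvec_line fP fR pPR.
  rewrite !mulr0 !add0r addr0 => /eqP; rewrite mulf_eq0 (negPf pRP) orbF mulf_eq0 expf_eq0 /=.
  case/orP=> /eqP z; rewrite z scale0r ?add0r ?addr0 in E.
    by apply: (@indep_scale K R t); rewrite -E.
  by apply: (@indep_scale K P s); rewrite -E.
have pPS := indep_vertex sm ug fP pPR.
have coord x y z : cvec f (x *: P + y *: R + z *: S) = 0 ->
    (x != 0) || (y != 0) || (z != 0) ->
    [\/ y = 0 /\ z = 0, x = 0 /\ z = 0 | x = 0 /\ y = 0].
  move=> f0 n0; have v0 : x *: P + y *: R + z *: S != 0.
    apply: contraTneq n0 => E.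
    have [|-> -> ->] := @cols3_inj P R S x y z 0 0 0 ug; last by rewrite !eqxx.
    by rewrite E !scale0r !addr0.
  have [c [E|E|E]] := all _ v0 f0.
  - have [|_ -> ->] := @cols3_inj P R S x y z c 0 0 ug; last by constructor 1.
    by rewrite E !scale0r !addr0.
  - have [|-> _ ->] := @cols3_inj P R S x y z 0 c 0 ug; last by constructor 2.
    by rewrite E !scale0r !addr0 add0r.
  - have [|-> -> _] := @cols3_inj P R S x y z 0 0 c ug; last by constructor 3.
    by rewrite E !scale0r !add0r.
(* The third intersection of the line PS with the curve has coordinates (- pol f S P, pol f P S) on
   it; if both were nonzero, it would be a fourth rational point. *)
have pSP : pol f S P = 0.
  apply/eqP; apply: contraT => n0.
  have [||[_ z0]|[x0 _]|[x0 _]] := coord (- pol f S P) 0 (pol f P S).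
  - rewrite scale0r addr0 cvec_line fP fS; ring.
  - by rewrite oppr_eq0 n0.
  - by rewrite z0 eqxx in pPS.
  - by move/eqP: x0; rewrite oppr_eq0 (negPf n0).
  - by move/eqP: x0; rewrite oppr_eq0 (negPf n0).
have ug' := cols3_rot ug.
have pSR := indep_vertex sm ug' fS pSP.
have pRS : pol f R S = 0.
  apply/eqP; apply: contraT => n0.
  have [||[y0 _]|[_ z0]|[_ y0]] := coord 0 (- pol f S R) (pol f R S).
  - rewrite scale0r add0r cvec_line fR fS; ring.
  - by rewrite !oppr_eq0 pSR orbT.
  - by move/eqP: y0; rewrite oppr_eq0 (negPf pSR).
  - by rewrite z0 eqxx in n0.
  - by move/eqP: y0; rewrite oppr_eq0 (negPf pSR).
pose al := pol f P S; pose be := pol f R P; pose ga := pol f S R; pose de := tri f P R S.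
pose b := ga * be / al ^+ 2; pose c := de / al.
have al0 : al != 0 := pPS. have be0 : be != 0 := pRP. have ga0 : ga != 0 := pSR.
exists b, c; split.
- by rewrite !mulf_neq0 ?invr_neq0 ?expf_neq0.
- exists (cols3 P R ((be / al) *: S)), be^-1; split.
  + apply: cols3_span PR _ => s t E.
    have := @cols3_inj P R S 0 0 (be / al) s t 0 ug; rewrite !scale0r !add0r addr0 => /(_ E) [_ _ /eqP].
    by rewrite mulf_eq0 invr_eq0 (negPf al0) (negPf be0).
  + by rewrite invr_neq0.
  rewrite cact_cols3; apply: cubicP => /=; rewrite ?cvecZ ?polZl ?polZ ?triZ ?fP ?fR ?fS ?pPR ?pSP ?pRS;
    rewrite -/al -/be -/ga -/de /b /c ?mulr0 //; by field; rewrite ?al0 ?be0.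
- move=> [x1 [x2 [x3 [Es Ep]]]].
  have b0 : b != 0 by rewrite !mulf_neq0 ?invr_neq0 ?expf_neq0.
  have [x10 x20] : x1 != 0 /\ x2 != 0.
    by move: b0; rewrite -Ep !mulf_eq0 !negb_or => /andP [/andP []].
  (* After normalisation this is the point with X/Y = x1 and Y/Z = x2. *)
  have [||[_ y0]|[x0 _]|[x0 _]] := coord (x1 * x2) x2 (be / al).
  + rewrite cvec_comb cact_cols3 fP fR fS pPR pSP pRS /ceval /= -/al -/be -/ga -/de.
    transitivity (be * x1 * x2 ^+ 2 * (x1 + x2 + x3 + c) + be * x2 * (b - x1 * x2 * x3)).
      by rewrite /b /c; field.
    by rewrite Es Ep subrr addNr !mulr0 addr0.
  + by rewrite x20 orbT.
  + by move/eqP: y0; rewrite mulf_eq0 invr_eq0 (negPf al0) (negPf be0).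
  + by move/eqP: x0; rewrite mulf_eq0 (negPf x10) (negPf x20).
  + by move/eqP: x0; rewrite mulf_eq0 (negPf x10) (negPf x20).
Qed.

Lemma points_flexes f P R S : csmooth f -> points f P R S ->
  pol f P R != 0 -> pol f R P != 0 -> pol f P S != 0 -> pol f R S != 0 ->
  exists b c, [/\ b != 0, cequiv f (flexes b c) & ~ sum_prod c b].
Proof.
move=> sm [[PR PS RS] [[fP fR fS] all]] pPR pRP pPS pRS.
pose x0 (u : 'cV[K]_3) := cderx f (u i0 0) (u i1 0) (u i2 0).
pose y0 (u : 'cV[K]_3) := cdery f (u i0 0) (u i1 0) (u i2 0).
pose z0 (u : 'cV[K]_3) := cderz f (u i0 0) (u i1 0) (u i2 0).
(* V is the meeting point of the tangents at P and R. *)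
have [V V0 [PV RV]] : exists2 V : 'cV[K]_3, V != 0 & pol f P V = 0 /\ pol f R V = 0.
  have [|V V0 EV] := @det_ker K (mx3 (x0 P) (y0 P) (z0 P) (x0 R) (y0 R) (z0 R) 0 0 0).
    by rewrite det3E !mxE /=; ring.
  exists V => //; split.
    have := congr1 (fun x : 'cV[K]_3 => x i0 0) EV; rewrite !mxE sum3E !mxE /= => <- //.
  have := congr1 (fun x : 'cV[K]_3 => x i1 0) EV; rewrite !mxE sum3E !mxE /= => <- //.
have ug : cols3 P R V \in unitmx.
  apply: cols3_span PR _ => s t E; move: PV RV; rewrite E !pol_lin !pol_diag fP fR !mul0rn !mulr0.
  rewrite add0r addr0 => /eqP; rewrite mulf_eq0 (negPf pPR) orbF => /eqP t0.
  move=> /eqP; rewrite mulf_eq0 (negPf pRP) orbF => /eqP s0.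
  by move: V0; rewrite E s0 t0 !scale0r addr0 eqxx.
have PVi : indep P V.
  move=> a b E; have [|-> _ ->] := @cols3_inj P R V a 0 b 0 0 0 ug; last by [].
  by rewrite !scale0r !addr0 E.
have RVi : indep R V.
  move=> a b E; have [|_ -> ->] := @cols3_inj P R V 0 a b 0 0 0 ug; last by [].
  by rewrite !scale0r !addr0 add0r E.
(* The tangent QV meets the curve twice at Q and once more at v. If v were not Q, it would have to
   be one of the other points, but the tangent contains none of them; so Q is a flex. *)
have half (Q : 'cV[K]_3) : cvec f Q = 0 -> pol f Q V = 0 -> pol f Q S != 0 ->
    (forall s t c : K, s *: Q + t *: V = c *: P -> t = 0) ->
    (forall s t c : K, s *: Q + t *: V = c *: R -> t = 0) -> pol f V Q = 0.
  move=> fQ QV QS HP HR; apply/eqP; apply: contraT => n0.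
  pose v := - cvec f V *: Q + pol f V Q *: V.
  have fv : cvec f v = 0 by rewrite cvec_line fQ QV; ring.
  have v0 : v != 0.
    by apply: contra n0 => /eqP E; rewrite (HP (- cvec f V) (pol f V Q) 0) // scale0r.
  have [c [/HP E|/HR E|E]] := all v v0 fv; [by rewrite E eqxx in n0..|].
  have := polZ f Q S c; rewrite -E pol_lin pol_diag fQ QV mul0rn !mulr0 addr0.
  move=> /esym/eqP; rewrite mulf_eq0 (negPf QS) orbF => /eqP c0.
  by rewrite E c0 scale0r eqxx in v0.
have VP : pol f V P = 0.
  apply: half => // s t c E.
    by have [|_ _ //] := @cols3_inj P R V s 0 t c 0 0 ug; rewrite ?scale0r ?addr0.
  by have [|_ _ //] := @cols3_inj P R V s 0 t 0 c 0 ug; rewrite ?scale0r ?addr0 ?add0r.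
have VR : pol f V R = 0.
  apply: half => // s t c E.
    by have [|_ _ //] := @cols3_inj P R V 0 s t c 0 0 ug; rewrite ?scale0r ?addr0 ?add0r.
  by have [|_ _ //] := @cols3_inj P R V 0 s t 0 c 0 ug; rewrite ?scale0r ?addr0 ?add0r.
have ug1 : cols3 V P R \in unitmx := cols3_rot ug.
have ug2 : cols3 R V P \in unitmx := cols3_rot ug1.
pose al := pol f P R; pose be := pol f R P; pose de := tri f P V R; pose ep := cvec f V.
have al0 : al != 0 := pPR. have be0 : be != 0 := pRP.
have ep0 : ep != 0.
  apply/eqP => fV.
  apply: (@singular_line K (cact f (cols3 P V R))); last first.
    apply: csmooth_act => //; rewrite unitmxE (_ : \det _ = - \det (cols3 P R V)) ?unitrN -?unitmxE //.
    by rewrite !det3E !mxE /=; ring.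
  1-4: by rewrite cact_cols3.
have fcomb x y z : cvec f (x *: P + y *: V + z *: R) =
    al * x ^+ 2 * z + be * x * z ^+ 2 + de * x * y * z + ep * y ^+ 3.
  rewrite cvec_comb cact_cols3 fP fR PV RV VP VR /ceval /= -/al -/be -/de -/ep; ring.
(* The third intersection of the line PR differs from P and R, so it is S. *)
have [s [t ES]] : exists s t, S = s *: P + t *: R.
  pose v := - be *: P + al *: R.
  have fv : cvec f v = 0 by rewrite cvec_line fP fR -/al -/be; ring.
  have v0 : v != 0 by apply: comb_neq0 PR _; rewrite oppr_eq0 be0.
  have [c [E|E|E]] := all v v0 fv.
  - have [|_ /eqP] := PR (- be - c) al; last by rewrite (negPf al0).
    by rewrite scalerBl addrAC -/v E subrr.
  - have [|/eqP] := PR (- be) (al - c); last by rewrite oppr_eq0 (negPf be0).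
    by rewrite scalerBl addrA -/v E subrr.
  - have c0 : c != 0 by apply: contra v0 => /eqP c0; rewrite E c0 scale0r.
    exists (c^-1 * - be), (c^-1 * al); rewrite -!scalerA -scalerDr -/v E scalerA mulVf //.
    by rewrite scale1r.
pose b := ep * be / al ^+ 2; pose c := - (de / al).
exists b, c; split.
- by rewrite !mulf_neq0 ?invr_neq0 ?expf_neq0.
- exists (cols3 P V ((- (al / be)) *: R)), (- (be / al ^+ 2)); split.
  + rewrite unitmxE (_ : \det _ = al / be * \det (cols3 P R V)).
      by rewrite unitrM -unitmxE ug unitfE !mulf_neq0 ?invr_neq0.
    by rewrite !det3E !mxE /=; ring.
  + by rewrite oppr_eq0 !mulf_neq0 ?invr_neq0 ?expf_neq0.
  rewrite cact_cols3; apply: cubicP => /=;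
    rewrite ?cvecZ ?polZl ?polZ ?triZ ?fP ?fR ?PV ?RV ?VP ?VR;
    rewrite -/al -/be -/de -/ep /b /c ?mulr0 //; by field; rewrite ?al0 ?be0.
move=> [x1 [x2 [x3 [Es Ep]]]].
(* In normalised coordinates this is (x1 : 1 : - x2), off the line that carries P, R and S. *)
pose v := x1 *: P + 1 *: V + (al / be * x2) *: R.
have fv : cvec f v = 0.
  rewrite fcomb.
  transitivity (ep * (b - x1 * x2 * x3) / b + al ^+ 2 / be * x1 * x2 * (x1 + x2 + x3 - c)).
    by rewrite /b /c; field; rewrite ?al0 ?be0 ?ep0.
  by rewrite Es Ep !subrr !mulr0 mul0r addr0.
have inj a1 b1 c1 a2 b2 c2 : a1 *: P + b1 *: V + c1 *: R = a2 *: P + b2 *: V + c2 *: R -> b1 = b2.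
  by rewrite !(addrAC _ _ (_ *: R)) => /(cols3_inj ug) [].
have n1 : (1 : K) <> 0 by apply/eqP; rewrite oner_eq0.
have v0 : v != 0.
  apply/eqP => E; apply: n1; apply: (inj x1 1 (al / be * x2) 0 0 0).
  by rewrite -/v E !scale0r !addr0.
have [d [E|E|E]] := all v v0 fv; apply: n1.
- by apply: (inj x1 1 (al / be * x2) d 0 0); rewrite -/v E !scale0r !addr0.
- by apply: (inj x1 1 (al / be * x2) 0 0 d); rewrite -/v E !scale0r !add0r.
- apply: (inj x1 1 (al / be * x2) (d * s) 0 (d * t)).
  by rewrite -/v E ES scale0r addr0 scalerDr !scalerA.
Qed.

Theorem normal_form f : csmooth f -> three_points f -> exists b c, b != 0 /\
  (cequiv f (triangle b c) /\ ~ sum_prod (- c) b \/ cequiv f (flexes b c) /\ ~ sum_prod c b).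
Proof.
move=> sm [P [R [S pts]]].
have tr P' R' S' : points f P' R' S' -> pol f P' R' = 0 -> exists b c, b != 0 /\
    (cequiv f (triangle b c) /\ ~ sum_prod (- c) b \/ cequiv f (flexes b c) /\ ~ sum_prod c b).
  move=> pts' E; have [b [c [b0 e n]]] := points_triangle sm pts' E.
  by exists b, c; split=> //; left.
have [/(tr _ _ _ pts) //|PR] := eqVneq (pol f P R) 0.
have [/(tr _ _ _ (points_swap pts)) //|RP] := eqVneq (pol f R P) 0.
have pts2 := points_swap (points_rot (points_rot pts)).
have [/(tr _ _ _ pts2) //|SP] := eqVneq (pol f P S) 0.
have [/(tr _ _ _ (points_rot pts)) //|RS] := eqVneq (pol f R S) 0.
have [b [c [b0 e n]]] := points_flexes sm pts PR RP SP RS.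
by exists b, c; split=> //; right.
Qed.
End NormalForms.

(** * Large fields *)

Section PowerSums.
Variable K : finFieldType.
Let q := #|K|.

Lemma sum_expr (n : nat) : (0 < n < q.-1)%N -> \sum_(x : K | x != 0) x ^+ n = 0.
Proof.
move=> /andP [n0 nq].
have [y y0 yn] : exists2 y : K, y != 0 & y ^+ n != 1.
  apply/exists_inP; apply: contraT; rewrite negb_exists_in => /forall_inP H.
  have p0 : ('X^n - 1 : {poly K}) != 0 by rewrite -size_poly_gt0 size_XnsubC.
  have := @max_poly_roots K ('X^n - 1) (enum (predC1 (0 : K))) p0.
  rewrite size_XnsubC // -cardE cardC1 enum_uniq ltnS leqNgt nq => /(_ _ isT) H'.
  apply: H'; apply/allP => x; rewrite mem_enum inE => x0.
  by rewrite /root !hornerE; move: (H x x0); rewrite negbK => /eqP ->; rewrite subrr.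
have E : \sum_(x : K | x != 0) x ^+ n = y ^+ n * \sum_(x : K | x != 0) x ^+ n.
  rewrite {1}(reindex_onto (fun x => y * x) (fun x => y^-1 * x)) /=; last first.
    by move=> x _; rewrite mulVKf.
  rewrite mulr_sumr; apply: eq_big => [x|x _]; last by rewrite exprMn.
  by rewrite mulKf // eqxx andbT mulf_eq0 (negPf y0).
apply/eqP; have : (y ^+ n - 1) * (\sum_(x : K | x != 0) x ^+ n) == 0.
  by rewrite mulrBl mul1r -E subrr.
by rewrite mulf_eq0 subr_eq0 (negPf yn).
Qed.

Lemma sum_exprV (n : nat) : (0 < n < q.-1)%N -> \sum_(x : K | x != 0) x^-1 ^+ n = 0.
Proof.
move=> hn; rewrite (reindex_onto (@GRing.inv K) (@GRing.inv K)) /=; last by move=> x _; rewrite invrK.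
rewrite -[RHS](sum_expr hn); apply: eq_big => [x|x _]; last by rewrite invrK.
by rewrite invrK eqxx andbT invr_eq0.
Qed.

Lemma card_natr : q%:R = 0 :> K.
Proof.
apply: (@addrI K (\sum_(x : K) x)); rewrite addr0.
by rewrite [RHS](reindex_inj (addIr 1)) big_split /= sumr_const.
Qed.

Lemma sum_const (a : K) : \sum_(x : K | x != 0) a = - a.
Proof.
apply/eqP; rewrite -addr_eq0 addrC; have := mulr_natr a q; rewrite card_natr mulr0 => /esym/eqP.
by rewrite -[a *+ q]sumr_const (bigD1 (0 : K)) //= addrC.
Qed.

(* Otherwise x -> - x^2 + c x + b / x is injective on the nonzero elements, so
   it takes all values but one, s0. Comparing the power sums of degrees 1, 2, 3
   of its values gives s0 = 0, then 2 b c = 0, then 3 b^2 = 0; hence c = 0 and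
   the characteristic is 3, where b has a cube root x, which is sent to 0. *)
Lemma sum_prod_exists (c b : K) : (7 < #|K|)%N -> b != 0 -> sum_prod c b.
Proof.
move=> K8 b0.
have [|H] := boolP [exists v : K * K, v.1 * v.2 * (c - v.1 - v.2) == b].
  case/existsP => -[x y] /= /eqP E; exists x, y, (c - x - y); split=> //; ring.
exfalso; have {}H x y : x * y * (c - x - y) <> b.
  by move=> E; move/negP: H; apply; apply/existsP; exists (x, y); rewrite /= E.
pose g (x : K) := - x ^+ 2 + c * x + b * x^-1.
(* The reason is g(x) - g(y) = (x - y) (c - x - y - b / (x y)). *)
have gi : {in [set~ (0 : K)] &, injective g}.
  move=> x y; rewrite !inE => x0 y0 E; apply/eqP; apply: contraT => xy.
  case: (H x y); have xy' : x - y != 0 by rewrite subr_eq0.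
  apply: (mulfI xy'); apply/eqP; rewrite -subr_eq0; apply/eqP.
  transitivity ((g x - g y) * (x * y)); first by rewrite /g; field; rewrite x0 y0.
  by rewrite E subrr mul0r.
pose I := [set g x | x in [set~ (0 : K)]].
have cI : #|I| = #|K|.-1 by rewrite card_in_imset // cardsC1.
have /eqP/cards1P [s0 Es0] : #|~: I| = 1%N.
  rewrite cardsCs setCK cI -subn1 subKn //; exact: ltnW (finNzRing_gt1 K).
have sI : s0 \notin I by rewrite -in_setC Es0 inE.
have tot (n : nat) : (0 < n < #|K|.-1)%N -> \sum_(x : K | x != 0) g x ^+ n = - s0 ^+ n.
  move=> hn; have S0 : \sum_(s : K) s ^+ n = 0.
    rewrite (bigD1 (0 : K)) //= (sum_expr hn) addr0 expr0n.
    by case: n hn.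
  have : \sum_(s in I) s ^+ n + s0 ^+ n = 0.
    rewrite -[RHS]S0 [RHS](bigID (mem I)) /=; congr (_ + _).
    rewrite (eq_bigl (mem (~: I))) => [|s]; last by rewrite /= in_setC.
    by rewrite Es0 big_set1.
  rewrite big_imset //= => /eqP; rewrite addr_eq0 => /eqP <-.
  by apply: eq_bigl => x; rewrite in_setC1.
(* This is where q > 7 enters: exponents up to 6 occur in g^3. *)
have P n : (0 < n < 7)%N -> (0 < n < #|K|.-1)%N.
  by case/andP=> -> n7; apply: leq_trans n7 _; move: K8; case: #|K|.
have p (a : K) n : (0 < n < 7)%N -> \sum_(x : K | x != 0) a * x ^+ n = 0.
  by move=> /P hn; rewrite -mulr_sumr sum_expr ?mulr0.
have pV (a : K) n : (0 < n < 7)%N -> \sum_(x : K | x != 0) a * x^-1 ^+ n = 0.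
  by move=> /P hn; rewrite -mulr_sumr sum_exprV ?mulr0.
have s00 : s0 = 0.
  have := tot 1%N (P 1%N isT).
  rewrite (eq_bigr (fun x => - 1 * x ^+ 2 + c * x ^+ 1 + b * x^-1 ^+ 1)) => [|x _]; last first.
    by rewrite /g; ring.
  by rewrite !big_split /= !p // pV // !addr0 expr1 => E; rewrite -[s0]opprK -E oppr0.
have E2 : b * c *+ 2 = 0.
  have := tot 2 (P 2 isT).
  rewrite (eq_bigr (fun x => 1 * x ^+ 4 + (- c *+ 2) * x ^+ 3 + c ^+ 2 * x ^+ 2 + (- b *+ 2) * x ^+ 1
    + b * c *+ 2 + b ^+ 2 * x^-1 ^+ 2)) => [|x x0]; last by rewrite /g; field.
  rewrite !big_split /= !p // pV // sum_const s00 expr0n /= oppr0 !add0r addr0.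
  by move=> E; rewrite mulr2n -[_ + _]opprK opprD E oppr0.
have E3 : b ^+ 2 *+ 3 = 0.
  have := tot 3 (P 3 isT).
  rewrite (eq_bigr (fun x => - 1 * x ^+ 6 + (c *+ 3) * x ^+ 5 + (- c ^+ 2 *+ 3) * x ^+ 4
    + (c ^+ 3 + b *+ 3) * x ^+ 3 + (- (b * c) *+ 6) * x ^+ 2 + (b * c ^+ 2 *+ 3) * x ^+ 1
    + - (b ^+ 2 *+ 3) + (b ^+ 2 * c *+ 3) * x^-1 ^+ 1 + b ^+ 3 * x^-1 ^+ 3)) => [|x x0]; last first.
    by rewrite /g; field.
  by rewrite !big_split /= !p // !pV // sum_const s00 expr0n /= oppr0 !add0r !addr0 opprK.
have three : 3%:R = 0 :> K.
  by move/eqP: E3; rewrite -mulr_natr mulf_eq0 expf_eq0 /= (negPf b0) /= => /eqP.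
have c0 : c = 0.
  move/eqP: E2; rewrite -mulr_natr !mulf_eq0 (negPf b0) /= => /orP [/eqP //|/eqP two].
  have : (1 : K) = 3%:R - 2%:R by ring.
  by rewrite three two subrr => /eqP; rewrite oner_eq0.
have cub : injective (fun x : K => x ^+ 3).
  move=> x y E; apply/eqP; rewrite -subr_eq0.
  have : (x - y) ^+ 3 == 0.
    have -> : (x - y) ^+ 3 = x ^+ 3 - y ^+ 3 - 3%:R * (x * y * (x - y)) by ring.
    by rewrite E three mul0r subrr subrr.
  by rewrite expf_eq0.
have [x Ex] : exists x : K, x ^+ 3 = b by exists (invF cub b); rewrite (f_invF cub).
have x0 : x != 0 by apply: contra b0 => /eqP E; rewrite -Ex E expr0n.
move/negP: sI; apply; apply/imsetP; exists x; first by rewrite !inE.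
by rewrite s00 /g c0 -Ex; field.
Qed.
End PowerSums.

(** * Small fields *)

Section NormalFormProperties.
Variable K : finFieldType.
Implicit Types (f h : cubic K) (u v w : 'cV[K]_3) (b c t : K).

Lemma expr_eq0 (R : idomainType) (x : R) n : x ^+ n.+1 = 0 -> x = 0.
Proof. by move/eqP; rewrite expf_eq0 => /eqP. Qed.

(** At a singular point the terms of the form satisfy P = Q = R and T = - 3 P. Since P Q R = b
    (xyz)^3 and T^3 = c^3 (xyz)^3, the factor c^3 + 27 b forces xyz = 0 and all terms to vanish. *)
Lemma triangle_smooth b c : b != 0 -> c ^+ 3 + b *+ 27 != 0 -> csmooth (triangle b c).
Proof.
move=> b0 bc L g x y z; rewrite /ceval /cderx /cdery /cderz /= !rmorph0 !rmorph1.
rewrite !(mul0r, mul1r, mulr0, mulr1, add0r, addr0, mul0rn).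
move=> F0 Fx Fy Fz.
set P := x ^+ 2 * z; set Q := x * y ^+ 2; set R := g b * y * z ^+ 2.
set T := g c * x * y * z.
have gb0 : g b != 0 by rewrite fmorph_eq0.
have PR : P = R.
  apply: subr0_eq.
  have := congr2 (fun s t : L => x * s - t) Fx F0; rewrite mulr0 subr0 => <-.
  by rewrite /P /R; ring.
have QP : Q = P.
  apply: subr0_eq.
  have := congr2 (fun s t : L => y * s - t) Fy F0; rewrite mulr0 subr0 => <-.
  by rewrite /P /Q; ring.
have PT : T = - (P *+ 3).
  apply/eqP; rewrite -addr_eq0 -F0; apply/eqP.
  by rewrite -/P -/Q -/R -/T QP -PR; ring.
have P0 : P = 0.
  have E1 : P ^+ 3 = g b * (x * y * z) ^+ 3.
    by rewrite 2!exprS expr1 {2}PR -{1}QP /P /Q /R; ring.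
  have : (x * y * z) ^+ 3 * g (c ^+ 3 + b *+ 27) = 0.
    rewrite rmorphD rmorphXn rmorphMn /= mulrDr.
    have -> : (x * y * z) ^+ 3 * g c ^+ 3 = T ^+ 3 by rewrite /T; ring.
    by rewrite mulrnAr [_ * g b]mulrC -E1 PT; ring.
  move/eqP; rewrite mulf_eq0 fmorph_eq0 (negPf bc) orbF => /eqP E2.
  by apply: (@expr_eq0 _ _ 2); rewrite E1 E2 mulr0.
have Q0 : Q = 0 by rewrite QP.
have R0 : R = 0 by rewrite -PR.
have [x0|x0] := eqVneq x 0.
  move: Fx Fy; rewrite x0 !(mulr0, mul0r, add0r, addr0, mul0rn) => Fx.
  move=> /eqP; rewrite mulf_eq0 (negPf gb0) expf_eq0 /= => /eqP z0.
  by move: Fx; rewrite z0 mulr0 addr0 => /eqP; rewrite expf_eq0 /= => /eqP ->.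
have z0 : z = 0 by move/eqP: P0; rewrite mulf_eq0 expf_eq0 /= (negPf x0) => /eqP.
have y0 : y = 0 by move/eqP: Q0; rewrite mulf_eq0 expf_eq0 /= (negPf x0) => /eqP.
move: Fz; rewrite z0 y0 !(mulr0, mul0r, add0r, addr0, mul0rn) => /eqP.
by rewrite expf_eq0 /= (negPf x0).
Qed.

(** A singular point with x z != 0 satisfies z = - x, 3 x = c y and x^3 = b y^3, hence (c^3 - 27 b)
    y^3 = 0. *)
Lemma flexes_smooth b c : b != 0 -> c ^+ 3 - b *+ 27 != 0 -> csmooth (flexes b c).
Proof.
move=> b0 bc L g x y z; rewrite /ceval /cderx /cdery /cderz /= !rmorphN !rmorph0 !rmorph1.
rewrite !(mul0r, mul1r, mulr0, mulr1, add0r, addr0, mul0rn).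
have gb0 : g b != 0 by rewrite fmorph_eq0.
have F00 : - g b * y ^+ 3 = 0 -> y = 0.
  by move=> /eqP; rewrite mulf_eq0 oppr_eq0 (negPf gb0) expf_eq0 /= => /eqP.
have [z0|z0] := eqVneq z 0.
  rewrite z0 => F0 Fx Fy Fz.
  have y0 : y = 0 by apply: F00; move: F0 => <-; ring.
  by split=> //; apply: (@expr_eq0 _ _ 1); move: Fz; rewrite y0 => <-; ring.
have [x0|x0] := eqVneq x 0.
  rewrite x0 => F0 Fx Fy Fz.
  have y0 : y = 0 by apply: F00; move: F0 => <-; ring.
  split=> //; apply: (@expr_eq0 _ _ 1).
  by move: (congr1 -%R Fx); rewrite y0 oppr0 => <-; ring.
move=> F0 Fx Fy Fz.
have E1 : x *+ 2 - z - g c * y = 0 by apply: (mulfI z0); rewrite mulr0 -Fx; ring.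
have E2 : x - z *+ 2 - g c * y = 0 by apply: (mulfI x0); rewrite mulr0 -Fz; ring.
have zx : z = - x.
    apply/eqP; rewrite -addr_eq0; have := congr2 (fun s t : L => s - t) E1 E2; rewrite subrr => <-.
    by apply/eqP; ring.
have E3 : x *+ 3 = g c * y by apply: subr0_eq; move: E1; rewrite zx => <-; ring.
have E3' : x *+ 3 - g c * y = 0 by rewrite E3 subrr.
have E4 : x ^+ 3 = g b * y ^+ 3.
  apply: subr0_eq.
  have := congr2 (fun s t : L => s + x ^+ 2 * t) F0 E3'; rewrite mulr0 addr0 => <-; rewrite zx; ring.
have : g (c ^+ 3 - b *+ 27) * y ^+ 3 = 0.
  rewrite rmorphB rmorphXn rmorphMn /= mulrBl mulrnAl -E4 -exprMn -E3; ring.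
move/eqP; rewrite mulf_eq0 fmorph_eq0 (negPf bc) expf_eq0 /= => /eqP y0.
by case/eqP: x0; apply: (@expr_eq0 _ _ 2); rewrite E4 y0 expr0n mulr0.
Qed.

Lemma e_E i j (a : 'I_1) : (e_ K i) j a = (j == i)%:R.
Proof. by rewrite mxE (ord1 a) eqxx andbT. Qed.

Lemma indep_e i j : i != j -> indep (e_ K i) (e_ K j).
Proof.
move=> ij s t E; split.
  have := congr1 (fun v : 'cV[K]_3 => v i 0) E.
  by rewrite !mxE !eqxx (negPf ij) /= mulr1 mulr0 addr0.
have := congr1 (fun v : 'cV[K]_3 => v j 0) E.
by rewrite !mxE !eqxx eq_sym (negPf ij) /= mulr1 mulr0 add0r.
Qed.

Lemma triangle_points b c : b != 0 -> ~ sum_prod (- c) b ->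
  points (triangle b c) (e_ K i0) (e_ K i1) (e_ K i2).
Proof.
move=> b0 ns.
have cE v : cvec (triangle b c) v = v i0 0 ^+ 2 * v i2 0 + v i0 0 * v i1 0 ^+ 2
    + b * v i1 0 * v i2 0 ^+ 2 + c * v i0 0 * v i1 0 * v i2 0.
  by rewrite /cvec /ceval /=; ring.
split; [by split; apply: indep_e|split; first by split; rewrite cE !e_E /=; ring].
move=> v _; rewrite cE => F0.
have [x0|x0] := eqVneq (v i0 0) 0.
  move: F0; rewrite x0 !(mulr0, mul0r, add0r, addr0, expr0n) /= => /eqP.
  rewrite !mulf_eq0 (negPf b0) /= orbb => /orP [] /eqP E0.
    by exists (v i2 0); constructor 3; apply: cv3P; rewrite !mxE /= ?mulr0 ?mulr1.
  by exists (v i1 0); constructor 2; apply: cv3P; rewrite !mxE /= ?mulr0 ?mulr1.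
have [y0|y0] := eqVneq (v i1 0) 0.
  move: F0; rewrite y0 !(mulr0, mul0r, add0r, addr0, expr0n) /= => /eqP.
  rewrite mulf_eq0 expf_eq0 /= (negPf x0) /= => /eqP z0.
  by exists (v i0 0); constructor 1; apply: cv3P; rewrite !mxE /= ?mulr0 ?mulr1.
have [z0|z0] := eqVneq (v i2 0) 0.
  move: F0; rewrite z0 !(mulr0, mul0r, add0r, addr0, expr0n) /= => /eqP.
  by rewrite mulf_eq0 expf_eq0 /= (negPf x0) (negPf y0).
case: ns; exists (v i0 0 / v i1 0), (v i1 0 / v i2 0), (b * v i2 0 / v i0 0).
split; last by field; rewrite x0 y0 z0.
apply: (mulfI (mulf_neq0 (mulf_neq0 x0 y0) z0)); apply/eqP; rewrite -subr_eq0 -F0.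
by apply/eqP; field; rewrite x0 y0 z0.
Qed.

Lemma flexes_points b c : b != 0 -> ~ sum_prod c b ->
  points (flexes b c) (e_ K i0) (e_ K i2) (e_ K i0 + e_ K i2).
Proof.
move=> b0 ns.
have cE v : cvec (flexes b c) v = v i0 0 ^+ 2 * v i2 0 - v i0 0 * v i2 0 ^+ 2
    - b * v i1 0 ^+ 3 - c * v i0 0 * v i1 0 * v i2 0.
  by rewrite /cvec /ceval /=; ring.
split.
  split; first exact: indep_e.
    move=> s t; rewrite scalerDr addrA -scalerDl => /(@indep_e i0 i2 isT) [E t0].
    by move: E; rewrite t0 addr0.
  move=> s t; rewrite scalerDr addrCA -scalerDl => /(@indep_e i0 i2 isT) [t0 E].
  by move: E; rewrite t0 addr0.
split; first by split; rewrite cE !(mxE, e_E) /=; ring.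
move=> v _; rewrite cE => F0.
have [y0|y0] := eqVneq (v i1 0) 0.
  have : v i0 0 * (v i2 0 * (v i0 0 - v i2 0)) = 0 by rewrite -F0 y0; ring.
  move/eqP; rewrite !mulf_eq0 subr_eq0 => /or3P [] /eqP E0.
  - by exists (v i2 0); constructor 2; apply: cv3P; rewrite !mxE /= ?mulr0 ?mulr1.
  - by exists (v i0 0); constructor 1; apply: cv3P; rewrite !mxE /= ?mulr0 ?mulr1.
  - by exists (v i2 0); constructor 3; apply: cv3P; rewrite !mxE /= ?addr0 ?add0r ?mulr0 ?mulr1.
case: ns; exists (v i0 0 / v i1 0), (- v i2 0 / v i1 0), (c - v i0 0 / v i1 0 + v i2 0 / v i1 0).
split; first by ring.
apply: (mulfI (expf_neq0 3 y0)); apply/eqP; rewrite -subr_eq0 -F0.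
by apply/eqP; field.
Qed.

(* Then both triangle b (- c) and flexes b c are smooth with exactly three
   points. *)
Definition nonsum b c := [/\ b != 0, c ^+ 3 - b *+ 27 != 0 & ~ sum_prod c b].

Lemma triangle_two b c : nonsum b c -> two_ldr_cubic (cpoly (triangle b (- c))).
Proof.
case=> b0 bc ns; have sm : csmooth (triangle b (- c)).
  apply: triangle_smooth => //; apply: contra bc => /eqP E; apply/eqP.
  by rewrite -[RHS]oppr0 -E; ring.
split; first exact/smooth_cpoly.
apply/(exactly_two_three_points sm); exists (e_ K i0), (e_ K i1), (e_ K i2).
by apply: triangle_points; rewrite ?opprK.
Qed.

Lemma flexes_two b c : nonsum b c -> two_ldr_cubic (cpoly (flexes b c)).
Proof.
case=> b0 bc ns; have sm := flexes_smooth b0 bc.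
split; first exact/smooth_cpoly.
apply/(exactly_two_three_points sm); exists (e_ K i0), (e_ K i2), (e_ K i0 + e_ K i2).
exact: flexes_points.
Qed.

Lemma triangle_scale b c t : t != 0 -> cequiv (triangle b c) (triangle (t ^+ 3 * b) (t * c)).
Proof.
move=> t0; exists (cols3 (e_ K i0) (t *: e_ K i1) (t ^+ 2 *: e_ K i2)), (t ^- 2); split.
- by rewrite unitmxE det3E !mxE /= unitfE; rewrite !(mulr0, mulr1, mul1r, subr0, addr0, mul0r) mulf_neq0 ?expf_neq0.
- by rewrite invr_neq0 // expf_neq0.
rewrite cact_cols3 /cvec /pol /tri /cpolar /ctri /ceval /cderx /cdery /cderz.
by apply: cubicP; rewrite /= !mxE /=; field.
Qed.

Lemma flexes_scale b c t : t != 0 -> cequiv (flexes b c) (flexes (t ^+ 3 * b) (t * c)).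
Proof.
move=> t0; exists (cols3 (e_ K i0) (t *: e_ K i1) (e_ K i2)), 1; split.
- by rewrite unitmxE det3E !mxE /= unitfE; rewrite !(mulr0, mulr1, mul1r, subr0, addr0, mul0r).
- exact: oner_neq0.
rewrite cact_cols3 /cvec /pol /tri /cpolar /ctri /ceval /cderx /cdery /cderz.
by apply: cubicP; rewrite /= !mxE /=; ring.
Qed.

Lemma two_ldr_normal_form G : two_ldr_cubic G ->
  exists f b c, [/\ G = cpoly f, b != 0, ~ sum_prod c b &
    cequiv (triangle b (- c)) f \/ cequiv (flexes b c) f].
Proof.
move=> [sm two]; have EG := homog3E (proj1 (proj2 sm)); move: sm two; rewrite EG.
move: (ccoef G) => f /smooth_cpoly sm /(exactly_two_three_points sm) /(normal_form sm).
case=> b [c [b0 [[/cequiv_sym e n]|[/cequiv_sym e n]]]].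
  by exists f, b, (- c); rewrite opprK; split=> //; left.
by exists f, b, c; split=> //; right.
Qed.
End NormalFormProperties.

(** * Inequivalence of the normal forms *)

Section Inequivalence.
Variable K : finFieldType.
Implicit Types (f h : cubic K) (u v w : 'cV[K]_3) (b c t : K).

Lemma cols3_col (A : 'M[K]_3) : A = cols3 (A *m e_ K i0) (A *m e_ K i1) (A *m e_ K i2).
Proof.
apply/matrixP => i j; rewrite !mxE !sum3E !e_E.
by move: j; apply: ord3P; rewrite /= !(mulr0, mulr1, addr0, add0r).
Qed.

Lemma zero_mulmx f h A mu v : mu != 0 -> h = cscale mu (cact f A) -> cvec h v = 0 ->
  cvec f (A *m v) = 0.
Proof.
move=> mu0 ->; rewrite -cvec_act /cvec.
have -> x y z : ceval (cscale mu (cact f A)) x y z = mu * ceval (cact f A) x y z.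
  by rewrite /ceval /=; ring.
by move/eqP; rewrite mulf_eq0 (negPf mu0) => /eqP.
Qed.

Lemma unitmx_neq0 (A : 'M[K]_3) v : A \in unitmx -> v != 0 -> A *m v != 0.
Proof.
move=> uA; apply: contra => /eqP E; apply/eqP.
by rewrite -[v](mulKmx uA) E mulmx0.
Qed.

Lemma e_neq0 i : e_ K i != 0.
Proof.
by apply/eqP => /(congr1 (fun v : 'cV[K]_3 => v i 0))/eqP; rewrite e_E mxE eqxx oner_eq0.
Qed.

Lemma zero_points f h A mu P R S v : points f P R S -> A \in unitmx -> mu != 0 ->
  h = cscale mu (cact f A) -> v != 0 -> cvec h v = 0 ->
  exists c, [\/ A *m v = c *: P, A *m v = c *: R | A *m v = c *: S].
Proof.
by move=> [_ [_ all]] uA mu0 E v0 hv; apply: all; [exact: unitmx_neq0 | exact: zero_mulmx E hv].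
Qed.

Lemma triangle_vertices b c i : cvec (triangle b c) (e_ K i) = 0.
Proof. by rewrite /cvec /ceval !e_E; move: i; apply: ord3P; rewrite /=; ring. Qed.

(** The three points of the first curve are not collinear, while those of the second lie on Y =
    0. *)
Lemma triangle_flexes b c b' c' : nonsum b' c' -> ~ cequiv (triangle b c) (flexes b' c').
Proof.
case=> b0 _ ns /cequiv_sym [A [mu [uA mu0 E]]].
have Y i : (A *m e_ K i) i1 0 = 0.
  have [s] := zero_points (flexes_points b0 ns) uA mu0 E (e_neq0 i) (triangle_vertices b c i).
  by case=> ->; rewrite !mxE /= ?addr0 mulr0.
move: uA; rewrite (cols3_col A) unitmxE unitfE det3E.
move: (A *m e_ K i0) (A *m e_ K i1) (A *m e_ K i2) (Y i0) (Y i1) (Y i2) => u v w Yu Yv Yw.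
by rewrite !mxE /= Yu Yv Yw; case/eqP; ring.
Qed.

Lemma pol_triangle b c i j : pol (triangle b c) (e_ K i) (e_ K j) =
  ((i == i0) && (j == i2) || (i == i1) && (j == i0))%:R + ((i == i2) && (j == i1))%:R * b.
Proof.
rewrite /pol /cpolar /cderx /cdery /cderz !e_E.
by move: i; apply: ord3P; move: j; apply: ord3P; rewrite /=; ring.
Qed.

Lemma tri_rot f u v w : tri f u v w = tri f v w u.
Proof. by rewrite /tri /ctri; ring. Qed.

Lemma triZ3 f u v w r s t :
  tri f (r *: u) (s *: v) (t *: w) = r * s * t * tri f u v w.
Proof. by rewrite /tri /ctri !mxE; ring. Qed.

(** An equivalence permutes the three vertices up to scalars, and cyclically, since it respects
    which tangent passes through which vertex. *)
Lemma triangle_triangle b c b' c' : nonsum b (- c) -> cequiv (triangle b c) (triangle b' c') ->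
  exists t, b' = t ^+ 3 * b /\ c' = t * c.
Proof.
case=> b0 _ ns [A [mu [uA mu0 E]]].
have Y i : exists k s, A *m e_ K i = s *: e_ K k.
  have [s] := zero_points (triangle_points b0 ns) uA mu0 E (e_neq0 i) (triangle_vertices b' c' i).
  by case=> ->; [exists i0|exists i1|exists i2]; exists s.
case: (Y i0) (Y i1) (Y i2) => k0 [s0 E0] [k1 [s1 E1]] [k2 [s2 E2]].
move: E; rewrite (cols3_col A) cact_cols3 E0 E1 E2 => E.
have := (congr1 (@c201 K) E, congr1 (@c120 K) E, congr1 (@c012 K) E, congr1 (@c111 K) E).
rewrite /= !polZ !polZl triZ3 => -[[[F1 F2] F3] F4].
have nz (r s x : K) : 1 = r * (s * x) -> x != 0.
  by move=> F; apply: contra_eq_neq F => ->; rewrite !mulr0 oner_neq0.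
have T : tri (triangle b c) (e_ K i0) (e_ K i1) (e_ K i2) = c.
  by rewrite /tri /ctri !e_E /=; ring.
have k02 : pol (triangle b c) (e_ K k0) (e_ K k2) != 0.
  by apply: (@nz (mu * s2) (s0 ^+ 2)); rewrite {1}F1; ring.
have k10 : pol (triangle b c) (e_ K k1) (e_ K k0) != 0.
  by apply: (@nz (mu * s0) (s1 ^+ 2)); rewrite {1}F2; ring.
(* The XYZ coefficient is multiplied by this t, and the product 1 * 1 * b of the other three
   coefficients by its cube. *)
exists (mu * s0 * s1 * s2).
have [T1 T2] : tri (triangle b c) (e_ K k0) (e_ K k1) (e_ K k2) = c /\
    pol (triangle b c) (e_ K k0) (e_ K k2) * pol (triangle b c) (e_ K k1) (e_ K k0) *
    pol (triangle b c) (e_ K k2) (e_ K k1) = b.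
  move: k02 k10; rewrite !pol_triangle => {F1 F2 F3 F4 E0 E1 E2 E}.
  move: k0 k1 k2; do 3! apply: ord3P; rewrite /= ?mul0r ?addr0 ?eqxx // => _ _; split; try by ring.
  - exact: T.
  - by rewrite -tri_rot.
  - by rewrite tri_rot.
split; last by rewrite F4 T1; ring.
move: F1 F2 F3 T2; move: (pol _ (_ k0) _) (pol _ (_ k1) _) (pol _ (_ k2) _) => p1 p2 p3 F1 F2 F3 T2.
by rewrite -[LHS]mulr1 -[LHS]mulr1 {1}F1 F2 F3 -T2; ring.
Qed.

Lemma flexes_vertices b c :
  [/\ cvec (flexes b c) (e_ K i0) = 0, cvec (flexes b c) (e_ K i2) = 0
    & cvec (flexes b c) (e_ K i0 + e_ K i2) = 0].
Proof. by rewrite /cvec /ceval !mxE /=; split; ring. Qed.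

(** For c = 0 the tangents at the three flexes all pass through (0 : 1 : 0). An equivalence fixes
    this point, and comparing the coefficients of Y^3 relates b' to b. *)
Lemma flexes_flexes b b' : nonsum b 0 -> cequiv (flexes b 0) (flexes b' 0) ->
  exists t, b' = t ^+ 3 * b.
Proof.
case=> b0 _ ns [A [mu [uA mu0 E]]].
have [V0 V2 _] := flexes_vertices b' 0.
have [s0 E0] := zero_points (flexes_points b0 ns) uA mu0 E (e_neq0 i0) V0.
have [s2 E2] := zero_points (flexes_points b0 ns) uA mu0 E (e_neq0 i2) V2.
move: E; rewrite (cols3_col A) cact_cols3; move: (A *m e_ K i1) => v E.
have := (congr1 (@c201 K) E, congr1 (@c102 K) E, congr1 (@c210 K) E, congr1 (@c012 K) E,
  congr1 (@c030 K) E).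
move=> {E} /= -[[[[F1 F2] F3] F4] F5].
have p u w : pol (flexes b 0) u w = (u i0 0 * u i2 0 *+ 2 - u i2 0 ^+ 2) * w i0 0
    + (u i0 0 ^+ 2 - u i0 0 * u i2 0 *+ 2) * w i2 0 - b * u i1 0 ^+ 2 * w i1 0 *+ 3.
  by rewrite /pol /cpolar /cderx /cdery /cderz /=; ring.
have cE w : cvec (flexes b 0) w = w i0 0 ^+ 2 * w i2 0 - w i0 0 * w i2 0 ^+ 2 - b * w i1 0 ^+ 3.
  by rewrite /cvec /ceval /=; ring.
have H (P Q : 'cV[K]_3) : A *m e_ K i0 = s0 *: P -> A *m e_ K i2 = s2 *: Q ->
    pol (flexes b 0) P Q ^+ 2 = 1 -> pol (flexes b 0) Q P ^+ 2 = 1 ->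
    (pol (flexes b 0) P v = 0 -> pol (flexes b 0) Q v = 0 -> v i0 0 = 0 /\ v i2 0 = 0) ->
    exists t, b' = t ^+ 3 * b.
  move=> EP EQ; move: F1 F2 F3 F4; rewrite EP EQ !polZ !polZl.
  move: (pol _ P Q) (pol _ Q P) => x1 x2 F1 F2 F3 F4 x11 x22 v02.
  have n0 : mu * s0 * s2 != 0.
    apply: contra_eq_neq F1 => E; have -> : mu * (s2 * (s0 ^+ 2 * x1)) = mu * s0 * s2 * s0 * x1 by ring.
    by rewrite E !mul0r oner_neq0.
  have [||v0 v2] := v02.
  - have s00 : s0 != 0 by apply: contra n0 => /eqP ->; rewrite mulr0 mul0r.
    by apply: (mulfI (mulf_neq0 mu0 (expf_neq0 2 s00))); rewrite mulr0 -mulrA -F3.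
  - have s20 : s2 != 0 by apply: contra n0 => /eqP ->; rewrite mulr0.
    by apply: (mulfI (mulf_neq0 mu0 (expf_neq0 2 s20))); rewrite mulr0 -mulrA -F4.
  (* [F1] and [F2] give mu^2 (s0 s2)^3 x1 x2 = - 1; with x1^2 = x2^2 = 1, the cube of this t is mu
     times the cube of [v i1 0]. *)
  exists (- (x1 * x2 * mu * s0 * s2 * v i1 0)).
  have F5' : b' = mu * b * v i1 0 ^+ 3 by apply: oppr_inj; rewrite F5 cE v0 v2; ring.
  transitivity (- (x1 ^+ 2 * x2 ^+ 2 * (mu * (s2 * (s0 ^+ 2 * x1))) * (mu * (s0 * (s2 ^+ 2 * x2))) * b')).
    by rewrite x11 x22 -F1 -F2; ring.
  by rewrite F5'; ring.
have Z u : A *m e_ K i0 = s0 *: u -> A *m e_ K i2 = s2 *: u -> cvec (flexes b 0) u = 0 -> False.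
  move=> E0' E2' fu; move/eqP: F1.
  by rewrite E0' E2' polZ polZl pol_diag fu mul0rn !mulr0 oner_eq0.
have [f0 f2 f02] := flexes_vertices b 0.
have q0 w : pol (flexes b 0) (e_ K i0) w = w i2 0 by rewrite p !e_E /=; ring.
have q2 w : pol (flexes b 0) (e_ K i2) w = - w i0 0 by rewrite p !e_E /=; ring.
have q02 w : pol (flexes b 0) (e_ K i0 + e_ K i2) w = w i0 0 - w i2 0.
  by rewrite p !mxE /=; ring.
have n (x : K) : - x = 0 -> x = 0 by move=> E; rewrite -[x]opprK E oppr0.
case: E0 => E0; case: E2 => E2; try by [case: (Z _ E0 E2)].
all: apply: (H _ _ E0 E2); rewrite !(q0, q2, q02) ?mxE /=; try by ring.
- by move=> -> /n ->.
- by move=> ->; rewrite subr0.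
- by move=> /n -> ->.
- by move=> /n ->; rewrite sub0r => /n ->.
- by move=> E E'; move: E; rewrite E' subr0.
- by move=> E /n E'; move: E; rewrite E' sub0r => /n.
Qed.

End Inequivalence.

Lemma triangle_poly (K : finFieldType) (b c : K) : cpoly (triangle b c) =
  vX ^+ 2 * vZ + vX * vY ^+ 2 + b *: (vY * vZ ^+ 2) + c *: (vX * vY * vZ).
Proof.
have E (R : comNzRingType) (x y z r s : R) : ceval (Cubic 0 0 0 0 1 1 0 0 r s) x y z =
    x ^+ 2 * z + x * y ^+ 2 + r * (y * z ^+ 2) + s * (x * y * z).
  by rewrite /ceval /=; ring.
by rewrite /cpoly /triangle /cmap /= mpolyC0 mpolyC1 E !mul_mpolyC.
Qed.

Lemma flexes_poly (K : finFieldType) (b c : K) : cpoly (flexes b c) =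
  vX ^+ 2 * vZ - vX * vZ ^+ 2 - c *: (vX * vY * vZ) - b *: vY ^+ 3.
Proof.
have E (R : comNzRingType) (x y z r s : R) : ceval (Cubic 0 r 0 0 1 0 0 (- 1) 0 s) x y z =
    x ^+ 2 * z - x * z ^+ 2 + s * (x * y * z) + r * y ^+ 3.
  by rewrite /ceval /=; ring.
rewrite /cpoly /flexes /cmap /= !mpolyCN mpolyC0 mpolyC1 E.
by rewrite !mulNr !mul_mpolyC.
Qed.

(** The unsolvable pairs form a single orbit under (b, c) -> (t^3 b, t c). One orbit gives one class
    of each normal form, hence two classes. *)
Definition unique_nonsum (K : finFieldType) (b0 c0 : K) := nonsum b0 c0 /\
  forall b c, b != 0 -> ~ sum_prod c b ->
    exists t, [/\ t != 0, b0 = t ^+ 3 * b & c0 = t * c].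

(** * Fields of prime order *)

Section PrimeFields.
Variables (K : finFieldType) (p : nat).
Hypotheses (Kp : #|K| = p) (p_pr : prime p).

Lemma pchar_card : p \in [pchar K].
Proof. by rewrite inE p_pr /= -Kp card_natr. Qed.

Lemma natr_eq m n : ((m%:R : K) == n%:R) = (m == n %[mod p]).
Proof.
wlog le : m n / (m <= n)%N.
  by move=> H; case/orP: (leq_total m n) => /H //; rewrite eq_sym => ->; rewrite eq_sym.
by rewrite eq_sym [in RHS]eq_sym eqn_mod_dvd // -subr_eq0 -natrB // -(dvdn_pcharf pchar_card).
Qed.

Lemma natr_onto (x : K) : exists2 n, n \in iota 0 p & x = n%:R.
Proof.
have inj : injective (fun i : 'I_p => (i : nat)%:R : K).
  by move=> i j /eqP; rewrite natr_eq !modn_small // => /eqP /val_inj.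
have [|g _ gK] := inj_card_bij inj; first by rewrite card_ord Kp.
by exists (g x : nat); rewrite ?gK // mem_iota /=.
Qed.

(** K is an abstract field with p elements, so the search is run on natural numbers modulo p, where
    it computes. *)
Definition solvable_mod (c b : nat) :=
  has (fun x => has (fun y => has (fun z =>
    (x + y + z == c %[mod p]) && (x * y * z == b %[mod p])) (iota 0 p)) (iota 0 p)) (iota 0 p).

Lemma solvable_modP c b : reflect (sum_prod (c%:R : K) b%:R) (solvable_mod c b).
Proof.
apply: (iffP hasP) => [[x _ /hasP [y _ /hasP [z _ /andP [s pr]]]]|].
  by exists x%:R, y%:R, z%:R; rewrite -!natrD -!natrM; split; apply/eqP; rewrite natr_eq.
case=> [x [y [z []]]]; have [i hi ->] := natr_onto x; have [j hj ->] := natr_onto y.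
have [k hk ->] := natr_onto z; rewrite -!natrD -!natrM => /eqP; rewrite natr_eq => s.
move/eqP; rewrite natr_eq => pr.
by exists i => //; apply/hasP; exists j => //; apply/hasP; exists k => //; rewrite s pr.
Qed.

Definition check_mod (b0 c0 : nat) :=
  [&& b0 != 0 %[mod p], c0 ^ 3 != 27 * b0 %[mod p], ~~ solvable_mod c0 b0 &
    all (fun b => all (fun c => [|| b == 0 %[mod p], solvable_mod c b |
      has (fun t => [&& t != 0 %[mod p], b0 == t ^ 3 * b %[mod p] & c0 == t * c %[mod p]])
        (iota 0 p)]) (iota 0 p)) (iota 0 p)].

Lemma check_unique b0 c0 : check_mod b0 c0 -> unique_nonsum (b0%:R : K) c0%:R.
Proof.
case/and4P=> hb hbc hs hall; split.
  split.
  - by rewrite -[0]/(0%:R) natr_eq.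
  - by rewrite -natrX -mulrnA subr_eq0 mulnC natr_eq.
  - exact/solvable_modP.
move=> b c; have [i hi ->] := natr_onto b; have [j hj ->] := natr_onto c => bi0 nij.
move/allP: hall => /(_ _ hi) /allP /(_ _ hj) /or3P [i0'|/solvable_modP //|].
  by move: bi0; rewrite -[0]/(0%:R) natr_eq i0'.
case/hasP=> t _ /and3P [t0 /eqP Eb /eqP Ec]; exists t%:R.
by split; [rewrite -[0]/(0%:R) natr_eq|apply/eqP; rewrite -natrX -natrM natr_eq Eb
  |apply/eqP; rewrite -natrM natr_eq Ec].
Qed.
End PrimeFields.

Lemma two_classes (K : finFieldType) (b0 c0 b1 c1 : K) :
  unique_nonsum b0 c0 -> unique_nonsum b1 c1 ->
  classes_represented_by [:: cpoly (triangle b0 (- c0)); cpoly (flexes b1 c1)].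
Proof.
move=> [n0 u0] [n1 u1]; split=> [F|].
  by rewrite !inE => /orP [] /eqP ->; [exact: triangle_two|exact: flexes_two].
split=> [i [|[|j]] // /andP [] //|G /two_ldr_normal_form].
  by case: i => //= _ _ /proj_equiv_cpoly; exact: triangle_flexes.
move=> [f [b [c [-> b_0 ns [e|e]]]]].
  have [t [t0 Eb Ec]] := u0 _ _ b_0 ns.
  exists (cpoly (triangle b0 (- c0))); first by rewrite mem_head.
  apply/proj_equiv_cpoly; apply: cequiv_trans e; apply: cequiv_sym.
  by rewrite Eb Ec -mulrN; exact: triangle_scale.
have [t [t0 Eb Ec]] := u1 _ _ b_0 ns.
exists (cpoly (flexes b1 c1)); first by rewrite !inE eqxx orbT.
apply/proj_equiv_cpoly; apply: cequiv_trans e; apply: cequiv_sym.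
by rewrite Eb Ec; exact: flexes_scale.
Qed.

Lemma mem_seq4 (T : eqType) (x y z t : T) (s := [:: x; y; z; t]) :
  [/\ x \in s, y \in s, z \in s & t \in s].
Proof. by rewrite !inE !eqxx !orbT. Qed.

(** * The field with four elements *)

Section FieldOfFour.
Variables (K : finFieldType) (w : K).
Hypotheses (K4 : #|K| = 4%N) (w_root : w ^+ 2 + w + 1 = 0).

Lemma F4_two : 2%:R = 0 :> K.
Proof.
have /eqP := card_natr K; rewrite K4 (natrM _ 2 2) mulf_eq0 orbb => /eqP //.
Qed.

Lemma F4_opp (x : K) : - x = x.
Proof. by apply/esym/eqP; rewrite -addr_eq0 -mulr2n -mulr_natr F4_two mulr0. Qed.

Lemma F4_elements (x : K) : [\/ x = 0, x = 1, x = w | x = w + 1].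
Proof.
have : x * ((x - 1) * ((x - w) * (x + w + 1))) = 0.
  transitivity (x ^+ 4 - x - x * (x - 1) * (w ^+ 2 + w + 1)); first by ring.
  by rewrite w_root mulr0 subr0 -{1}K4 expf_card subrr.
move/eqP; rewrite !mulf_eq0 !subr_eq0 -addrA addr_eq0 F4_opp.
by case/or4P=> /eqP; [constructor 1|constructor 2|constructor 3|constructor 4].
Qed.

Lemma F4_cube (x : K) : x != 0 -> x ^+ 3 = 1.
Proof. by move=> x0; apply: (mulfI x0); rewrite -exprS -{1}K4 expf_card mulr1. Qed.

(** A solution with sum 0 has z = x + y with x != y. As x^3 = y^3 = 1, also x^2 + x y + y^2 = 0, so
    x y z = x (x y + y^2) = x^3 = 1. *)
Lemma F4_nonsum (b : K) : b != 0 -> b != 1 -> nonsum b 0.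
Proof.
move=> b0 b1; split=> //.
  have -> : 0 ^+ 3 - b *+ 27 = b - 2%:R * (b *+ 14) by ring.
  by rewrite F4_two mul0r subr0.
move=> [x [y [z [s pr]]]].
have [x0 y0] : x != 0 /\ y != 0.
  by split; apply: contra b0 => /eqP E; rewrite -pr E ?mulr0 ?mul0r.
have ez : z = x + y.
  by apply/eqP; rewrite -[x + y]F4_opp -addr_eq0 addrC s.
have xy : x != y.
  apply: contra b0 => /eqP E; rewrite -pr ez E -mulr2n -[_ *+ 2]mulr_natr F4_two.
  by rewrite !mulr0.
have E : x ^+ 2 + x * y + y ^+ 2 = 0.
  have xy' : x - y != 0 by rewrite subr_eq0.
  apply: (mulfI xy'); rewrite mulr0 -(subrr (1 : K)) -{1}(F4_cube x0) -(F4_cube y0); ring.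
case/eqP: b1; rewrite -pr ez -[RHS](F4_cube x0) -[RHS]F4_opp.
apply: subr0_eq; transitivity (x * (x ^+ 2 + x * y + y ^+ 2)); first by ring.
by rewrite E mulr0.
Qed.

(** For c != 0, scaling by c reduces to c = 1 and leaves b unchanged because c^3 = 1; explicit
    solutions then exist for each b. *)
Lemma F4_sum (b c : K) : b != 0 -> ~ sum_prod c b -> c = 0 /\ (b = w \/ b = w + 1).
Proof.
move=> b0 ns; have ww : w ^+ 2 = w + 1.
  by apply/eqP; rewrite -[w + 1]F4_opp -addr_eq0 addrA w_root.
have [c0|c0] := eqVneq c 0.
  split=> //; have [E|E|E|E] := F4_elements b; [by rewrite E eqxx in b0| |by left|by right].
  case: ns; exists 1, w, (w + 1); rewrite c0 E; split.
    by rewrite -[RHS]w_root ww; ring.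
  by rewrite mul1r mulrDr mulr1 -expr2 ww addrAC -mulr2n -mulr_natr F4_two mulr0 add0r.
case: ns; suff [x [y [z [s pr]]]] : sum_prod 1 b.
  exists (c * x), (c * y), (c * z); rewrite -!mulrDr s mulr1; split=> //.
  by rewrite -[RHS]mul1r -(F4_cube c0) -pr; ring.
have two (x : K) : x + x = 0 by rewrite -mulr2n -mulr_natr F4_two mulr0.
have [E|E|E|E] := F4_elements b; first by rewrite E eqxx in b0.
- by exists 1, 1, 1; rewrite two add0r !mulr1.
- exists (w + 1), (w + 1), 1; rewrite two add0r mulr1; split=> //.
  rewrite E; transitivity (w ^+ 2 + (w + w) + 1); first by ring.
  by rewrite two addr0 ww -addrA two addr0.
- by exists w, w, 1; rewrite two add0r mulr1 -expr2 ww.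
Qed.

(** All nonzero cubes are 1, so scaling never identifies b = w with b = w + 1: there are two orbits,
    each with two normal forms. *)
Lemma F4_classes : classes_represented_by [:: cpoly (triangle w 0); cpoly (triangle (w + 1) 0);
  cpoly (flexes w 0); cpoly (flexes (w + 1) 0)].
Proof.
have w0 : w != 0.
  by apply: contra_eq_neq w_root => ->; rewrite expr0n /= !add0r oner_neq0.
have ww : w != w + 1 by rewrite -{1}[w]addr0 (inj_eq (addrI w)) eq_sym oner_neq0.
have w1 : w != 1.
  by apply: contra_eq_neq w_root => ->; rewrite expr1n -(mulr2n 1) F4_two add0r oner_neq0.
have n0 : nonsum w 0 by apply: F4_nonsum.
have n1 : nonsum (w + 1) 0.
  apply: F4_nonsum; first by rewrite addr_eq0 F4_opp.
  by rewrite -subr_eq0 addrK.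
have cub t : w + 1 <> t ^+ 3 * w.
  have [->|/F4_cube ->] := eqVneq t 0; last by move/eqP; rewrite mul1r eq_sym (negPf ww).
  by rewrite expr0n mul0r => /eqP; rewrite addr_eq0 F4_opp (negPf w1).
split=> [F|].
  have t2 b : nonsum b 0 -> two_ldr_cubic (cpoly (triangle b 0)).
    by move=> /triangle_two; rewrite oppr0.
  by rewrite !inE => /or4P [] /eqP ->; [exact: t2..|exact: flexes_two|exact: flexes_two].
split=> [i [|[|[|[|j]]]] // /andP [] //|G /two_ldr_normal_form].
- case: i => //= _ _ /proj_equiv_cpoly /triangle_triangle.
  by rewrite oppr0 => /(_ n0) [t [/cub]].
- by case: i => [|[|]] //= _ _ /proj_equiv_cpoly; exact: triangle_flexes.
- case: i => [|[|[|]]] //= _ _ /proj_equiv_cpoly; [exact: triangle_flexes..|].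
  by case/flexes_flexes => // t /cub.
move=> [f [b [c [-> b_0 ns e]]]]; have [c0 hb] := F4_sum b_0 ns; subst c.
have [m0 m1 m2 m3] := mem_seq4 (cpoly (triangle w 0)) (cpoly (triangle (w + 1) 0))
  (cpoly (flexes w 0)) (cpoly (flexes (w + 1) 0)).
move: e; rewrite oppr0; case: hb => -> [] /proj_equiv_cpoly e.
- eexists; [exact: m0|exact: e].
- eexists; [exact: m2|exact: e].
- eexists; [exact: m1|exact: e].
- eexists; [exact: m3|exact: e].
Qed.
End FieldOfFour.

Lemma no_two_classes (K : finFieldType) (F : {mpoly K[3]}) : (7 < #|K|)%N ->
  smooth_plane_cubic F -> ~ exactly_two_ldr_classes F.
Proof.
move=> K8 sm two; have [f [b [c [_ b0 ns _]]]] := two_ldr_normal_form (conj sm two).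
by apply: ns; apply: sum_prod_exists.
Qed.

Theorem theorem6p3 (K : finFieldType) :
  ((7 < #|K|)%N -> forall F : {mpoly K[3]}, smooth_plane_cubic F ->
      ~ exactly_two_ldr_classes F) /\
  (#|K| = 2%N -> classes_represented_by (K := K)
     [:: vX^+2 * vZ + vX * vY^+2 + vY * vZ^+2;
         vX^+2 * vZ + vX * vZ^+2 + vY^+3]) /\
  (#|K| = 3%N -> classes_represented_by (K := K)
     [:: vX^+2 * vZ + vX * vY^+2 + vY * vZ^+2 + 2%:R *: (vX * vY * vZ);
         vX^+2 * vZ - vX * vZ^+2 - vX * vY * vZ - vY^+3]) /\
  (#|K| = 4%N -> forall w : K, w ^+ 2 + w + 1 = 0 -> classes_represented_by (K := K)
     [:: vX^+2 * vZ + vX * vY^+2 + w *: (vY * vZ^+2);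
         vX^+2 * vZ + vX * vY^+2 + (w + 1) *: (vY * vZ^+2);
         vX^+2 * vZ + vX * vZ^+2 + w *: vY^+3;
         vX^+2 * vZ + vX * vZ^+2 + (w + 1) *: vY^+3]) /\
  (#|K| = 5%N -> classes_represented_by (K := K)
     [:: vX^+2 * vZ + vX * vY^+2 + vY * vZ^+2 - 2%:R *: (vX * vY * vZ);
         vX^+2 * vZ - vX * vZ^+2 - 2%:R *: (vX * vY * vZ) - vY^+3]) /\
  (#|K| = 7%N -> classes_represented_by (K := K)
     [:: vX^+2 * vZ + vX * vY^+2 + 3%:R *: (vY * vZ^+2);
         vX^+2 * vZ - vX * vZ^+2 + 3%:R *: vY^+3]).
Proof.
split; first by move=> K8 F; exact: no_two_classes.
split=> [K2|].
  have T : unique_nonsum (1 : K) 0 by apply: (@check_unique K 2 K2 isT 1 0).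
  have o : -1 = 1 :> K by rewrite (oppr_pchar2 (pchar_card K2 isT)).
  have := two_classes T T; rewrite triangle_poly flexes_poly oppr0 !scale1r scale0r addr0.
  have om (P : {mpoly K[3]}) : - P = P by rewrite -scaleN1r o scale1r.
  by rewrite subr0 !om.
split=> [K3|].
  have T : unique_nonsum (1 : K) 1 by apply: (@check_unique K 3 K3 isT 1 1).
  have o : -1 = 2%:R :> K.
    by apply/eqP; rewrite eq_sym -subr_eq0 opprK -(natrD _ 2 1) -[(2 + 1)%N]/3%N -K3 card_natr.
  by have := two_classes T T; rewrite triangle_poly flexes_poly !scale1r -o.
split=> [K4 w ww|].
  have := F4_classes K4 ww; rewrite !triangle_poly !flexes_poly.
  rewrite !scale0r !addr0 !subr0.
  have om (P : {mpoly K[3]}) : - P = P by rewrite -scaleN1r (F4_opp K4) scale1r.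
  by rewrite !om.
split=> [K5|K7].
  have T : unique_nonsum (1 : K) 2%:R by apply: (@check_unique K 5 K5 isT 1 2).
  by have := two_classes T T; rewrite triangle_poly flexes_poly !scale1r scaleNr.
have T1 : unique_nonsum (3%:R : K) 0 by apply: (@check_unique K 7 K7 isT 3 0).
(* The pair (4, 0) lies in the same orbit as (3, 0); it is chosen because the second representative
   is displayed with + 3 Y^3, that is b = - 3. *)
have T2 : unique_nonsum (4%:R : K) 0 by apply: (@check_unique K 7 K7 isT 4 0).
have o : 4%:R = - 3%:R :> K.
  by apply/eqP; rewrite -subr_eq0 opprK -natrD -[(4 + 3)%N]/7%N -K7 card_natr.
have := two_classes T1 T2; rewrite triangle_poly flexes_poly o oppr0 !scale0r.
by rewrite scaleNr opprK addr0 subr0.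
Qed.
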